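(* Let $x=p/q$ with $p\in\mathbb Z$, $q\in\mathbb N$, $\gcd(p,q)=1$, and let $\theta=7/64$. Let $\{y_n\}_{n\in\mathbb N}$ be positive numbers with $y_n\asymp n^{-\alpha}$ for some fixed $\alpha\in[\tfrac{2}{1+2\theta},2)$. Then $\delta_{n,x,y_n}\to\mu_{\mathcal M}$ weakly as $n\to\infty$ along $n\in\mathbb N_q$, and $\delta^{\rm pr}_{n,x,y_n}\to\mu_{\mathcal M}$ weakly as $n\to\infty$ along $n\in\mathbb N_q^{\rm pr}$, where $\mathbb N_q=\{n\in\mathbb N:\gcd(n^2,q)\mid n\}$ and $\mathbb N_q^{\rm pr}=\{n\in\mathbb N:\gcd(n,q)=1\}$.
   Context: $\mathcal M=\mathrm{SL}_2(\mathbb Z)\backslash\mathbb H$ is the modular surface, $\Gamma=\mathrm{SL}_2(\mathbb Z)$, and $\mu_{\mathcal M}$ is the normalized hyperbolic area, $d\mu_{\mathcal M}=\frac{3}{\pi}\frac{dx\,dy}{y^2}$. For $n\in\mathbb N$, $x\in\mathbb R/\mathbb Z$, $y>0$, $\delta_{n,x,y}$ is the probability measure $\frac1n\sum_{j=0}^{n-1}\delta_{\Gamma(x+j/n+iy)}$ and $\delta^{\rm pr}_{n,x,y}=\frac{1}{\varphi(n)}\sum_{j\in(\mathbb Z/n\mathbb Z)^\times}\delta_{\Gamma(x+j/n+iy)}$ on $\mathcal M$. Weak convergence means convergence against every $\Psi\in C_c^\infty(\mathcal M)$ (equivalently $C_c(\mathcal M)$). $A\asymp B$ means $A\ll B\ll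 A$. *)

(* Defs.v *)
From HB Require Import structures.
From mathcomp Require Import all_boot all_order all_algebra.
From mathcomp Require Import all_classical all_reals all_analysis.
Set Implicit Arguments. Unset Strict Implicit. Unset Printing Implicit Defensive.
Import Order.TTheory GRing.Theory Num.Theory.
Import numFieldNormedType.Exports.
Local Open Scope classical_set_scope.
Local Open Scope ring_scope.

(* Points z = x + i y of C are represented by pairs (x, y) : R * R. *)
Definition upper_half (R : realType) : set (R * R) := [set z | 0 < z.2].

Record SL2Z := mkSL2Z {
  sl_a : int; sl_b : int; sl_c : int; sl_d : int;
  sl_det : sl_a * sl_d - sl_b * sl_c == 1 }.

(* Moebius action g.z = (a z + b)/(c z + d), written in coordinates. *)
Definition mob (R : realType) (g : SL2Z) (z : R * R) : R * R :=
  let a := (sl_a g)%:~R in let b := (sl_b g)%:~R in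
  let c := (sl_c g)%:~R in let d := (sl_d g)%:~R in
  let x := z.1 in let y := z.2 in
  let den := (c * x + d) ^+ 2 + (c * y) ^+ 2 in
  (((a * x + b) * (c * x + d) + a * c * y ^+ 2) / den, y / den).

(* Psi in C_c(M) = SL_2(Z)\H, viewed as a Gamma-invariant function on H that is
   continuous on H and whose support is compact modulo Gamma (i.e. contained in
   Gamma K for a compact K subset of H).  Values outside H are irrelevant. *)
Definition test_fun (R : realType) (f : R * R -> R) : Prop :=
  [/\ (forall z, @upper_half R z -> {for z, continuous f}),
      (forall (g : SL2Z) z, @upper_half R z -> f (mob g z) = f z) &
      exists K : set (R * R),
        [/\ compact K, K `<=` @upper_half R &
            forall z, @upper_half R z -> f z != 0 -> exists g : SL2Z, K (mob g z)]].

Definition fund_dom (R : realType) : set (R * R) :=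
  [set z | - (1/2) <= z.1 <= 1/2 /\ 1 <= z.1 ^+ 2 + z.2 ^+ 2 /\ 0 < z.2].

Definition mu_M (R : realType) (f : R * R -> R) : R :=
  3 / pi * Rintegral ((@lebesgue_measure R) \x (@lebesgue_measure R))%E
                     (@fund_dom R) (fun z => f z / z.2 ^+ 2).

Definition delta_nxy (R : realType) (n : nat) (x y : R) (f : R * R -> R) : R :=
  (n%:R)^-1 * \sum_(j < n) f (x + j%:R / n%:R, y).

Definition delta_pr_nxy (R : realType) (n : nat) (x y : R) (f : R * R -> R) : R :=
  ((totient n)%:R)^-1 * \sum_(j < n | coprime j n) f (x + j%:R / n%:R, y).

Definition conv_along (R : realType) (P : pred nat) (u : nat -> R) (l : R) : Prop :=
  forall e : R, 0 < e -> exists N : nat, forall n : nat, (N <= n)%N -> P n -> `|u n - l| < e.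

Definition N_q (q : nat) : pred nat := fun n => (0 < n)%N && (gcdn (n ^ 2) q %| n)%N.
Definition N_q_pr (q : nat) : pred nat := fun n => (0 < n)%N && coprime n q.

Definition theta (R : realType) : R := 7 / 64.

(* Main.v *)
Require Import Defs.
From HB Require Import structures.
From mathcomp Require Import all_boot all_order all_algebra.
From mathcomp Require Import all_classical all_reals all_analysis.
From mathcomp Require Import measurable_realfun.
From mathcomp Require cyclic.
From mathcomp Require Import zify ring lra.
Set Implicit Arguments. Unset Strict Implicit. Unset Printing Implicit Defensive.
Import Order.TTheory GRing.Theory Num.Theory.
Import numFieldNormedType.Exports.
Local Open Scope classical_set_scope.
Local Open Scope ring_scope.

(* For [N = qd] and [m] coprime to [N], the points [m/N + iy] and
   [-m'/N + i/(N^2 y)], with [m m' = 1] mod [N], agree modulo SL_2(Z).  When [d] is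
   coprime to [q] this carries the primitive points of denominator [d] at height
   [y] to primitive points at height [Y = 1/((qd)^2 y)], which is now so large that
   [phi(d) Y] exceeds [2^omega(d)] by any constant factor, because [alpha] is at
   least [3/2].  For such points a box [B] of the fundamental domain is treated by
   unfolding: a point [x + J/d + iY] is sent to [B] by a matrix with bottom row
   [(c, e)] iff [c^2 Y], [a/c] and [tau = (x + J/d + e/c)/Y] satisfy explicit
   inequalities, so that the hits are counted by coprime pairs [(a, c)] in a planar
   region and, for each of them, by the [J] coprime to [d] in a short interval.
   Both are sieve problems.  Only lower bounds are needed: applied to [M + f] and
   [M - f] they yield convergence, since the area of the fundamental domain is
   [pi/3].  The full average is a sum of primitive averages over the divisors [d] of
   [n], in which small [d] do not matter. *)

(** At the original height [y] a pair [(a, c)] selects about phi(d) y values of [J], which tends to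
    zero, against a sieve error of 2^omega(d). After the inversion it selects about phi(d) / (d^2 y)
    values, a positive power of n for every d up to n, and this beats the error. The bound alpha < 2
    makes the new height tend to zero when d is close to n, so that the pairs [(a, c)], about 1/Y in
    number, can themselves be counted. The condition defining [N_q] allows [x] to be written as a
    fraction of denominator coprime to n plus a multiple of 1/n, so that the inversion applies to
    every divisor of n.

    Lower bounds may discard mass near the cusp and along box edges, but their constant has to be
    exact, or the bounds for M + f and M - f would not meet. It is: coprime pairs have density
    6/pi^2, the summation over [c] gives a factor 1/2 as in the integral of c dc, and the integral
    of 1/(1 + tau^2) is pi. The product is 3/pi, the inverse of the area. *)

(* Legendre's sieve: [cnt ps X] counts points of a region scaled by [X] that are
   divisible by no prime of [ps], so removing the multiples of one more prime [p]
   subtracts the count for the region scaled by [X / p]. *)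
Lemma sieve_bound (R : realType) (cnt : seq nat -> R -> R) (err : R -> R)
    (e : nat) (kappa X0 : R) :
  (forall X Y, 0 <= X -> X <= Y -> err X <= err Y) ->
  (forall X, 0 <= X -> X <= X0 -> `|cnt [::] X - kappa * X ^+ e| <= err X) ->
  (forall p ps X, prime p -> p \notin ps -> all prime ps -> 0 <= X -> X <= X0 ->
     cnt (p :: ps) X = cnt ps X - cnt ps (X / p%:R)) ->
  forall ps X, uniq ps -> all prime ps -> 0 <= X -> X <= X0 ->
  `|cnt ps X - kappa * X ^+ e * \prod_(p <- ps) (1 - (p%:R ^+ e)^-1)|
    <= 2 ^+ size ps * err X.
Proof.
move=> err_mono base rec; elim=> [|p ps IH] X.
  by move=> _ _ X_ge0 XX0; rewrite big_nil mulr1 mul1r; exact: base.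
move=> /andP[pps ups] /andP[p_pr ps_pr] X_ge0 XX0.
have p_gt1 : 1 <= p%:R :> R by rewrite ler1n prime_gt0.
have p_gt0 : 0 < p%:R :> R by rewrite ltr0n prime_gt0.
have Xp_ge0 : 0 <= X / p%:R by rewrite divr_ge0.
have XpX : X / p%:R <= X by rewrite ler_pdivrMr // ler_peMr.
rewrite rec // big_cons /=.
have H1 := IH X ups ps_pr X_ge0 XX0.
have H2 := IH (X / p%:R) ups ps_pr Xp_ge0 (le_trans XpX XX0).
have H3 : 2 ^+ size ps * err (X / p%:R) <= 2 ^+ size ps * err X.
  by rewrite ler_wpM2l ?exprn_ge0 // err_mono.
set P := \prod_(_ <- _) _ in H1 H2 *.
rewrite [X in `|X|](_ : _ = (cnt ps X - kappa * X ^+ e * P)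
    - (cnt ps (X / p%:R) - kappa * (X / p%:R) ^+ e * P)); last first.
  by rewrite exprMn exprVn; ring.
rewrite (_ : 2 ^+ _ * _ = 2 ^+ size ps * err X + 2 ^+ size ps * err X); last first.
  by rewrite exprS; ring.
apply: (le_trans (ler_normB _ _)); apply: lerD => //.
exact: le_trans H2 H3.
Qed.

(** * Integers coprime to n in an interval *)

Lemma big_dvdn_nat (T : Type) (idx : T) (op : Monoid.law idx) (p M : nat)
    (F : nat -> T) : (0 < p)%N ->
  \big[op/idx]_(0 <= a < p * M | (p %| a)%N) F a = \big[op/idx]_(0 <= a < M) F (p * a)%N.
Proof.
move=> p_gt0; elim: M => [|M IH]; first by rewrite muln0 !big_geq.
rewrite big_nat_recr //= mulnS addnC.
rewrite (@big_cat_nat _ _ _ (p * M)) ?leq_addr //= IH; congr (op _ _).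
rewrite big_ltn_cond; last by rewrite -ltn_subLR // subnn.
rewrite dvdn_mulr // big_nat_cond big1 ?Monoid.mulm1 // => i /andP[/andP[i1 i2] /dvdnP[k kE]].
move: i1 i2; rewrite kE [(k * p)%N]mulnC ltn_pmul2l // addnC -mulnS ltn_pmul2l //.
by lia.
Qed.

(** The common range [N] on both sides lets the sieve recursion compare the scales [X] and [X / p]
    without resizing any sum. *)
Lemma sum_dvdn_supp (p N : nat) (F : nat -> nat) : (0 < p)%N ->
  (forall a, (N <= a)%N -> F a = 0%N) ->
  (\sum_(a < N | p %| a) F a = \sum_(a < N) F (p * a)%N)%N.
Proof.
move=> p_gt0 F0; rewrite -[RHS](big_mkord xpredT (fun a => F (p * a)%N)).
rewrite -big_dvdn_nat // -(big_mkord (fun a => p %| a)%N F).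
rewrite (@big_cat_nat _ _ _ N 0 (p * N)) ?leq_pmull //=.
rewrite [X in (_ + X)%N]big_nat_cond [X in (_ + X)%N]big1 ?addn0 //.
by move=> i /andP[/andP[/F0 ->]].
Qed.

Lemma ex_nat_ceil (R : realType) (x : R) : 0 <= x ->
  exists m : nat, [/\ x <= m%:R, m%:R < x + 1 & forall k : nat, (k%:R < x) = (k < m)%N].
Proof.
move=> x_ge0; exists (`|Num.ceil x|%N).
have c_ge0 : 0 <= Num.ceil x by rewrite ceil_ge0; lra.
have cE : (`|Num.ceil x|%N)%:R = (Num.ceil x)%:~R :> R.
  by rewrite natr_absz (ger0_norm c_ge0).
have /andP[h1 h2] := ceil_itv x.
rewrite !cE; split => //.
  by rewrite -ltrBlDr -[1]/(1%:~R) -rmorphB.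
move=> k; rewrite -[k%:R]/(k%:Z%:~R) -ceil_gt_int.
by rewrite -{1}(gez0_abs c_ge0).
Qed.

Lemma count_interval (R : realType) (lo hi : R) (N : nat) :
  0 <= lo -> lo <= hi -> hi <= N%:R ->
  `|(\sum_(J < N) (lo <= J%:R < hi)%R)%N%:R - (hi - lo)| <= 1.
Proof.
move=> lo0 lohi hiN.
have [m [m1 m2 mE]] := ex_nat_ceil lo0.
have [k [k1 k2 kE]] := ex_nat_ceil (le_trans lo0 lohi).
have mk : (m <= k)%N.
  by rewrite leqNgt -mE -leNgt; lra.
have kN : (k <= N)%N by rewrite leqNgt -kE -leNgt.
rewrite (eq_bigr (fun J : 'I_N => (m <= J < k)%N : nat)); last first.
  by move=> J _; rewrite kE leNgt mE -leqNgt.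
rewrite -(big_mkord xpredT (fun J => (m <= J < k)%N : nat)).
rewrite (@big_cat_nat _ _ _ k) //= (@big_cat_nat _ _ _ m 0 k) //=.
rewrite big_nat_cond big1; last by move=> i; case: ltnP => //; lia.
rewrite (eq_big_nat _ _ (F2 := fun=> 1%N)); last by move=> i /andP[-> ->].
rewrite sum_nat_const_nat muln1 big_nat_cond big1; last first.
  by move=> i; case: (ltnP i k) => //; lia.
rewrite add0n addn0 natrB //; rewrite ler_norml; apply/andP; split; lra.
Qed.

Lemma coprime_all_primes (J n : nat) : (0 < n)%N ->
  coprime J n = all (fun p => ~~ (p %| J)%N) (primes n).
Proof.
move=> n0; apply/idP/allP => [co p|H].
  rewrite mem_primes => /and3P[p_pr _ pn]; apply/negP => pJ.
  have : (p %| gcdn J n)%N by rewrite dvdn_gcd pJ.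
  by rewrite (eqP co) dvdn1 => /eqP p1; rewrite p1 in p_pr.
rewrite /coprime eqn_leq gcdn_gt0 n0 orbT andbT leqNgt; apply/negP => g1.
have /H/negP[] : pdiv (gcdn J n) \in primes n.
  by rewrite mem_primes pdiv_prime // n0 (dvdn_trans (pdiv_dvd _)) // dvdn_gcdr.
by rewrite (dvdn_trans (pdiv_dvd _)) // dvdn_gcdl.
Qed.

Lemma totient_prod (R : realType) (n : nat) : (0 < n)%N ->
  (totient n)%:R = n%:R * \prod_(p <- primes n) (1 - (p%:R)^-1) :> R.
Proof.
move=> n0.
have nE : n%:R = \prod_(p <- primes n) (p ^ logn p n)%N%:R :> R.
  by rewrite -natr_prod {1}(prod_prime_decomp n0) prime_decompE big_map.
rewrite nE totientE // natr_prod -big_split /=.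
apply: eq_big_seq => p; rewrite mem_primes => /and3P[p_pr _ pn].
have p0 : p%:R != 0 :> R by rewrite pnatr_eq0 -lt0n prime_gt0.
rewrite /= -{2}[logn p n]prednK ?logn_gt0 ?mem_primes ?p_pr ?n0 //.
rewrite natrM -subn1 natrB ?prime_gt0 // expnS natrM.
by field.
Qed.

Lemma sum_dvdn_split (N p : nat) (P : nat -> bool) :
  (\sum_(J < N) P J = \sum_(J < N) (P J && ~~ (p %| J)) + \sum_(J < N | p %| J) P J)%N.
Proof.
rewrite [X in (_ + X)%N]big_mkcond -big_split /=; apply: eq_bigr => J _.
by case: (P J); case: (p %| J)%N.
Qed.

(** [sieve_bound] in dimension one with [X0 = 1]: shrunken copies of the interval stay below [N],
    the Euler product over [primes n] is phi(n)/n, and each of the 2^omega(n) counts is off by at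
    most 1. *)
Lemma coprime_interval (R : realType) (n N : nat) (lo hi : R) :
  (0 < n)%N -> 0 <= lo -> lo <= hi -> hi <= N%:R ->
  `|(\sum_(J < N) ((lo <= J%:R < hi)%R && coprime J n))%N%:R
     - (hi - lo) * ((totient n)%:R / n%:R)| <= 2 ^+ size (primes n).
Proof.
move=> n0 lo0 lohi hiN.
pose cnt (ps : seq nat) (X : R) : R :=
 (\sum_(J < N) ((X * lo <= J%:R < X * hi)%R && all (fun p => ~~ (p %| J)%N) ps))%N%:R.
have n0R : n%:R != 0 :> R by rewrite pnatr_eq0 -lt0n.
have -> : (totient n)%:R / n%:R = \prod_(p <- primes n) (1 - (p%:R ^+ 1)^-1) :> R.
  rewrite totient_prod // mulrAC divff // mul1r.
  by under [RHS]eq_bigr do rewrite expr1.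
have := @sieve_bound R cnt (fun=> 1) 1 (hi - lo) 1 (fun _ _ _ _ => lexx _)
  _ _ (primes n) 1 (primes_uniq n) _ ler01 (lexx _).
rewrite !mulr1 => Hs.
rewrite (eq_bigr (fun J : 'I_N => ((1 * lo <= J%:R < 1 * hi)%R && all (fun p => ~~ (p %| J)%N) (primes n) : nat))); last first.
  by move=> J _; rewrite !mul1r coprime_all_primes.
apply: Hs.
- move=> X X0 X1; rewrite /cnt /= expr1.
  under eq_bigr do rewrite andbT.
  rewrite [(hi - lo) * X](_ : _ = X * hi - X * lo); last by ring.
  by apply: count_interval; [exact: mulr_ge0|exact: ler_wpM2l|nra].
- move=> p ps X p_pr pps ps_pr X0 X1; rewrite /cnt.
  apply/eqP; rewrite -subr_eq opprK -natrD; apply/eqP; congr (_%:R).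
  rewrite (sum_dvdn_split _ p (fun J => (X * lo <= J%:R < X * hi)%R && all (fun p0 => ~~ (p0 %| J)%N) ps)).
  congr addn.
    by apply: eq_bigr => J _ /=; rewrite -!andbA; congr (nat_of_bool (_ && (_ && _))); rewrite andbC.
  rewrite (sum_dvdn_supp (F := fun J => (X * lo <= J%:R < X * hi)%R && all (fun p0 => ~~ (p0 %| J)%N) ps)) ?prime_gt0 //; last first.
    move=> a Na; suff -> : (a%:R < X * hi) = false by rewrite andbF.
    have Na' : N%:R <= a%:R :> R by rewrite ler_nat.
    by apply/negbTE; rewrite -leNgt; nra.
  have p0 : 0 < p%:R :> R by rewrite ltr0n prime_gt0.
  apply: eq_bigr => J _; congr (nat_of_bool (_ && _)).
    by rewrite natrM ![X / _ * _]mulrAC ler_pdivrMr // ltr_pdivlMr // ![_ * p%:R]mulrC.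
  apply: eq_in_all => r rps; congr negb.
  have r_pr := allP ps_pr _ rps.
  rewrite Euclid_dvdM // (dvdn_prime2 r_pr p_pr); case: (r =P p) => // rp.
  by rewrite -rp rps in pps.
- by apply/allP => p; rewrite mem_primes => /andP[].
Qed.

(* [c] plays the role of the bottom left entry of a matrix of SL_2(Z) and [a] of
   its top left entry, so that [a / c] runs through an interval. *)
Definition trap (R : realType) (al be C0 C1 X : R) (a c : nat) : bool :=
  (X * C0 <= c%:R < X * C1) && (al * c%:R <= a%:R < be * c%:R).

(** Telescoping: (w + 1)^-2 is at most 1/w - 1/(w + 1). *)
Lemma sum_sqr_inv_tail (R : realType) (z N : nat) : (0 < z)%N ->
  \sum_(z.+1 <= p < N) (p%:R ^+ 2)^-1 <= z%:R^-1 :> R.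
Proof.
move=> z0; have [Nz|zN] := leqP N z.+1.
  by rewrite big_geq // invr_ge0.
suff H : \sum_(z.+1 <= p < N) (p%:R ^+ 2)^-1 <= z%:R^-1 - (N.-1)%:R^-1 :> R.
  by apply: (le_trans H); rewrite gerBl invr_ge0.
have -> : N = (z.+1 + (N - z.+1))%N by lia.
elim: (N - z.+1)%N => [|m IH].
  by rewrite addn0 big_geq //= subrr.
rewrite addnS big_nat_recr ?leq_addr //=.
apply: (le_trans (lerD IH (lexx _))).
have -> : (z.+1 + m).-1 = (z + m)%N by lia.
have h : 0 < (z + m)%:R :> R by rewrite ltr0n; lia.
have -> : (z.+1 + m)%:R = (z + m)%:R + 1 :> R by rewrite addSn -addn1 natrD.
have hz : 0 < z%:R :> R by rewrite ltr0n.
move: (z + m)%:R h => w h.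
rewrite -subr_ge0 (_ : _ - _ = (w * (w + 1) ^+ 2)^-1); first by rewrite invr_ge0 mulr_ge0 ?sqr_ge0 // ltW.
by field; apply/and3P; split; apply/eqP; lra.
Qed.

Lemma trap_scale (R : realType) (al be C0 C1 X : R) (p a c : nat) : (0 < p)%N ->
  trap al be C0 C1 X (p * a) (p * c) = trap al be C0 C1 (X / p%:R) a c.
Proof.
move=> p0; have p0R : 0 < p%:R :> R by rewrite ltr0n.
rewrite /trap !natrM.
have E C : X / p%:R * C = X * C / p%:R by rewrite mulrAC.
rewrite !E ler_pdivrMr // ltr_pdivlMr // ![c%:R * p%:R]mulrC.
by rewrite ![_ * (p%:R * c%:R)]mulrCA ler_pM2l // ltr_pM2l.
Qed.

(** * Integer points and coprime pairs in the planar region [trap] *)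

Section Trapezoid.
Variables (R : realType) (al be C0 C1 : R).
Hypotheses (al0 : 0 <= al) (albe : al <= be) (C00 : 0 < C0) (C01 : C0 <= C1).

Let tr := trap al be C0 C1.

Lemma trap_supp X N a c : 0 <= X -> X * C1 <= N%:R -> be * (X * C1) <= N%:R ->
  (N <= a)%N || (N <= c)%N -> tr X a c = false.
Proof.
move=> X0 H1 H2 H; apply/negbTE; apply/negP => /andP[/andP[_ h1] /andP[_ h2]].
have be0 := le_trans al0 albe.
have h3 : be * c%:R <= be * (X * C1) by rewrite ler_wpM2l // ltW.
case/orP: H; rewrite -(ler_nat R); lra.
Qed.

(** Column by column, [t c] being the rounding error of column [c]. This exact form yields both the
    asymptotic count [trap_count] and the homogeneous bound [trap_count_le]. *)
Lemma trap_count_eq X N : 0 <= X -> X * C1 <= N%:R -> be * (X * C1) <= N%:R ->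
  exists k0 k1 : nat, [/\ (k0 <= k1)%N, X * C0 <= k0%:R < X * C0 + 1,
    X * C1 <= k1%:R < X * C1 + 1 &
    exists t : nat -> R, (forall c, `|t c| <= 1) /\
     (\sum_(c < N) \sum_(a < N) tr X a c)%N%:R =
       \sum_(k0 <= c < k1) ((be - al) * c%:R + t c)].
Proof.
move=> X0 H1 H2.
have XC0 : 0 <= X * C0 by rewrite mulr_ge0 // ltW.
have XC01 : X * C0 <= X * C1 by rewrite ler_wpM2l.
have [k0 [k01 k02 k0E]] := ex_nat_ceil XC0.
have [k1 [k11 k12 k1E]] := ex_nat_ceil (le_trans XC0 XC01).
have k0k1 : (k0 <= k1)%N by rewrite leqNgt -k0E -leNgt; lra.
have k1N : (k1 <= N)%N by rewrite leqNgt -k1E -leNgt.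
exists k0, k1; split => //; rewrite ?k01 ?k11 //.
pose t c : R := if (c < k1)%N then
  (\sum_(a < N) (al * c%:R <= a%:R < be * c%:R)%R)%N%:R - (be * c%:R - al * c%:R)
  else 0.
exists t; split => [c|].
  rewrite /t; case: ifP => ck1; last by rewrite normr0.
  apply: count_interval; [exact: mulr_ge0|exact: ler_wpM2r|].
  apply: le_trans H2; rewrite ler_wpM2l ?(le_trans al0) // ltW //.
  by rewrite k1E.
rewrite -(big_mkord xpredT (fun c => \sum_(a < N) tr X a c)%N).
rewrite (@big_cat_nat _ _ _ k1) //= (@big_cat_nat _ _ _ k0 0 k1) //=.
rewrite big_nat_cond big1 ?add0n; last first.
  move=> c /andP[/andP[_ ck0] _]; apply: big1 => a _.
  by rewrite /tr /trap leNgt k0E ck0.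
rewrite [X in (_ + X)%N]big_nat_cond [X in (_ + X)%N]big1 ?addn0; last first.
  move=> c /andP[/andP[ck1 _] _]; apply: big1 => a _.
  by rewrite /tr /trap k1E ltnNge ck1 andbF.
rewrite natr_sum; apply: eq_big_nat => c /andP[ck0 ck1].
rewrite /t ck1; rewrite -mulrBl addrCA subrr addr0; congr (_%:R).
by apply: eq_bigr => a _; rewrite /tr /trap leNgt k0E k1E -leqNgt ck0 ck1.
Qed.

Lemma sum_nat_range (k0 k1 : nat) : (k0 <= k1)%N ->
  \sum_(k0 <= c < k1) c%:R = (k1%:R * (k1%:R - 1) - k0%:R * (k0%:R - 1)) / 2 :> R.
Proof.
move=> /subnKC <-; elim: (k1 - k0)%N => [|m IH].
  by rewrite addn0 big_geq // subrr mul0r.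
rewrite addnS big_nat_recr ?leq_addr //= IH -[(k0 + m).+1]addn1 natrD natrD.
by field.
Qed.

Lemma trap_count X N : 0 <= X -> X * C1 <= N%:R -> be * (X * C1) <= N%:R ->
  `|(\sum_(c < N) \sum_(a < N) tr X a c)%N%:R
     - (be - al) * (C1 ^+ 2 - C0 ^+ 2) / 2 * X ^+ 2| <= (be - al + 1) * (C1 + 1) * (X + 1).
Proof.
move=> X0 H1 H2; have [k0 [k1 [k01 /andP[e1 e2] /andP[e3 e4] [t [t1 ->]]]]] :=
  trap_count_eq X0 H1 H2.
rewrite big_split /= -mulr_sumr sum_nat_range //.
have tb : `|\sum_(k0 <= c < k1) t c| <= k1%:R - k0%:R.
  apply: (le_trans (ler_norm_sum _ _ _)).
  apply: (le_trans (ler_sum _ (fun c _ => t1 c))).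
  by rewrite sumr_const_nat -natrB.
set T := \sum_(_ <= _ < _) _ in tb *.
set a := k0%:R in e1 e2 tb *; set b := k1%:R in e3 e4 tb *.
have XC0 : 0 <= X * C0 by rewrite mulr_ge0 // ltW.
have XC01 : X * C0 <= X * C1 by rewrite ler_wpM2l.
have q1 : `|b * (b - 1) - (X * C1) ^+ 2| <= X * C1 + 1.
  by rewrite ler_norml; apply/andP; split; nra.
have q0 : `|a * (a - 1) - (X * C0) ^+ 2| <= X * C0 + 1.
  by rewrite ler_norml; apply/andP; split; nra.
rewrite (_ : _ - _ = (be - al) / 2 * ((b * (b - 1) - (X * C1) ^+ 2)
   - (a * (a - 1) - (X * C0) ^+ 2)) + T); last by field.
apply: (le_trans (ler_normD _ _)).
rewrite normrM ger0_norm; last by rewrite divr_ge0 // subr_ge0.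
have q : `|b * (b - 1) - (X * C1) ^+ 2 - (a * (a - 1) - (X * C0) ^+ 2)|
   <= 2 * (X * C1 + 1) by apply: (le_trans (ler_normB _ _)); lra.
have D0 : 0 <= be - al by rewrite subr_ge0.
have := ler_wpM2l (_ : 0 <= (be - al) / 2) q; rewrite divr_ge0 // => /(_ isT) q'.
have a0 : 0 <= a by rewrite ler0n.
have C10 := le_trans (ltW C00) C01.
by nra.
Qed.

(** As [C0 > 0], only columns with [c >= 1] occur, so a rounding error of 1 is absorbed into [c].
    Having no term of lower order, the bound can be summed over all scales [X / p], however
    small. *)
Lemma trap_count_le X N : 0 < X -> X * C1 <= N%:R -> be * (X * C1) <= N%:R ->
  (\sum_(c < N) \sum_(a < N) tr X a c)%N%:R <= (be - al + 1) * (C1 * X) ^+ 2.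
Proof.
move=> X0 H1 H2; have [k0 [k1 [k01 /andP[e1 e2] /andP[e3 e4] [t [t1 ->]]]]] :=
  trap_count_eq (ltW X0) H1 H2.
have k0_gt0 : (0 < k0)%N.
  by rewrite -(ltr_nat R); apply: lt_le_trans e1; rewrite mulr_gt0.
have D0 : 0 <= be - al by rewrite subr_ge0.
apply: (@le_trans _ _ (\sum_(k0 <= c < k1) (be - al + 1) * c%:R)).
  apply: ler_sum_nat => c /andP[ck _].
  have : 1 <= c%:R :> R by rewrite ler1n (leq_trans k0_gt0 ck).
  have := ler_norm (t c); have := t1 c; nra.
rewrite -mulr_sumr sum_nat_range //; apply: ler_wpM2l; first by rewrite addr_ge0.
have hk0 : 1 <= k0%:R :> R by rewrite ler1n.
have hk1 : k0%:R <= k1%:R :> R by rewrite ler_nat.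
have [k1E|k1n] := eqVneq k1 1%N; first by rewrite k1E in hk1 *; nra.
have hk2 : 2 <= k1%:R :> R.
  by rewrite ler_nat ltn_neqAle eq_sym k1n (leq_trans k0_gt0 k01).
by nra.
Qed.

(** [P] is the condition at the remaining primes in the sieve, and [true] in the estimate of the
    large primes. *)
Lemma trap_sum_dvd X N p : 0 <= X -> X * C1 <= N%:R -> be * (X * C1) <= N%:R ->
  (0 < p)%N -> forall P : nat -> nat -> bool,
  (\sum_(c < N) \sum_(a < N) (tr X a c && P a c && ((p %| a) && (p %| c)))
   = \sum_(c < N) \sum_(a < N) (tr (X / p%:R) a c && P (p * a) (p * c)))%N.
Proof.
move=> X0 H1 H2 p0 P.
transitivity (\sum_(c < N | p %| c) \sum_(a < N | p %| a) (tr X a c && P a c))%N.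
  rewrite [RHS]big_mkcond; apply: eq_bigr => c _.
  case: (p %| c)%N; last by apply: big1 => a _; rewrite !andbF.
  rewrite [RHS]big_mkcond; apply: eq_bigr => a _.
  by case: (p %| a)%N; rewrite ?andbT ?andbF.
rewrite (sum_dvdn_supp (F := fun c => \sum_(a < N | p %| a) (tr X a c && P a c))%N) //.
  apply: eq_bigr => c _.
  rewrite (sum_dvdn_supp (F := fun a => tr X a (p * c) && P a (p * c)%N)) //.
    by apply: eq_bigr => a _; rewrite /tr trap_scale.
  by move=> a Na; rewrite (@trap_supp X N) // Na.
by move=> c Nc; apply: big1 => a _; rewrite (@trap_supp X N) // Nc orbT.
Qed.

Lemma trap_sieve (ps : seq nat) X N : uniq ps -> all prime ps ->
  0 <= X -> X * C1 <= N%:R -> be * (X * C1) <= N%:R ->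
  `|(\sum_(c < N) \sum_(a < N)
       (tr X a c && all (fun p => ~~ ((p %| a) && (p %| c)))%N ps))%N%:R
    - (be - al) * (C1 ^+ 2 - C0 ^+ 2) / 2 * X ^+ 2 * \prod_(p <- ps) (1 - (p%:R ^+ 2)^-1)|
  <= 2 ^+ size ps * ((be - al + 1) * (C1 + 1) * (X + 1)).
Proof.
move=> ups ps_pr X0 H1 H2.
pose cnt (ps : seq nat) (X : R) : R := (\sum_(c < N) \sum_(a < N)
       (tr X a c && all (fun p => ~~ ((p %| a) && (p %| c)))%N ps))%N%:R.
have C10 := lt_le_trans C00 C01.
have be0 := le_trans al0 albe.
have D0 : 0 <= be - al by rewrite subr_ge0.
have Hle Y : 0 <= Y -> Y <= X -> Y * C1 <= N%:R /\ be * (Y * C1) <= N%:R.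
  move=> Y0 YX; have h : Y * C1 <= X * C1 by rewrite ler_wpM2r // ltW.
  by split; [exact: le_trans H1|apply: le_trans H2; rewrite ler_wpM2l].
apply: (@sieve_bound R cnt (fun X => (be - al + 1) * (C1 + 1) * (X + 1)) 2 _ X) => //.
- by move=> Y Z Y0 YZ; rewrite ler_wpM2l ?lerD2r // mulr_ge0 // addr_ge0 // ltW.
- move=> Y Y0 /(Hle _ Y0)[h1 h2]; rewrite /cnt.
  rewrite (eq_bigr (fun c : 'I_N => \sum_(a < N) tr Y a c)%N); first exact: trap_count.
  by move=> c _; apply: eq_bigr => a _; rewrite andbT.
- move=> p qs Y p_pr pqs qs_pr Y0 /(Hle _ Y0)[h1 h2]; rewrite /cnt.
  apply/eqP; rewrite -subr_eq opprK -natrD; apply/eqP; congr (_%:R).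
  pose Q a c := all (fun p => ~~ ((p %| a) && (p %| c)))%N qs.
  transitivity (\sum_(c < N) \sum_(a < N) (tr Y a c && all (fun p => ~~ ((p %| a) && (p %| c)))%N (p :: qs))
    + \sum_(c < N) \sum_(a < N) (tr Y a c && Q a c && ((p %| a) && (p %| c))))%N.
    rewrite (trap_sum_dvd Y0 h1 h2 (prime_gt0 p_pr)); congr addn.
    apply: eq_bigr => c _; apply: eq_bigr => a _; congr (nat_of_bool (_ && _)).
    apply: eq_in_all => r rqs; congr negb.
    have r_pr := allP qs_pr _ rqs.
    rewrite !Euclid_dvdM // (dvdn_prime2 r_pr p_pr); case: (r =P p) => // rp.
    by rewrite -rp rqs in pqs.
  rewrite -big_split; apply: eq_bigr => c _; rewrite -big_split; apply: eq_bigr => a _ /=.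
  rewrite -!/(Q a c); case: (tr _ _ _) => //=.
  by case: (Q a c); case: (p %| a)%N; case: (p %| c)%N.
Qed.

End Trapezoid.

(** * The series of inverse squares and the Euler product of 1/zeta(2) *)

Lemma sin_le_id (R : realType) (x : R) : 0 <= x -> sin x <= x.
Proof.
rewrite le_eqVlt => /predU1P[<-|x0]; first by rewrite sin0.
have [c _] := @MVT R sin cos 0 x x0 (fun c _ => is_derive_sin c)
  (continuous_subspaceT (@continuous_sin R)).
by rewrite sin0 !subr0 => ->; have := cos_le1 c; nra.
Qed.

(** Induction by 1/sin^2 t + 1/cos^2 t = 4/sin^2 (2t): the angles are the odd multiples of
    pi/2^(m+2) below pi/2, and each is paired with its complement. *)
Lemma sum_inv_sin2 (R : realType) (m : nat) :
  \sum_(k < 2 ^ m) (sin (((2 * k).+1)%:R * (pi / 2 ^+ m.+2)) ^+ 2)^-1 = 2 ^+ (2 * m).+1 :> R.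
Proof.
have step (t : R) : 0 < t < pi / 2 ->
    (sin t ^+ 2)^-1 + (sin (pi / 2 - t) ^+ 2)^-1 = 4 * (sin (t *+ 2) ^+ 2)^-1.
  move=> /andP[t0 t1]; have s0 : 0 < sin t by apply: sin_gt0_pihalf; rewrite t0.
  have c0 : 0 < cos t by apply: cos_gt0_pihalf; rewrite t1 andbT; have := @pi_gt0 R; lra.
  rewrite -opprB sinN sinBpihalf opprK sin_mulr2n.
  have cs := cos2Dsin2 t.
  have -> : (cos t * sin t) *+ 2 = 2 * (cos t * sin t) by rewrite mulr_natl.
  rewrite (_ : _ + _ = (cos t ^+ 2 + sin t ^+ 2) / (cos t ^+ 2 * sin t ^+ 2)).
    by rewrite cs; field; rewrite !lt0r_neq0.
  by field; rewrite !lt0r_neq0.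
elim: m => [|m IH].
  rewrite big_ord1 muln0 mul1r /= expr1.
  have s0 : 0 < sin (pi / 4 : R).
    by apply: sin_gt0_pihalf; have := @pi_gt0 R; lra.
  have -> : pi / 2 ^+ 2 = pi / 4 :> R by congr (_ / _); ring.
  have : sin (pi / 4) ^+ 2 *+ 2 = 1 :> R.
    have := cos_mulr2n (pi / 4 : R).
    have -> : pi / 4 *+ 2 = pi / 2 :> R by rewrite -mulr_natr; field.
    by rewrite cos_pihalf cos2sin2 !mulr2n; lra.
  rewrite mulr2n => h; apply: (mulIf (lt0r_neq0 (exprn_gt0 2 s0))).
  by rewrite mulVf ?lt0r_neq0 ?exprn_gt0 //; lra.
set h : R := pi / 2 ^+ m.+3.
have hE : pi / 2 ^+ m.+2 = h *+ 2 :> R.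
  by rewrite /h -mulr_natr [in RHS]exprS; field; rewrite expf_neq0.
have h0 : 0 < h by rewrite divr_gt0 ?pi_gt0 ?exprn_gt0.
have pih : pi / 2 = 2 ^+ m.+2 * h :> R.
  by rewrite /h [2 ^+ m.+3]exprS; field; rewrite expf_neq0.
have E : (2 ^ m.+1 = 2 ^ m + 2 ^ m)%N by rewrite expnS; lia.
rewrite E big_split_ord /= [X in _ + X](reindex_inj rev_ord_inj) /= -big_split /=.
transitivity (4 * \sum_(k < 2 ^ m) (sin (((2 * k).+1)%:R * (pi / 2 ^+ m.+2)) ^+ 2)^-1 : R).
  rewrite mulr_sumr; apply: eq_bigr => k _.
  have kl := ltn_ord k.
  have -> : ((2 * (2 ^ m + (2 ^ m - k.+1))).+1)%:R * h = pi / 2 - ((2 * k).+1)%:R * h.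
    rewrite pih -mulrBl; congr (_ * h).
    have -> : 2 ^+ m.+2 = (4 * 2 ^ m)%N%:R :> R.
      by rewrite natrM natrX !exprS; ring.
    by rewrite -natrB; [congr (_%:R)|]; lia.
  rewrite step; first by rewrite hE -mulrnAr.
  rewrite mulr_gt0 //= pih ltr_pM2r //.
  have -> : 2 ^+ m.+2 = (4 * 2 ^ m)%N%:R :> R by rewrite natrM natrX !exprS; ring.
  by rewrite ltr_nat; lia.
rewrite IH (_ : (2 * m.+1).+1 = (2 * m).+1.+2); last by lia.
by rewrite [RHS]exprS [in RHS]exprS; ring.
Qed.

(** Comparison with [sum_inv_sin2] through sin x <= x. *)
Lemma sum_inv_odd2 (R : realType) (m : nat) :
  \sum_(k < 2 ^ m) (((2 * k).+1)%:R ^+ 2)^-1 <= pi ^+ 2 / 8 :> R.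
Proof.
have p0 := @pi_gt0 R.
set h : R := pi / 2 ^+ m.+2.
have t0 : 0 < 2 ^+ m :> R by rewrite exprn_gt0.
have h0 : 0 < h by rewrite divr_gt0 ?exprn_gt0.
have h2 : h * (4 * 2 ^+ m) = pi.
  by rewrite /h 2!exprS; field; rewrite expf_neq0.
rewrite -(ler_pM2r (x := (h ^+ 2)^-1)) ?invr_gt0 ?exprn_gt0 //.
apply: (@le_trans _ _ (2 ^+ (2 * m).+1)); last first.
  rewrite -h2 exprS mulnC exprM; set t := 2 ^+ m in t0 *.
  by rewrite le_eqVlt; apply/orP; left; apply/eqP; field; rewrite lt0r_neq0.
rewrite -sum_inv_sin2 mulr_suml; apply: ler_sum => k _.
rewrite -invfM -exprMn -/h.
have kl := ltn_ord k.
have s0 : 0 < sin ((2 * k).+1%:R * h).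
  apply: sin_gt0_pihalf; rewrite mulr_gt0 //=.
  have -> : pi / 2 = (2 * 2 ^ m)%N%:R * h.
    by rewrite -h2 natrM natrX; field.
  by rewrite ltr_pM2r // ltr_nat; lia.
rewrite lef_pV2 ?posrE ?exprn_gt0 ?mulr_gt0 //.
by rewrite lerXn2r ?nnegrE ?sin_le_id ?mulr_ge0 // ltW.
Qed.

(** Odd terms contribute at most pi^2/8 and even terms a quarter of a shorter sum; pi^2/6 is the
    fixed point of s -> pi^2/8 + s/4. *)
Lemma sum_inv_sqr_le (R : realType) (N : nat) :
  \sum_(1 <= k < N) (k%:R ^+ 2)^-1 <= pi ^+ 2 / 6 :> R.
Proof.
have split M : \sum_(1 <= k < 2 * M) (k%:R ^+ 2)^-1 =
    \sum_(k < M) (((2 * k).+1)%:R ^+ 2)^-1 + 4^-1 * \sum_(1 <= k < M) (k%:R ^+ 2)^-1 :> R.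
  elim: M => [|M IH]; first by rewrite big_ord0 !big_geq // mulr0 addr0.
  case: M IH => [|M] IH.
    by rewrite big_ord1 muln0 muln1 !big_nat1 big_geq // mulr0 addr0.
  rewrite big_ord_recr /= [in RHS]big_nat_recr //=.
  have -> : (2 * M.+2 = (2 * M.+1).+2)%N by lia.
  rewrite big_nat_recr // big_nat_recr; last by lia.
  rewrite /= IH [(2 * M.+1)%N%:R]natrM exprMn invfM.
  have -> : (2%:R ^+ 2)^-1 = 4^-1 :> R by congr (_^-1); ring.
  by ring.
have pow m : \sum_(1 <= k < 2 ^ m) (k%:R ^+ 2)^-1 <= pi ^+ 2 / 6 :> R.
  elim: m => [|m IH]; first by rewrite big_geq // divr_ge0 // sqr_ge0.
  rewrite expnS split; have := @sum_inv_odd2 R m; lra.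
apply: le_trans (pow N); have NN := ltn_expl N (ltnSn 1).
case: N NN => [|N] NN; first by rewrite !big_geq.
rewrite [leRHS](@big_cat_nat _ _ _ N.+1) //=; last exact: ltnW.
by rewrite lerDl; apply: sumr_ge0 => k _; rewrite invr_ge0 sqr_ge0.
Qed.

(* Finite subproducts of the Euler product of [1 / zeta(2)]; deleting the multiples
   of [p] from the series divides its supremum by at least [1 - p^-2]. *)
Lemma prod_prime_inv2_ge (R : realType) (ps : seq nat) : uniq ps -> all prime ps ->
  6 / pi ^+ 2 <= \prod_(p <- ps) (1 - (p%:R ^+ 2)^-1) :> R.
Proof.
move=> ups ps_pr.
pose S (ps : seq nat) (N : nat) : R :=
  \sum_(0 <= k < N | all (fun p => ~~ (p %| k)%N) ps) (k%:R ^+ 2)^-1.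
have Sge0 k : 0 <= (k%:R ^+ 2)^-1 :> R by rewrite invr_ge0 sqr_ge0.
have Smono qs : {homo S qs : N M / (N <= M)%N >-> N <= M}.
  move=> N M NM; rewrite /S.
  by rewrite [leRHS](@big_cat_nat _ _ _ N) //= lerDl; apply: sumr_ge0.
suff H : forall N, S ps N <= pi ^+ 2 / 6 * \prod_(p <- ps) (1 - (p%:R ^+ 2)^-1).
  (* For [N = 2] only [k = 1] contributes, the inverse of 0 being 0. *)
  have := H 2%N; rewrite /S (@big_ltn_cond _ _ _ 0) // (@big_ltn_cond _ _ _ 1) // big_geq // addr0.
  have -> : all (fun p => ~~ (p %| 1)%N) ps.
    by apply/allP => p /(allP ps_pr); rewrite dvdn1; case: eqP => // ->.
  have p0 : 0 < pi ^+ 2 :> R by rewrite exprn_gt0 // pi_gt0.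
  rewrite expr0n invr0 add0r if_same expr1n invr1 => h; rewrite ler_pdivrMr // mulrC.
  by move: h; set P := \prod_(_ <- _) _; lra.
elim: ps ups ps_pr => [_ _ N|p ps IH /= /andP[pps ups] /andP[p_pr ps_pr] N].
  rewrite big_nil mulr1 /S; case: N => [|N].
    by rewrite big_geq // divr_ge0 // sqr_ge0.
  by rewrite big_ltn //= expr0n invr0 add0r; exact: sum_inv_sqr_le.
have p0 := prime_gt0 p_pr.
have p2 : 0 < (p%:R ^+ 2) :> R by rewrite exprn_gt0 // ltr0n.
(* Integers prime to [p] and multiples [p * k] are disjoint parts of the sum over [ps]. *)
have step M : S (p :: ps) N + (p%:R ^+ 2)^-1 * S ps M <= S ps (maxn N (p * M)).
  have -> : S ps (maxn N (p * M)) = S (p :: ps) (maxn N (p * M)) +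
      \sum_(0 <= k < maxn N (p * M) | all (fun p => ~~ (p %| k)%N) ps && (p %| k)%N) (k%:R ^+ 2)^-1.
    rewrite /S (bigID (fun k => p %| k)%N) /= addrC; congr +%R.
    by apply: eq_bigl => k; rewrite andbC.
  apply: lerD; first by apply: Smono; exact: leq_maxl.
  apply: (@le_trans _ _ (\sum_(0 <= k < p * M | all (fun p => ~~ (p %| k)%N) ps && (p %| k)%N) (k%:R ^+ 2)^-1)); last first.
    rewrite [leRHS](@big_cat_nat _ _ _ (p * M)) ?leq_maxr //= lerDl; exact: sumr_ge0.
  rewrite (eq_bigl (fun k => (p %| k)%N && all (fun p => ~~ (p %| k)%N) ps)); last first.
    by move=> k; rewrite andbC.
  rewrite big_mkcondr big_dvdn_nat // -big_mkcond /S mulr_sumr.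
  rewrite le_eqVlt; apply/orP; left; apply/eqP; apply: eq_big => [k|k _].
    apply: eq_in_all => r rps; congr negb; have r_pr := allP ps_pr _ rps.
    rewrite Euclid_dvdM // (dvdn_prime2 r_pr p_pr); case: (r =P p) => // rp.
    by rewrite -rp rps in pps.
  by rewrite natrM exprMn [RHS]invfM.
set B := pi ^+ 2 / 6 * \prod_(j <- ps) _ in IH.
have -> : pi ^+ 2 / 6 * \prod_(j <- p :: ps) (1 - (j%:R ^+ 2)^-1) = B * (1 - (p%:R ^+ 2)^-1).
  by rewrite big_cons /B; ring.
(* Division by [p] changes the truncation point, so the recursion closes up only for the supremum
   [s]: it gives S (p :: ps) N <= (1 - p^-2) s. *)
have hs : has_sup (range (S ps)).
  by split; [exists (S ps 0%N), 0%N|exists B => _ [M _ <-]; exact: IH].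
set s := sup (range (S ps)).
have sB : s <= B by apply: ge_sup; [exists (S ps 0%N), 0%N|move=> _ [M _ <-]; exact: IH].
have Ss M : S ps M <= s by apply: ub_le_sup; [case: hs|exists M].
have : s <= p%:R ^+ 2 * (s - S (p :: ps) N).
  apply: ge_sup; first by exists (S ps 0%N), 0%N.
  move=> _ [M _ <-]; rewrite mulrC -ler_pdivrMr // mulrC.
  by have := step M; have := Ss (maxn N (p * M)); lra.
rewrite -ler_pdivrMl // => h.
have i0 : 0 <= 1 - (p%:R ^+ 2)^-1 :> R.
  by rewrite subr_ge0 invf_le1 // exprn_ege1 // ler1n.
by nra.
Qed.

(** Sieving by all primes would cost far too many error terms. Only the primes up to a fixed [z] are
    sieved out, and pairs with a larger common prime are subtracted by a union bound, whose total is
    [O(X^2 / z)]. *)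
Lemma prim_trap_lower (R : realType) (al be C0 C1 eps : R) :
  0 <= al -> al <= be -> 0 < C0 -> C0 <= C1 -> 0 < eps ->
  exists2 X0 : R, 0 < X0 & forall (X : R) (N : nat), X0 <= X ->
    X * C1 <= N%:R -> be * (X * C1) <= N%:R ->
    ((be - al) * (C1 ^+ 2 - C0 ^+ 2) / 2 * (6 / pi ^+ 2) - eps) * X ^+ 2 <=
    (\sum_(c < N) \sum_(a < N) (trap al be C0 C1 X a c && coprime a c))%N%:R.
Proof.
move=> al0 albe C00 C01 eps0.
have C10 := lt_le_trans C00 C01; have be0 := le_trans al0 albe.
have D0 : 0 <= be - al by rewrite subr_ge0.
pose B := (be - al + 1) * C1 ^+ 2.
have B0 : 0 <= B by rewrite mulr_ge0 ?sqr_ge0 // addr_ge0.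
(* The common prime factors beyond [z] take half of [eps]. *)
have [z z_gt0 zB] : exists2 z : nat, (0 < z)%N & B / z%:R <= eps / 2.
  exists (Num.truncn (2 * B / eps)).+1 => //.
  have : 2 * B / eps < (Num.truncn (2 * B / eps)).+1%:R by exact: truncnS_gt.
  by rewrite ltr_pdivrMr // ler_pdivrMr ?ltr0n //; lra.
pose ps := [seq p <- iota 0 z.+1 | prime p].
have ups : uniq ps by rewrite filter_uniq // iota_uniq.
have ps_pr : all prime ps by exact: filter_all.
pose K := 2 ^+ size ps * ((be - al + 1) * (C1 + 1)).
have K0 : 0 <= K.
  by rewrite mulr_ge0 ?exprn_ge0 // mulr_ge0 // addr_ge0 // ltW.
have q0 : 0 <= 4 * K / eps by apply: divr_ge0; [exact: mulr_ge0|exact: ltW].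
(* The other half covers the sieve error: [K (X + 1) <= 2 K X <= eps / 2 * X^2]. *)
exists (1 + 4 * K / eps); first by lra.
move=> X N XX0 H1 H2.
have X1 : 1 <= X by lra.
have XK : 4 * K <= eps * X.
  have : 4 * K / eps <= X by lra.
  by rewrite ler_pdivrMr // [X * _]mulrC.
have X0 : 0 < X by lra.
pose tr := trap al be C0 C1.
(* A pair that survives the sieve without being coprime has a gcd whose smallest prime factor
   exceeds [z]. *)
have key : (\sum_(c < N) \sum_(a < N)
       (tr X a c && all (fun p => ~~ ((p %| a) && (p %| c))) ps) <=
   \sum_(c < N) \sum_(a < N) (tr X a c && coprime a c) +
   \sum_(z.+1 <= p < N) \sum_(c < N) \sum_(a < N) (tr X a c && true && ((p %| a) && (p %| c))))%N.
  rewrite [X in (_ <= _ + X)%N]exchange_big -big_split; apply: leq_sum => c _.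
  rewrite [X in (_ <= _ + X)%N]exchange_big -big_split; apply: leq_sum => a _ /=.
  case trE : (tr X a c) => //=.
  case co : (coprime a c) => /=; first by rewrite (leq_trans (leq_b1 _)) // leq_addr.
  case: allP => // Hall; rewrite add0n.
  have c0 : (0 < c)%N.
    move: trE => /andP[/andP[h _] _]; rewrite -(ltr_nat R); apply: lt_le_trans h.
    exact: mulr_gt0.
  have g1 : (1 < gcdn a c)%N.
    by rewrite ltn_neqAle eq_sym [_ == _]co gcdn_gt0 c0 orbT.
  set p := pdiv (gcdn a c).
  have p_pr : prime p by exact: pdiv_prime.
  have pa : (p %| a)%N by rewrite (dvdn_trans (pdiv_dvd _)) // dvdn_gcdl.
  have pc : (p %| c)%N by rewrite (dvdn_trans (pdiv_dvd _)) // dvdn_gcdr.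
  have pN : (p < N)%N by apply: leq_ltn_trans (ltn_ord c); exact: dvdn_leq.
  have zp : (z < p)%N.
    rewrite ltnNge; apply/negP => pz; have /Hall : p \in ps.
      by rewrite mem_filter p_pr mem_iota.
    by rewrite pa pc.
  rewrite (bigD1_seq p) ?iota_uniq //= ?pa ?pc //.
  by rewrite mem_index_iota zp.
have tail : (\sum_(z.+1 <= p < N) \sum_(c < N) \sum_(a < N)
    (tr X a c && true && ((p %| a) && (p %| c))))%N%:R <= B * X ^+ 2 / z%:R.
  rewrite natr_sum; apply: (@le_trans _ _ (\sum_(z.+1 <= p < N) (B * X ^+ 2 * (p%:R ^+ 2)^-1))).
    apply: ler_sum_nat => p /andP[zp pN].
    have p0 : (0 < p)%N by exact: leq_ltn_trans zp.
    have p1R : 1 <= p%:R :> R by rewrite ler1n.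
    have Xp0 : 0 < X / p%:R by rewrite divr_gt0 // ltr0n.
    have XpX : X / p%:R <= X by rewrite ler_pdivrMr ?ltr0n // ler_peMr // ltW.
    have h : X / p%:R * C1 <= X * C1 by rewrite ler_wpM2r // ltW.
    rewrite (trap_sum_dvd C0 al0 albe (ltW X0) H1 H2 p0 (fun _ _ => true)).
    under eq_bigr do under eq_bigr do rewrite andbT.
    apply: (le_trans (trap_count_le al0 albe C00 C01 Xp0 _ _)).
    - exact: le_trans H1.
    - by apply: le_trans H2; rewrite ler_wpM2l.
    - rewrite /B !exprMn exprVn le_eqVlt; apply/orP; left; apply/eqP; ring.
  rewrite -mulr_sumr ler_wpM2l ?sum_sqr_inv_tail //.
  by apply: mulr_ge0; rewrite ?sqr_ge0.
have main := trap_sieve al0 albe C00 C01 ups ps_pr (ltW X0) H1 H2.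
have prod := @prod_prime_inv2_ge R ps ups ps_pr.
move: key; rewrite -(ler_nat R) natrD => key.
move: key tail main prod; rewrite -/tr.
set U := (\sum_(c < N) \sum_(a < N) (tr X a c && all _ _))%N%:R.
set V := (\sum_(_ <= _ < _) _)%N%:R; set W := (\sum_(_ < _) _)%N%:R.
set P := \prod_(_ <- _) _; set s6 := 6 / _ => key tail main prod.
have q1 : 0 <= (be - al) * (C1 ^+ 2 - C0 ^+ 2) / 2 by rewrite divr_ge0 // mulr_ge0 //; nra.
set kap := (be - al) * _ / 2 in main q1 *.
have X2 : 0 < X ^+ 2 by exact: exprn_gt0.
have t2 : B * X ^+ 2 / z%:R <= eps / 2 * X ^+ 2 by rewrite mulrAC ler_wpM2r // ltW.
have e1 : kap * X ^+ 2 * s6 <= kap * X ^+ 2 * P by rewrite ler_wpM2l // mulr_ge0 // ltW.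
have e2 : 2 ^+ size ps * ((be - al + 1) * (C1 + 1) * (X + 1)) <= eps / 2 * X ^+ 2.
  rewrite (_ : _ * _ = K * (X + 1)); last by rewrite /K; ring.
  by rewrite expr2; nra.
move: main; rewrite ler_norml => /andP[m1 _].
by rewrite mulrBl; lra.
Qed.

(** * The modular action and uniqueness of reduction to the fundamental domain *)

Definition fund_int (R : realType) : set (R * R) :=
  [set w | - (1/2) < w.1 < 1/2 /\ 1 < w.1 ^+ 2 + w.2 ^+ 2 /\ 0 < w.2].

(* tau is the position of the point on its horocycle, measured from the foot
   -d/c of the cusp and rescaled by the height: Re z = -d/c + y tau. *)
Definition tau (R : realType) (g : SL2Z) (z : R * R) : R :=
  ((sl_c g)%:~R * z.1 + (sl_d g)%:~R) / ((sl_c g)%:~R * z.2).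

(** The squared modulus |cz + d|^2. *)
Definition mob_den (R : realType) (g : SL2Z) (z : R * R) : R :=
  ((sl_c g)%:~R * z.1 + (sl_d g)%:~R) ^+ 2 + ((sl_c g)%:~R * z.2) ^+ 2.

Lemma sl_detR (R : realType) (g : SL2Z) :
  (sl_a g)%:~R * (sl_d g)%:~R - (sl_b g)%:~R * (sl_c g)%:~R = 1 :> R.
Proof. by rewrite -!intrM -intrB (eqP (sl_det g)). Qed.

Lemma mob_den_gt0 (R : realType) (g : SL2Z) (z : R * R) : 0 < z.2 -> 0 < mob_den g z.
Proof.
move=> z0; rewrite /mob_den; have [c0|c0] := eqVneq (sl_c g) 0.
  have d0 : (sl_d g)%:~R != 0 :> R.
    by apply/eqP => d0; have := sl_detR R g; rewrite d0 c0 !mulr0 subrr => /eqP; rewrite eq_sym oner_eq0.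
  by rewrite c0 !mul0r add0r expr0n addr0 exprn_even_gt0.
have cR : (sl_c g)%:~R != 0 :> R by rewrite intr_eq0.
rewrite ltr_pwDr ?sqr_ge0 //.
by rewrite exprn_even_gt0 //= mulf_neq0 // lt0r_neq0.
Qed.

Lemma mob_im (R : realType) (g : SL2Z) (z : R * R) : (mob g z).2 = z.2 / mob_den g z.
Proof. by []. Qed.

(** From gz = a/c - 1/(c(cz + d)), where cz + d = c y (tau + i). With [tau] fixed, the height
    depends only on [c^2 y], and the abscissa only on [a/c] and the height. *)
Lemma mobE (R : realType) (g : SL2Z) (z : R * R) : 0 < sl_c g -> 0 < z.2 ->
  (mob g z).2 = ((sl_c g)%:~R ^+ 2 * z.2 * (1 + tau g z ^+ 2))^-1 /\
  (mob g z).1 = (sl_a g)%:~R / (sl_c g)%:~R - tau g z * (mob g z).2.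
Proof.
move=> c0 z0; have den0 := mob_den_gt0 g z0.
have cR : 0 < (sl_c g)%:~R :> R by rewrite ltr0z.
have cz : (sl_c g)%:~R * z.2 != 0 :> R by rewrite mulf_neq0 // lt0r_neq0.
have v : (mob g z).2 = ((sl_c g)%:~R ^+ 2 * z.2 * (1 + tau g z ^+ 2))^-1.
  have -> : (mob g z).2 = z.2 / mob_den g z by [].
  have -> : mob_den g z = ((sl_c g)%:~R * z.2) ^+ 2 * (1 + tau g z ^+ 2).
    by rewrite /tau /mob_den; field; rewrite !lt0r_neq0.
  have t1 : 1 + tau g z ^+ 2 != 0 by rewrite lt0r_neq0 // ltr_pwDl // sqr_ge0.
  by field; rewrite t1 !lt0r_neq0.
split => //; rewrite mob_im /tau.
have E : (sl_b g)%:~R = ((sl_a g)%:~R * (sl_d g)%:~R - 1) / (sl_c g)%:~R :> R.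
  apply: (mulIf (lt0r_neq0 cR)); rewrite divfK ?lt0r_neq0 //.
  by have := sl_detR R g; lra.
rewrite /mob /= E -/(mob_den g z).
have den' := den0; rewrite /mob_den in den' *.
by field; rewrite (lt0r_neq0 z0) (lt0r_neq0 cR) lt0r_neq0.
Qed.

(** The cocycle relation: [(e, f)] is the bottom row of h g^-1, applied at the point [mob g z]. *)
Lemma mob_den_pair (R : realType) (g h : SL2Z) (z : R * R) : 0 < z.2 ->
  let e := sl_c h * sl_d g - sl_d h * sl_c g in
  let f := sl_d h * sl_a g - sl_c h * sl_b g in
  mob_den h z = mob_den g z *
    ((e%:~R * (mob g z).1 + f%:~R) ^+ 2 + (e%:~R * (mob g z).2) ^+ 2).
Proof.
move=> z0 e f; have den0 := mob_den_gt0 g z0.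
have detg := sl_detR R g.
(* Powers of the determinant, which is 1, are inserted to turn the claim into a formal identity in
   the matrix entries. *)
have -> : mob_den h z = ((sl_a g)%:~R * (sl_d g)%:~R - (sl_b g)%:~R * (sl_c g)%:~R) ^+ 2 * mob_den h z.
  by rewrite detg expr1n mul1r.
have -> : (mob g z).2 = ((sl_a g)%:~R * (sl_d g)%:~R - (sl_b g)%:~R * (sl_c g)%:~R) * (mob g z).2.
  by rewrite detg mul1r.
rewrite mob_im /mob /= -/(mob_den g z) /e /f !intrB !intrM.
have den' := den0; rewrite /mob_den in den' *.
by field; rewrite lt0r_neq0.
Qed.

(** The form exceeds e^2 - |e f| + f^2 because |w| > 1 and |Re w| < 1/2, and that integer is at
    least 1. *)
Lemma fund_int_form_gt1 (R : realType) (w : R * R) (e f : int) :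
  fund_int w -> e != 0 -> 1 < (e%:~R * w.1 + f%:~R) ^+ 2 + (e%:~R * w.2) ^+ 2.
Proof.
move=> [/andP[w1 w2] [w3 w4]] e0.
have int_ge1 : 1 <= `|e| ^+ 2 - `|e| * `|f| + `|f| ^+ 2.
  have : 1 <= `|e| by rewrite -gtz0_ge1 normr_gt0.
  have : 0 <= `|f| by [].
  by nia.
have H : 1 <= `|e%:~R| ^+ 2 - `|e%:~R| * `|f%:~R| + `|f%:~R| ^+ 2 :> R.
  by move: int_ge1; rewrite -(ler_int R) !rmorphD !rmorphN /= !rmorphM /= !intr_norm !expr2.
have e2 : 0 < `|e%:~R| :> R by rewrite normr_gt0 intr_eq0.
move: H; rewrite !real_normK ?num_real // => H.
set E : R := e%:~R in H e2 *; set F : R := f%:~R in H *.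
have h1 : - (`|E| * `|F|) <= 2 * (E * F) * w.1.
  have : `|2 * (E * F) * w.1| <= `|E| * `|F|.
    have w12 : `|w.1| <= 1 / 2 by rewrite ler_norml; lra.
    rewrite !normrM ger0_norm //.
    by have := mulr_ge0 (normr_ge0 E) (normr_ge0 F); nra.
  by rewrite ler_norml => /andP[].
have h2 : 0 < E ^+ 2 by rewrite exprn_even_gt0 //= -normr_gt0.
nra.
Qed.

(* If [g z] and [h z] both lie in the open fundamental domain, the bottom rows
   agree up to sign: otherwise [mob_den_pair] and [fund_int_form_gt1] make each
   denominator strictly larger than the other. *)
Lemma mob_uniq (R : realType) (g h : SL2Z) (z : R * R) :
  0 < z.2 -> 0 < sl_c g -> 0 < sl_c h -> fund_int (mob g z) -> fund_int (mob h z) ->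
  [/\ sl_a g = sl_a h, sl_c g = sl_c h & sl_d g = sl_d h].
Proof.
move=> z0 cg ch Fg Fh.
have dg := mob_den_gt0 g z0; have dh := mob_den_gt0 h z0.
have P := @mob_den_pair R g h z z0; have Q := @mob_den_pair R h g z z0.
have [e0|e0] := eqVneq (sl_c h * sl_d g - sl_d h * sl_c g) 0; last first.
  exfalso; have e0' : sl_c g * sl_d h - sl_d g * sl_c h != 0.
    by apply: contra_neq e0 => E0; lia.
  have := fund_int_form_gt1 (sl_d h * sl_a g - sl_c h * sl_b g) Fg e0.
  have := fund_int_form_gt1 (sl_d g * sl_a h - sl_c g * sl_b h) Fh e0'.
  move: P Q => /=; set s := _ + _; set t := _ + _ => P Q t1 s1.
  nra.
have cgh : (sl_c g %| sl_c h * sl_d g)%Z.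
  by apply/dvdzP; exists (sl_d h); lia.
have coprg : coprimez (sl_c g) (sl_d g).
  by apply/coprimezP; exists (- sl_b g, sl_a g) => /=; have := eqP (sl_det g); lia.
have coprh : coprimez (sl_c h) (sl_d h).
  by apply/coprimezP; exists (- sl_b h, sl_a h) => /=; have := eqP (sl_det h); lia.
have chg : (sl_c h %| sl_c g * sl_d h)%Z.
  by apply/dvdzP; exists (sl_d g); lia.
rewrite Gauss_dvdzl // in cgh; rewrite Gauss_dvdzl // in chg.
have cE : sl_c g = sl_c h.
  move: cgh chg => /dvdzP[k kE] /dvdzP[l lE].
  have k0 : 0 < k by nia.
  have l0 : 0 < l by nia.
  have h1 : sl_c g <= sl_c h by nia.
  have h2 : sl_c h <= sl_c g by nia.
  by lia.
have dE : sl_d g = sl_d h by nia.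
split => //.
(* Equal bottom rows leave a translation by an integer [k], which vanishes because the open domain
   has width 1. *)
have [k kE] : exists k, sl_a h = sl_a g + k * sl_c g.
  have : (sl_c g %| (sl_a h - sl_a g) * sl_d g)%Z.
    apply/dvdzP; exists (sl_b h - sl_b g).
    have := eqP (sl_det g); have := eqP (sl_det h); rewrite -dE -cE; lia.
  by rewrite Gauss_dvdzl // => /dvdzP[k kE]; exists k; lia.
have [vg ug] := mobE cg z0; have [vh uh] := mobE ch z0.
have tE : tau g z = tau h z by rewrite /tau cE dE.
have vE : (mob g z).2 = (mob h z).2 by rewrite vg vh tE cE.
have cR : (sl_c g)%:~R != 0 :> R by rewrite intr_eq0 gt_eqF.
have uE : (mob h z).1 = (mob g z).1 + k%:~R.
  by rewrite uh ug tE vE kE -cE intrD intrM; field.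
case: Fg Fh => /andP[g1 g2] _ [/andP[h1 h2] _].
have k1 : -1 < k by rewrite -(ltr_int R); lra.
have k2 : k < 1 by rewrite -(ltr_int R); lra.
have k0 : k = 0 by clear -k1 k2; lia.
by rewrite kE k0 mul0r addr0.
Qed.

(** * Lower density of the points sent to a region *)

(** The sign of [sl_c g] chooses one of g and -g. The parameter [tau] is kept next to the image
    point so that regions can also be cut along it. *)
Definition hits (R : realType) (D : set ((R * R) * R)) (z : R * R) : Prop :=
  exists2 g, 0 < sl_c g & D (mob g z, tau g z).

Definition nhits (R : realType) (D : set ((R * R) * R)) (n : nat) (x y : R) : nat :=
  #|[pred j : 'I_n | coprime j n && `[< hits D (x + j%:R / n%:R, y) >]]|.

(** Uniformity in [x] is essential, since the inversion produces an abscissa about which nothing is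
    known. The condition with [K] says that the main term in [coprime_interval] dominates its
    error. *)
Definition lower_density (R : realType) (D : set ((R * R) * R)) (kappa : R) : Prop :=
  forall eps : R, 0 < eps -> exists Y0 K : R, [/\ 0 < Y0, 0 < K &
    forall (x y : R) (n : nat), (0 < n)%N -> 0 < y -> y < Y0 ->
      K * 2 ^+ size (primes n) <= (totient n)%:R * y ->
      (totient n)%:R * (kappa - eps) <= (nhits D n x y)%:R].

Definition cell (R : realType) (u0 u1 v0 v1 t0 t1 : R) : set ((R * R) * R) :=
  [set q | u0 <= q.1.1 < u1 /\ v0 < q.1.2 <= v1 /\ t0 <= q.2 < t1].

Lemma lower_density_le0 (R : realType) (D : set ((R * R) * R)) (kappa : R) :
  kappa <= 0 -> lower_density D kappa.
Proof.
move=> k0 eps e0; exists 1, 1; split => // x y n n0 y0 _ _.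
apply: (@le_trans _ _ 0) => //; rewrite mulr_ge0_le0 //; lra.
Qed.

(** The lower right entries form a residue class modulo [c]; choosing one in a window of length [c]
    makes the interval of [J] begin between 0 and [n]. *)
Lemma bezout_bottom_row (R : realType) (a c : nat) (B : R) : (0 < c)%N -> coprime a c ->
  exists g : SL2Z, [/\ sl_a g = a, sl_c g = c & B - c%:R < (sl_d g)%:~R <= B].
Proof.
move=> c0 co; have c0R : 0 < c%:R :> R by rewrite ltr0n.
have : coprimez a c by [].
move=> /coprimezP[[d0 b0] /= db].
pose k := Num.ceil ((d0%:~R - B) / c%:R).
have det : (a : int) * (d0 - k * c) - (- b0 - k * a) * (c : int) == 1.
  by apply/eqP; rewrite -db; ring.
exists (mkSL2Z det); split => //=.
have := ceil_itv ((d0%:~R - B) / c%:R); rewrite -/k intrB intrB intrM => /andP[h1 h2].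
rewrite ltr_pdivlMr // in h1; rewrite ler_pdivrMr // in h2.
by rewrite -[(Posz c)%:~R]/(c%:R); apply/andP; split; lra.
Qed.

Lemma tau_translate (R : realType) (g h : SL2Z) (x y : R) (r : int) :
  sl_c h = sl_c g -> sl_d h = sl_d g + sl_c g * r ->
  tau h (x, y) = tau g (x + r%:~R, y).
Proof. by move=> cE dE; rewrite /tau /= cE dE intrD intrM; congr (_ / _); ring. Qed.

(** The matrix T^-k g T^r, where T is z -> z + 1. *)
Lemma SL2Z_translate (g : SL2Z) (k r : int) : exists h : SL2Z,
  [/\ sl_a h = sl_a g - k * sl_c g, sl_c h = sl_c g & sl_d h = sl_d g + sl_c g * r].
Proof.
have det : (sl_a g - k * sl_c g) * (sl_d g + sl_c g * r)
   - ((sl_a g - k * sl_c g) * r + sl_b g - k * sl_d g) * sl_c g == 1.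
  by apply/eqP; rewrite -(eqP (sl_det g)); ring.
by exists (mkSL2Z det).
Qed.

(* The cell is hit at [x + J/n + iy] as soon as [J] lies in an interval of length
   [n y (t1 - t0)] attached to a coprime pair [(a, c)] of the region [trap] at
   scale [X = y^(-1/2)]; [mob_uniq] shows that no [J] is counted twice. *)
Lemma lower_density_cell (R : realType) (u0 u1 v0 v1 t0 t1 m2 M2 L U : R) :
  0 < v0 -> v0 < v1 -> t0 < t1 -> 0 <= m2 -> U - L <= u1 - u0 ->
  (forall t, t0 <= t < t1 -> m2 <= t ^+ 2 <= M2) ->
  (forall t v, t0 <= t < t1 -> v0 < v <= v1 -> L <= t * v <= U) ->
  (forall q, cell u0 u1 v0 v1 t0 t1 q -> fund_int q.1) ->
  lower_density (cell u0 u1 v0 v1 t0 t1)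
    (3 / pi ^+ 2 * (t1 - t0) * ((u1 - u0) - (U - L)) *
       ((v0 * (1 + M2))^-1 - (v1 * (1 + m2))^-1)).
Proof.
move=> v00 v01 t01 m20 UL tm tv inF.
have M20 : 0 <= M2.
  have /tm/andP[h1 h2] : t0 <= t0 < t1 by rewrite lexx.
  exact: le_trans m20 (le_trans h1 h2).
have v10 := lt_trans v00 v01.
(* By [mobE] the height is 1/(c^2 y (1 + tau^2)); it lies in the required range for all admissible
   [tau] as soon as [s1 <= c^2 y < s2]. *)
set s2 := (v0 * (1 + M2))^-1; set s1 := (v1 * (1 + m2))^-1.
have s1_gt0 : 0 < s1 by rewrite invr_gt0 mulr_gt0 //; lra.
have s2_gt0 : 0 < s2 by rewrite invr_gt0 mulr_gt0 //; lra.
have pi2 : 0 < pi ^+ 2 :> R by rewrite exprn_gt0 // pi_gt0.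
have [s21|s12] := leP s2 s1.
  apply: lower_density_le0; apply: mulr_ge0_le0; last by lra.
  by rewrite !mulr_ge0 ?invr_ge0 ?(ltW pi2) //; lra.
set C0 := Num.sqrt s1; set C1 := Num.sqrt s2.
have C00 : 0 < C0 by rewrite sqrtr_gt0.
have C10 : 0 < C1 by rewrite sqrtr_gt0.
have C02 : C0 ^+ 2 = s1 by rewrite sqr_sqrtr // ltW.
have C12 : C1 ^+ 2 = s2 by rewrite sqr_sqrtr // ltW.
have C01 : C0 <= C1 by rewrite ler_wsqrtr // ltW.
(* A translation by [k] makes the numerators [a] nonnegative, as [trap] counts natural numbers. *)
pose k := (Num.truncn `|u0 + U|).+1.
have k0 : 0 <= u0 + U + k%:R.
  have : `|u0 + U| < k%:R by exact: truncnS_gt.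
  by rewrite ltr_norml => /andP[]; lra.
move: k k0 => k k0.
(* The abscissa is a/c - k - tau v with tau v between [L] and [U], so a/c in [al, be) places it in
   [u0, u1) for every admissible [tau]. *)
pose al := u0 + k%:R + U; pose be := u1 + k%:R + L.
have al0 : 0 <= al by rewrite /al; lra.
have albe : al <= be by rewrite /al /be; lra.
have be0 := le_trans al0 albe.
have baE : be - al = (u1 - u0) - (U - L) by rewrite /al /be; ring.
set kap := _ * _ * _ * _.
pose k1 := (be - al) * (C1 ^+ 2 - C0 ^+ 2) / 2 * (6 / pi ^+ 2).
have kapE : kap = k1 * (t1 - t0).
  rewrite /kap /k1 baE C02 C12; move: (pi ^+ 2) pi2 => w w0.
  by field; rewrite lt0r_neq0.
have k1_ge0 : 0 <= k1.
  rewrite /k1 C02 C12; apply: mulr_ge0; last by rewrite divr_ge0 // ltW.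
  by apply: divr_ge0 => //; apply: mulr_ge0; lra.
move=> eps eps0.
have dt0 : 0 < t1 - t0 by lra.
have e1 : 0 < eps / (2 * (t1 - t0)) by rewrite divr_gt0 // mulr_gt0.
have [X0 X00 primX] := prim_trap_lower al0 albe C00 C01 e1.
(* The first summand keeps [t1 - t0 - 1/K] nonnegative, the second makes [k1 / K] at most
   [eps / 2]. *)
pose K := (t1 - t0)^-1 + 2 * k1 / eps.
have ke0 : 0 <= 2 * k1 / eps by apply: divr_ge0; [exact: mulr_ge0|exact: ltW].
have K0 : 0 < K by apply: ltr_pwDl; rewrite ?invr_gt0.
exists (X0 ^+ 2)^-1, K; split; rewrite ?invr_gt0 ?exprn_gt0 //.
move=> x y n n0 y0 yY Ky.
pose X := (Num.sqrt y)^-1.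
have sy0 : 0 < Num.sqrt y by rewrite sqrtr_gt0.
have X0' : 0 < X by rewrite invr_gt0.
have X2 : X ^+ 2 = y^-1 by rewrite exprVn sqr_sqrtr // ltW.
have XX0 : X0 <= X.
  rewrite -(ler_pXn2r (n := 2)) ?nnegrE ?(ltW X0') ?(ltW X00) // X2.
  by rewrite -[leLHS]invrK lef_pV2 ?posrE ?invr_gt0 ?exprn_gt0 // ltW.
have nR : 0 < n%:R :> R by rewrite ltr0n.
pose N := (Num.truncn (X * C1 + be * (X * C1))).+1.
have XC1 : 0 <= X * C1 by rewrite mulr_ge0 // ltW.
have bXC1 : 0 <= be * (X * C1) by rewrite mulr_ge0.
have NB : X * C1 + be * (X * C1) < N%:R by exact: truncnS_gt.
have N1 : X * C1 <= N%:R by lra.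
have N2 : be * (X * C1) <= N%:R by lra.
(* The interval of [J] starts before [n] but may run past it, so [J] is reduced modulo [n] only
   afterwards. *)
pose NJ := (Num.truncn (n%:R * (1 + y * (t1 - t0)))).+1.
have NJB : n%:R * (1 + y * (t1 - t0)) < NJ%:R by exact: truncnS_gt.
move: N NJ N1 N2 NJB {NB} => N NJ N1 N2 NJB.
have W := primX X N XX0 N1 N2.
have /choice[G GP] : forall ac : 'I_N * 'I_N, exists g : SL2Z,
   (0 < ac.2)%N -> coprime ac.1 ac.2 ->
   [/\ sl_a g = ac.1, sl_c g = ac.2 &
     ac.2%:R * (y * t0 - x) - ac.2%:R < (sl_d g)%:~R <= ac.2%:R * (y * t0 - x)].
  move=> [a c] /=; have [c0|c0] := posnP c.
    by exists (@mkSL2Z 1 0 0 1 (eqxx _)); rewrite c0.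
  have [co|nco] := boolP (coprime a c).
    by have [g gP] := @bezout_bottom_row R a c (c%:R * (y * t0 - x)) c0 co; exists g.
  by exists (@mkSL2Z 1 0 0 1 (eqxx _)).
pose lo (ac : 'I_N * 'I_N) : R := n%:R * (y * t0 - x - (sl_d (G ac))%:~R / ac.2%:R).
pose hi (ac : 'I_N * 'I_N) : R := n%:R * (y * t1 - x - (sl_d (G ac))%:~R / ac.2%:R).
pose A1 := [pred ac : 'I_N * 'I_N | trap al be C0 C1 X ac.1 ac.2 && coprime ac.1 ac.2].
pose A2 (ac : 'I_N * 'I_N) := [pred J : 'I_NJ | (lo ac <= J%:R < hi ac) && coprime J n].
pose A := [pred q : ('I_N * 'I_N) * 'I_NJ | A1 q.1 && A2 q.1 q.2].
have trc ac : A1 ac -> (0 < ac.2)%N.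
  move=> /andP[/andP[/andP[h _] _] _]; rewrite -(ltr_nat R); apply: lt_le_trans h.
  exact: mulr_gt0.
have cardA : (totient n)%:R * (kap - eps) <= #|A|%:R.
  have -> : #|A| = (\sum_(ac | A1 ac) #|A2 ac|)%N.
    rewrite -sum1_card; under [RHS]eq_bigr do rewrite -sum1_card.
    by rewrite pair_big_dep.
  have cA1 : #|A1|%:R = (\sum_(c < N) \sum_(a < N) (trap al be C0 C1 X a c && coprime a c))%N%:R :> R.
    congr (_%:R); rewrite -sum1_card big_mkcond exchange_big pair_big /=.
    by apply: eq_bigr => -[a c] _; rewrite /= inE /=; case: (_ && _).
  pose phi := (totient n)%:R : R.
  have phi0 : 0 <= phi by rewrite ler0n.
  have cA2 ac : A1 ac -> phi * (y * ((t1 - t0) - K^-1)) <= #|A2 ac|%:R.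
    move=> Aac; have c0 := trc _ Aac; have [ga gc /andP[gd1 gd2]] := GP ac c0 (andP Aac).2.
    have c0R : 0 < ac.2%:R :> R by rewrite ltr0n.
    set d : R := (sl_d (G ac))%:~R in gd1 gd2.
    have dc : d = d / ac.2%:R * ac.2%:R by rewrite divfK // lt0r_neq0.
    have loge0 : 0 <= lo ac.
      by rewrite /lo mulr_ge0 // subr_ge0 -/d ler_pdivrMr //; clear -gd2; lra.
    have lohi : hi ac - lo ac = n%:R * y * (t1 - t0) by rewrite /hi /lo; ring.
    have lole : lo ac <= hi ac.
      by rewrite -subr_ge0 lohi !mulr_ge0 // ltW.
    have hiN : hi ac <= NJ%:R.
      have lo1 : lo ac <= n%:R.
        by rewrite /lo ler_piMr // -/d -(ler_pM2r c0R) mulrBl -dc; clear -gd1 gd2; lra.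
      by apply: le_trans (ltW NJB); rewrite -[hi ac](subrK (lo ac)) lohi; clear -lo1; lra.
    have := coprime_interval n0 loge0 lole hiN.
    have -> : (\sum_(J < NJ) ((lo ac <= J%:R < hi ac)%R && coprime J n))%N = #|A2 ac|.
      rewrite -sum1_card [RHS]big_mkcond; apply: eq_bigr => J _; rewrite inE /=.
      by case: (_ && _).
    rewrite lohi (_ : n%:R * y * (t1 - t0) * ((totient n)%:R / n%:R) = phi * y * (t1 - t0)); last first.
      by rewrite /phi; field; rewrite lt0r_neq0.
    rewrite ler_norml => /andP[h _].
    have : 2 ^+ size (primes n) <= phi * y * K^-1.
      by rewrite ler_pdivlMr // mulrC.
    by clear -h; lra.
  rewrite natr_sum; apply: (@le_trans _ _ (\sum_(ac | A1 ac) phi * (y * ((t1 - t0) - K^-1)))); last first.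
    exact: ler_sum.
  rewrite (_ : \sum_(ac | A1 ac) _ = #|A1|%:R * (phi * (y * ((t1 - t0) - K^-1)))); last first.
    by rewrite sumr_const mulr_natl.
  rewrite cA1.
  set w := (\sum_(_ < N) _)%N%:R in W *.
  have wy : k1 - eps / (2 * (t1 - t0)) <= w * y.
    by move: W; rewrite X2 ler_pdivrMr.
  have w0 : 0 <= w by rewrite ler0n.
  have dK0 : 0 <= (t1 - t0) - K^-1.
    by rewrite subr_ge0 -[leRHS]invrK lef_pV2 ?posrE ?invr_gt0 // /K lerDl.
  have -> : w * (phi * (y * ((t1 - t0) - K^-1))) = phi * (w * y * ((t1 - t0) - K^-1)).
    by rewrite mulrCA [w * (y * _)]mulrA.
  apply: ler_wpM2l => //.
  apply: (@le_trans _ _ ((k1 - eps / (2 * (t1 - t0))) * ((t1 - t0) - K^-1))); last first.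
    exact: ler_wpM2r.
  have k1K : k1 * K^-1 <= eps / 2.
    rewrite ler_pdivrMr // /K mulrDr.
    have -> : eps / 2 * (2 * k1 / eps) = k1 by field; rewrite lt0r_neq0.
    by rewrite lerDr mulr_ge0 // ?divr_ge0 ?invr_ge0 // ltW.
  have eK : 0 <= eps / (2 * (t1 - t0)) * K^-1 by rewrite mulr_ge0 ?invr_ge0 // ltW.
  have eE : eps / (2 * (t1 - t0)) * (t1 - t0) = eps / 2 by field; rewrite lt0r_neq0.
  rewrite kapE; move: k1K eK eE; move: (eps / (2 * _)) (K^-1) (k1) => e' q' k' h1 h2 h3.
  by clear -h1 h2 h3; nra.
apply: (le_trans cardA); rewrite ler_nat.
have fP (q : ('I_N * 'I_N) * 'I_NJ) : (q.2 %% n < n)%N by rewrite ltn_mod.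
pose f (q : ('I_N * 'I_N) * 'I_NJ) : 'I_n := Ordinal (fP q).
have xE (q : ('I_N * 'I_N) * 'I_NJ) :
    x + (f q)%:R / n%:R + (Posz (q.2 %/ n)%N)%:~R = x + q.2%:R / n%:R.
  rewrite {2}(divn_eq q.2 n) natrD natrM /=.
  by rewrite -[(Posz _)%:~R]/(_%:R); field; rewrite lt0r_neq0.
have wit q : q \in A -> exists h : SL2Z, [/\ sl_a h = Posz q.1.1 - Posz k * Posz q.1.2,
    sl_c h = q.1.2, sl_d h = sl_d (G q.1) + sl_c (G q.1) * Posz (q.2 %/ n)%N &
    cell u0 u1 v0 v1 t0 t1 (mob h (x + (f q)%:R / n%:R, y), tau h (x + (f q)%:R / n%:R, y))].
  move=> /andP[Aq /andP[/andP[J1 J2] Jn]]; have c0 := trc _ Aq.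
  have c0R : 0 < q.1.2%:R :> R by rewrite ltr0n.
  have [ga gc _] := GP q.1 c0 (andP Aq).2.
  (* Reducing [J] modulo [n] moves the point by an integer, which the right translation by [J %/ n]
     undoes; the left one removes the shift [k]. *)
  have [h [ha hc hd]] := SL2Z_translate (G q.1) k (Posz (q.2 %/ n)%N).
  exists h; split; rewrite ?ha ?hc ?hd ?ga ?gc //.
  have ch : 0 < sl_c h by rewrite hc gc.
  have [hv hu] := @mobE R h (x + (f q)%:R / n%:R, y) ch y0.
  set t := tau h _ in hv hu *.
  have tE : t = (q.2%:R / n%:R + x + (sl_d (G q.1))%:~R / q.1.2%:R) / y.
    rewrite /t (tau_translate _ _ hc hd) xE /tau /= gc -[(Posz _)%:~R]/(_%:R).
    by field; rewrite !lt0r_neq0.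
  have t01' : t0 <= t < t1.
    rewrite tE ler_pdivlMr // ltr_pdivrMr //.
    have J1' : y * t0 - x - (sl_d (G q.1))%:~R / q.1.2%:R <= q.2%:R / n%:R.
      by rewrite ler_pdivlMr // mulrC.
    have J2' : q.2%:R / n%:R < y * t1 - x - (sl_d (G q.1))%:~R / q.1.2%:R.
      by rewrite ltr_pdivrMr // mulrC.
    by rewrite ![_ * y]mulrC; clear -J1' J2'; apply/andP; split; lra.
  have /andP[tm1 tm2] := tm _ t01'.
  move: Aq => /andP[/andP[/andP[c1 c2] /andP[a1 a2]] co].
  have sc : (sl_c h)%:~R = q.1.2%:R :> R by rewrite hc gc.
  have c2y1 : s1 <= q.1.2%:R ^+ 2 * y.
    rewrite -C02 -[y]invrK -X2 ler_pdivlMr ?exprn_gt0 // -exprMn mulrC.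
    by rewrite ler_pXn2r // ?nnegrE ?ler0n // mulr_ge0 // ltW.
  have c2y2 : q.1.2%:R ^+ 2 * y < s2.
    rewrite -C12 -[y]invrK -X2 ltr_pdivrMr ?exprn_gt0 // -exprMn mulrC.
    by rewrite ltr_pXn2r // ?nnegrE ?ler0n.
  have t2 : 0 < 1 + t ^+ 2 by rewrite ltr_pwDl // sqr_ge0.
  have cy0 : 0 < q.1.2%:R ^+ 2 * y by rewrite mulr_gt0 ?exprn_gt0.
  have hv01 : v0 < (mob h (x + (f q)%:R / n%:R, y)).2 <= v1.
    rewrite hv sc /=; apply/andP; split.
      rewrite -[v0]invrK ltf_pV2 ?posrE ?invr_gt0 ?mulr_gt0 //.
      apply: (@lt_le_trans _ _ (s2 * (1 + t ^+ 2))); first by rewrite ltr_pM2r.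
      rewrite /s2 invfM -mulrA ler_piMr ?invr_ge0 ?(ltW v00) //.
      by clear -tm2 M20; rewrite ler_pdivrMl; lra.
    rewrite -[v1]invrK lef_pV2 ?posrE ?invr_gt0 ?mulr_gt0 //.
    apply: (@le_trans _ _ (s1 * (1 + t ^+ 2))); last by rewrite ler_pM2r.
    rewrite /s1 invfM -mulrA ler_peMr ?invr_ge0 ?(ltW v10) //.
    by clear -tm1 m20; rewrite ler_pdivlMl; lra.
  have /andP[l1 l2] := tv _ _ t01' hv01.
  suff : u0 <= (mob h (x + (f q)%:R / n%:R, y)).1 < u1 by [].
  rewrite hu sc ha gc ga intrB intrM -[(Posz q.1.1)%:~R]/(q.1.1%:R) -[(Posz q.1.2)%:~R]/(q.1.2%:R) -[(Posz k)%:~R]/(k%:R).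
  rewrite mulrBl mulfK ?lt0r_neq0 //.
  move: a1 a2; rewrite -ler_pdivlMr // -ltr_pdivrMr // /al /be => a1 a2.
  by clear -a1 a2 l1 l2; apply/andP; split; lra.
have finj : {in A &, injective f}.
  move=> q r Aq Ar fE.
  have [h [ha hc hd hcell]] := wit _ Aq; have [g [ga gc gd gcell]] := wit _ Ar.
  have cq := trc _ (andP Aq).1; have cr := trc _ (andP Ar).1.
  rewrite -fE in gcell.
  have [e1' e2 e3] := @mob_uniq R h g (x + (f q)%:R / n%:R, y) y0
    (ltac:(by rewrite hc)) (ltac:(by rewrite gc)) (inF _ hcell) (inF _ gcell).
  have cE : q.1.2 = r.1.2 by apply: val_inj; move: e2; rewrite hc gc => -[].
  have aE : q.1.1 = r.1.1.
    by apply: val_inj; move: e1'; rewrite ha ga cE => /addIr[].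
  have q1E : q.1 = r.1 by rewrite [q.1]surjective_pairing [r.1]surjective_pairing aE cE.
  have [_ Gc _] := GP r.1 cr (andP (andP Ar).1).2.
  have dE : (q.2 %/ n = r.2 %/ n)%N.
    have r0 : (r.1.2 : int) != 0 by rewrite eqz_nat -lt0n.
    by move: e3; rewrite hd gd q1E Gc => /addrI /(mulfI r0)[].
  have mE : (q.2 %% n = r.2 %% n)%N by have := congr1 val fE.
  have JE : q.2 = r.2 by apply: val_inj; rewrite /= (divn_eq q.2 n) (divn_eq r.2 n) dE mE.
  by rewrite [q]surjective_pairing [r]surjective_pairing q1E JE.
rewrite -(card_in_image finj); apply: subset_leq_card; apply/fintype.subsetP => j /fintype.imageP[q Aq ->].
have [h [ha hc hd hcell]] := wit _ Aq.
rewrite inE /= coprime_modl.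
move: (Aq) => /andP[Aq1 /andP[_ Jn]]; rewrite Jn /=.
by apply/asboolP; exists h => //; rewrite hc; exact: trc.
Qed.

Lemma hits_uniq (R : realType) (g h : SL2Z) (z : R * R) :
  0 < z.2 -> 0 < sl_c g -> 0 < sl_c h -> fund_int (mob g z) -> fund_int (mob h z) ->
  mob g z = mob h z /\ tau g z = tau h z.
Proof.
move=> z0 cg ch Fg Fh; have [aE cE dE] := mob_uniq z0 cg ch Fg Fh.
have tE : tau g z = tau h z by rewrite /tau cE dE.
have [vg ug] := mobE cg z0; have [vh uh] := mobE ch z0.
have vE : (mob g z).2 = (mob h z).2 by rewrite vg vh tE cE.
split => //; rewrite [LHS]surjective_pairing [RHS]surjective_pairing vE.
by rewrite ug uh tE vE aE cE.
Qed.

Lemma lower_density_sub (R : realType) (D D' : set ((R * R) * R)) (k k' : R) :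
  D `<=` D' -> k' <= k -> lower_density D k -> lower_density D' k'.
Proof.
move=> DD' kk LD eps eps0; have [Y0 [K [Y00 K0 H]]] := LD eps eps0.
exists Y0, K; split => // x y n n0 y0 yY Ky.
apply: (@le_trans _ _ ((totient n)%:R * (k - eps))); first by rewrite ler_wpM2l // lerB.
apply: (le_trans (H x y n n0 y0 yY Ky)); rewrite ler_nat.
apply: subset_leq_card; apply/fintype.subsetP => j; rewrite !inE => /andP[-> /asboolP[g g0 Dg]] /=.
by apply/asboolP; exists g => //; exact: DD'.
Qed.

Lemma lower_density_lim (R : realType) (D : set ((R * R) * R)) (k : R) :
  (forall eps, 0 < eps -> lower_density D (k - eps)) -> lower_density D k.
Proof.
move=> H eps eps0; have e2 : 0 < eps / 2 by rewrite divr_gt0.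
have [Y0 [K [Y00 K0 HH]]] := H _ e2 _ e2.
exists Y0, K; split => // x y n n0 y0 yY Ky.
by have := HH x y n n0 y0 yY Ky; rewrite (_ : k - eps / 2 - eps / 2 = k - eps) //; field.
Qed.

(** By [hits_uniq] a point has only one image in the open domain and one value of [tau], so no point
    hits two disjoint regions and the counts add. *)
Lemma lower_densityU (R : realType) (D E : set ((R * R) * R)) (k l : R) :
  (forall q, D q -> fund_int q.1) -> (forall q, E q -> fund_int q.1) ->
  (forall q, D q -> E q -> False) ->
  lower_density D k -> lower_density E l -> lower_density (D `|` E) (k + l).
Proof.
move=> Df Ef DE LD LE eps eps0; have e2 : 0 < eps / 2 by rewrite divr_gt0.
have [Y0 [K [Y00 K0 HD]]] := LD _ e2; have [Y1 [L [Y10 L0 HE]]] := LE _ e2.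
exists (Num.min Y0 Y1), (Num.max K L); split.
- by rewrite lt_min Y00.
- by rewrite lt_max K0.
move=> x y n n0 y0; rewrite lt_min => /andP[yY0 yY1] Ky.
have p2 : 0 <= 2 ^+ size (primes n) :> R by rewrite exprn_ge0.
have h1 : K * 2 ^+ size (primes n) <= (totient n)%:R * y.
  by apply: le_trans Ky; rewrite ler_wpM2r // le_max lexx.
have h2 : L * 2 ^+ size (primes n) <= (totient n)%:R * y.
  by apply: le_trans Ky; rewrite ler_wpM2r // le_max lexx orbT.
have := HD x y n n0 y0 yY0 h1; have := HE x y n n0 y0 yY1 h2.
suff : (nhits D n x y + nhits E n x y <= nhits (D `|` E) n x y)%N.
  rewrite -(ler_nat R) natrD => H a b; apply: le_trans H.
  by apply: le_trans (lerD b a); rewrite -mulrDr le_eqVlt; apply/orP; left; apply/eqP; field.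
rewrite /nhits -cardUI [X in (_ + X)%N]eq_card0 ?addn0; last first.
  move=> j; rewrite !inE; apply/negbTE; apply/negP.
  move=> /andP[/andP[_ /asboolP[g g0 Dg]] /andP[_ /asboolP[h h0 Eh]]].
  have [mE tE] := @hits_uniq R g h (x + j%:R / n%:R, y) y0 g0 h0 (Df _ Dg) (Ef _ Eh).
  by apply: (DE _ Dg); rewrite mE tE.
apply: subset_leq_card; apply/fintype.subsetP => j; rewrite !inE => /orP[].
  by move=> /andP[-> /asboolP[g g0 Dg]]; apply/asboolP; exists g => //; left.
by move=> /andP[-> /asboolP[g g0 Dg]]; apply/asboolP; exists g => //; right.
Qed.

Lemma lower_density_sum (R : realType) (I : finType) (F : I -> set ((R * R) * R))
    (k : I -> R) (D : set ((R * R) * R)) :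
  (forall q, D q -> fund_int q.1) -> (forall i, F i `<=` D) ->
  (forall i j q, F i q -> F j q -> i = j) ->
  (forall i, lower_density (F i) (k i)) -> lower_density D (\sum_i k i).
Proof.
move=> Df FD Fdisj LF.
pose U (r : seq I) : set ((R * R) * R) := [set q | exists2 i, i \in r & F i q].
suff H : forall r, uniq r -> lower_density (U r) (\sum_(i <- r) k i).
  rewrite -big_enum /=; apply: lower_density_sub (lexx _) (H _ (enum_uniq I)).
  by move=> q [i _ /FD].
elim=> [_|i r IH /= /andP[ir ur]].
  by apply: lower_density_le0; rewrite big_nil.
rewrite big_cons; apply: (@lower_density_sub _ (F i `|` U r) _ _ _ _ (lexx _)).
  move=> q [Fq|[j jr Fq]]; first by exists i; rewrite ?mem_head.
  by exists j => //; rewrite inE jr orbT.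
apply: lower_densityU => //.
- by move=> q /FD /Df.
- by move=> q [j _ /FD /Df].
- by move=> q Fi [j jr Fj]; move: ir; rewrite (Fdisj _ _ _ Fi Fj) jr.
- exact: IH.
Qed.

(** * From cells to boxes: summation over tau *)

Lemma atan_diff_le (R : realType) (a b : R) : 0 <= a -> a < b ->
  atan b - atan a <= (b - a) / (1 + a ^+ 2).
Proof.
move=> a0 ab.
have [c] := @MVT R (@atan R) (fun x => (1 + x ^+ 2)^-1) a b ab
  (fun c _ => @is_derive1_atan R c)
  (continuous_subspaceT (@continuous_atan R)).
rewrite in_itv /= => /andP[ac cb] ->; rewrite mulrC ler_wpM2l ?subr_ge0 ?(ltW ab) //.
rewrite lef_pV2 ?posrE ?ltr_pwDl ?sqr_ge0 // lerD2l.
by rewrite ler_pXn2r ?nnegrE // ltW // (le_lt_trans a0).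
Qed.

Lemma sum_atan_ge (R : realType) (T : R) (M : nat) : 0 < T -> (0 < M)%N ->
  atan T <= \sum_(i < M) T / M%:R / (1 + (i%:R * (T / M%:R)) ^+ 2).
Proof.
move=> T0 M0; set h := T / M%:R; have MR : 0 < M%:R :> R by rewrite ltr0n.
have h0 : 0 < h by rewrite divr_gt0.
have -> : T = M%:R * h by rewrite /h mulrC divfK // lt0r_neq0.
move: h h0 => h h0; elim: M {M0 MR} => [|M IH].
  by rewrite mul0r atan0 big_ord0.
rewrite big_ord_recr /=.
have := @atan_diff_le R (M%:R * h) (M.+1%:R * h) (mulr_ge0 (ler0n _ _) (ltW h0)).
rewrite ltr_pM2r // ltr_nat => /(_ (ltnSn _)).
rewrite -mulrBl -natrB // subSnn mul1r; lra.
Qed.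

Definition tube (R : realType) (u0 u1 v0 v1 : R) : set ((R * R) * R) :=
  [set q | u0 <= q.1.1 < u1 /\ v0 < q.1.2 <= v1].

(* Slicing in [tau]: the density of hits with respect to [tau] is proportional to
   [1 / (1 + tau^2)], integrated here by lower Riemann sums over [|tau| <= T]. *)
Lemma lower_density_thin (R : realType) (u0 u1 v0 v1 T : R) :
  0 < v0 -> v0 < v1 -> 0 < T -> T * (v1 - v0) < u1 - u0 ->
  (forall q, tube u0 u1 v0 v1 q -> fund_int q.1) ->
  lower_density (tube u0 u1 v0 v1)
    (6 / pi ^+ 2 * atan T * ((u1 - u0) - T * (v1 - v0)) * (v0^-1 - v1^-1)).
Proof.
move=> v00 v01 T0 Tw inF; have v10 := lt_trans v00 v01.
have pi2 : 0 < pi ^+ 2 :> R by rewrite exprn_gt0 // pi_gt0.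
have at0 : 0 <= atan T by rewrite -atan0 le_atan // ltW.
set w := (u1 - u0) - T * (v1 - v0); set del := v0^-1 - v1^-1.
have w0 : 0 < w by rewrite subr_gt0.
have del0 : 0 < del by rewrite subr_gt0 ltf_pV2.
apply: lower_density_lim => eps eps0.
(* Slices of width [h] lose at most [h * B], as the product expanded at the end shows. *)
pose B := 6 / pi ^+ 2 * (w / v0 + v1 * atan T * del).
have B1 : 0 <= w / v0 by exact: divr_ge0 (ltW w0) (ltW v00).
have B2 : 0 <= v1 * atan T * del.
  by apply: mulr_ge0 (ltW del0); apply: mulr_ge0 => //; exact: ltW.
have B0 : 0 <= B.
  by apply: mulr_ge0; [apply: divr_ge0 => //; exact: ltW|exact: addr_ge0].
have [M [M0 M1 M2]] : exists M : nat, [/\ (0 < M)%N, T / M%:R * v1 <= w & T / M%:R * B <= eps].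
  exists (Num.truncn (T * v1 / w + T * B / eps)).+1.
  set m := (Num.truncn _).+1.
  have : T * v1 / w + T * B / eps < m%:R by exact: truncnS_gt.
  have m0 : 0 < m%:R :> R by rewrite ltr0n.
  have q1 : 0 <= T * v1 / w.
    by apply: divr_ge0 (ltW w0); apply: mulr_ge0; exact: ltW.
  have q2 : 0 <= T * B / eps.
    by apply: divr_ge0 (ltW eps0); apply: mulr_ge0 => //; exact: ltW.
  move=> mB; split => //.
    rewrite mulrAC ler_pdivrMr // -ler_pdivrMl // mulrC; lra.
  rewrite mulrAC ler_pdivrMr // -ler_pdivrMl // mulrC; lra.
set h := T / M%:R in M1 M2.
have MR : 0 < M%:R :> R by rewrite ltr0n.
have h0 : 0 < h by rewrite divr_gt0.
have MhT : M%:R * h = T by rewrite /h mulrC divfK // lt0r_neq0.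
(* Bound for the variation of tau v on a slice: [T (v1 - v0)] from the height and [h v1] from
   [tau]. *)
pose err := T * (v1 - v0) + h * v1.
(* The boolean is the sign of [tau]. Slicing symmetrically by |tau| puts tau^2 between [(i h)^2] and
   [((i + 1) h)^2] on both sides. *)
pose c0 (ib : 'I_M * bool) : R := if ib.2 then ib.1%:R * h else - (ib.1.+1%:R * h).
pose c1 (ib : 'I_M * bool) : R := if ib.2 then ib.1.+1%:R * h else - (ib.1%:R * h).
pose kap (ib : 'I_M * bool) : R := 3 / pi ^+ 2 * h * ((u1 - u0) - err) *
  ((v0 * (1 + (ib.1.+1%:R * h) ^+ 2))^-1 - (v1 * (1 + (ib.1%:R * h) ^+ 2))^-1).
have iS (i : nat) : i.+1%:R * h = i%:R * h + h by rewrite -natr1 mulrDl mul1r.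
have iT (i : 'I_M) : i%:R * h + h <= T.
  by rewrite -MhT -iS ler_pM2r // ler_nat.
have i0 (i : 'I_M) : 0 <= i%:R * h by rewrite mulr_ge0 // ltW.
suff L : lower_density (tube u0 u1 v0 v1) (\sum_ib kap ib).
  apply: lower_density_sub L => //.
  have -> : \sum_ib kap ib = \sum_(i < M) (kap (i, true) + kap (i, false)).
    rewrite -(pair_bigA _ (fun i b => kap (i, b))) /=; apply: eq_bigr => i _.
    by rewrite big_bool.
  have S1 := sum_atan_ge T0 M0; rewrite -/h in S1.
  set A := \sum_(i < M) _ in S1.
  (* The bounds at [v0] and [v1] involve right and left endpoint sums, which differ only in their
     two extreme terms. *)
  have S2 : \sum_(i < M) h / (1 + (i.+1%:R * h) ^+ 2) = A + (h / (1 + T ^+ 2) - h).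
    have : \sum_(i < M.+1) h / (1 + (i%:R * h) ^+ 2) = A + h / (1 + T ^+ 2).
      by rewrite big_ord_recr /= MhT.
    rewrite big_ord_recl /= mul0r expr0n addr0 divr1.
    under eq_bigr do rewrite /bump /= add1n.
    by move=> E; rewrite addrA -E addrC addKr.
  have hT : 0 <= h / (1 + T ^+ 2).
    by rewrite divr_ge0 ?(ltW h0) // addr_ge0 // sqr_ge0.
  rewrite (eq_bigr (fun i : 'I_M => 6 / pi ^+ 2 * ((u1 - u0) - err) *
    (v0^-1 * (h / (1 + (i.+1%:R * h) ^+ 2)) - v1^-1 * (h / (1 + (i%:R * h) ^+ 2))))); last first.
    move=> i _; rewrite /kap /= [(v0 * _)^-1]invfM [(v1 * _)^-1]invfM.
    move: (pi ^+ 2)^-1 (v0^-1) (v1^-1) ((1 + (i.+1%:R * h) ^+ 2)^-1) ((1 + (i%:R * h) ^+ 2)^-1) => a b c d e.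
    by move: (err) => err'; ring.
  rewrite -mulr_sumr.
  have -> : \sum_(i < M) (v0^-1 * (h / (1 + (i.+1%:R * h) ^+ 2)) - v1^-1 * (h / (1 + (i%:R * h) ^+ 2)))
     = v0^-1 * (A + (h / (1 + T ^+ 2) - h)) - v1^-1 * A.
    by rewrite -S2 /A sumrB !mulr_sumr.
  have -> : u1 - u0 - err = w - h * v1 by rewrite /err /w; ring.
  have w1 : 0 <= w - h * v1 by rewrite subr_ge0.
  have six : 0 <= 6 / pi ^+ 2 :> R by rewrite divr_ge0 // ltW.
  have v0i : 0 < v0^-1 by rewrite invr_gt0.
  have H1 : atan T * del - h * v0^-1 <= v0^-1 * (A + (h / (1 + T ^+ 2) - h)) - v1^-1 * A.
    rewrite (_ : _ - v1^-1 * A = A * del + v0^-1 * (h / (1 + T ^+ 2)) - h * v0^-1); last first.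
      by rewrite /del; ring.
    have := ler_wpM2r (ltW del0) S1; have := mulr_ge0 (ltW v0i) hT; lra.
  apply: (@le_trans _ _ (6 / pi ^+ 2 * (w - h * v1) * (atan T * del - h * v0^-1))); last first.
    by rewrite ler_wpM2l // mulr_ge0.
  have -> : 6 / pi ^+ 2 * (w - h * v1) * (atan T * del - h * v0^-1) =
     6 / pi ^+ 2 * atan T * w * del - h * B + 6 / pi ^+ 2 * (h * h * v1 * v0^-1).
    rewrite /B; move: (6 / pi ^+ 2) (v0^-1) (atan T) (del) (w) => a b c d e; ring.
  have : 0 <= 6 / pi ^+ 2 * (h * h * v1 * v0^-1).
    apply: mulr_ge0 => //; apply: mulr_ge0; last exact: ltW.
    by apply: mulr_ge0; [apply: mulr_ge0|]; exact: ltW.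
  by move: M2; lra.
apply: (@lower_density_sum R _ (fun ib => cell u0 u1 v0 v1 (c0 ib) (c1 ib))) => //.
- by move=> ib q [q1 [q2 _]].
- move=> [i b] [j b'] q [_ [_ q1]] [_ [_ q2]].
  have Hi (a : 'I_M) (bb : bool) (c : R) : c0 (a, bb) <= c < c1 (a, bb) ->
     (bb = true -> a%:R * h <= c < a%:R * h + h /\ 0 <= c) /\ (bb = false -> - (a%:R * h) - h <= c < - (a%:R * h) /\ c < 0).
    rewrite /c0 /c1 /= iS; have := i0 a; case: bb => h1 /andP[h2 h3];
      by clear -h0 h1 h2 h3; split => // _; split; lra.
  have lt1 (a b0 : 'I_M) : a%:R * h < b0%:R * h + h -> (a <= b0)%N.
    by rewrite -iS ltr_pM2r // ltr_nat ltnS.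
  have [pi' ni] := Hi _ _ _ q1; have [pj nj] := Hi _ _ _ q2.
  case: b {q1 Hi} pi' ni; case: b' {q2} pj nj.
  + move=> /(_ erefl)[q1 _] _ /(_ erefl)[q2 _] _; congr pair; apply: val_inj; apply/eqP.
    by rewrite eqn_leq !lt1 //; lra.
  + by move=> _ /(_ erefl)[_ q1] /(_ erefl)[_ q2]; exfalso; lra.
  + by move=> /(_ erefl)[_ q1] _ _ /(_ erefl)[_ q2]; exfalso; lra.
  + move=> _ /(_ erefl)[q1 _] _ /(_ erefl)[q2 _]; congr pair; apply: val_inj; apply/eqP.
    by rewrite eqn_leq !lt1 //; lra.
- move=> [i b].
  pose L := if b then i%:R * h * v0 else - (i%:R * h * v0) - err.
  have U_L : L + err - L = err by ring.
  have c10 : c1 (i, b) - c0 (i, b) = h.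
    by rewrite /c1 /c0 /=; case: b {L U_L}; rewrite iS; ring.
  have Hv := i0 i; have HT := iT i.
  have := @lower_density_cell R u0 u1 v0 v1 (c0 (i, b)) (c1 (i, b)) ((i%:R * h) ^+ 2) ((i.+1%:R * h) ^+ 2) L (L + err).
  rewrite U_L c10; apply => //.
  + by rewrite -subr_gt0 c10.
  + exact: sqr_ge0.
  + by rewrite /err; move: M1; rewrite /w; lra.
  + move=> t; rewrite /c0 /c1 /= iS; case: b {L U_L c10} => /andP[t1 t2]; nra.
  + move=> t v; rewrite /c0 /c1 /L /err /= iS; case: b {L U_L c10} => /andP[t1 t2] /andP[v2 v3].
      have e1 : i%:R * h * v0 <= t * v by clear -t1 t2 v2 v3 Hv v00; apply: ler_pM; lra.
      have e2 : t * v <= (i%:R * h + h) * v1 by clear -t1 t2 v2 v3 Hv v00; apply: ler_pM; lra.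
      have e3 : (i%:R * h) * (v1 - v0) <= T * (v1 - v0).
        by clear -HT h0 v01; apply: ler_wpM2r; lra.
      by apply/andP; split; nra.
    have e1 : i%:R * h * v0 <= (- t) * v by clear -t1 t2 v2 v3 Hv v00; apply: ler_pM; lra.
    have e2 : (- t) * v <= (i%:R * h + h) * v1 by clear -t1 t2 v2 v3 Hv v00; apply: ler_pM; lra.
    have e3 : (i%:R * h) * (v1 - v0) <= T * (v1 - v0).
        by clear -HT h0 v01; apply: ler_wpM2r; lra.
    by apply/andP; split; nra.
  + by move=> q [q1 [q2 _]]; apply: inF.
Qed.

Lemma ex_atan_close (R : realType) (e : R) : 0 < e ->
  exists2 T : R, 0 < T & pi / 2 - e <= atan T.
Proof.
move=> e0; have p0 := @pi_gt0 R.
pose t := Num.max (pi / 2 - e) (pi / 4).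
have [t0 [t1 t2]] : 0 < t /\ (t < pi / 2 /\ pi / 2 - e <= t).
  by rewrite /t lt_max gt_max le_max lexx /=; split; [|split => //]; lra.
have tK : atan (tan t) = t by apply: tanK; rewrite in_itv /=; lra.
exists (tan t); last by rewrite tK.
by rewrite ltNge; apply/negP => /le_atan; rewrite tK atan0; lra.
Qed.

(** [lower_density_thin] loses the width [T (v1 - v0)]. Cutting the box into [N] horizontal bands
    divides this loss by [N]; as [T] grows, 6/pi^2 * atan T tends to 3/pi. *)
Lemma lower_density_tube (R : realType) (u0 u1 v0 v1 : R) :
  u0 < u1 -> 0 < v0 -> v0 < v1 ->
  (forall q, tube u0 u1 v0 v1 q -> fund_int q.1) ->
  lower_density (tube u0 u1 v0 v1) (3 / pi * (u1 - u0) * (v0^-1 - v1^-1)).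
Proof.
move=> u01 v00 v01 inF; have v10 := lt_trans v00 v01.
have p0 := @pi_gt0 R.
have [c cD] : {c : R | c = 6 / pi ^+ 2} by exists (6 / pi ^+ 2).
have [w wD] : {w : R | w = u1 - u0} by exists (u1 - u0).
have [del delD] : {del : R | del = v0^-1 - v1^-1} by exists (v0^-1 - v1^-1).
have c0 : 0 < c by rewrite cD divr_gt0 // exprn_gt0.
have w0 : 0 < w by rewrite wD subr_gt0.
have d0 : 0 < del by rewrite delD subr_gt0 ltf_pV2.
have cE : 3 / pi = c * (pi / 2).
  by rewrite cD; move: (pi : R) p0 => p p0; field; rewrite lt0r_neq0.
rewrite -wD -delD; apply: lower_density_lim => eps eps0.
have B0 : 0 < 2 * c * w * del by rewrite !mulr_gt0.
have [e e0 eE] : exists2 e : R, 0 < e & 2 * (c * w * del * e) = eps.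
  exists (eps / (2 * c * w * del)); first by rewrite divr_gt0.
  by field; rewrite !lt0r_neq0.
have [T T0 TE] := ex_atan_close e0.
have at2 := atan_ltpi2 T.
have at0 : 0 <= atan T by rewrite -atan0 le_atan // ltW.
(* The lost width [T (v1 - v0) / N], summed over all bands, costs at most [B / N]. *)
have [B BD] : {B : R | B = c * (pi / 2) * T * (v1 - v0) * del}.
  by exists (c * (pi / 2) * T * (v1 - v0) * del).
have B'0 : 0 <= B.
  by rewrite BD !mulr_ge0 ?(ltW c0) ?(ltW T0) ?(ltW d0) //; lra.
have [N [N0 N1 N2]] : exists N : nat, [/\ (0 < N)%N, T * (v1 - v0) < w * N%:R & 2 * B <= eps * N%:R].
  exists (Num.truncn (T * (v1 - v0) / w + 2 * B / eps)).+1.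
  set m := (Num.truncn _).+1.
  have mB : T * (v1 - v0) / w + 2 * B / eps < m%:R by exact: truncnS_gt.
  have q1 : 0 <= T * (v1 - v0) / w.
    by apply: divr_ge0 (ltW w0); apply: mulr_ge0; [exact: ltW|rewrite subr_ge0 ltW].
  have q2 : 0 <= 2 * B / eps by apply: divr_ge0 (ltW eps0); exact: mulr_ge0.
  split => //.
    by rewrite [w * _]mulrC -ltr_pdivrMr //; lra.
  by rewrite [eps * _]mulrC -ler_pdivrMr //; lra.
have NR : 0 < N%:R :> R by rewrite ltr0n.
pose h := (v1 - v0) / N%:R.
have h0 : 0 < h by rewrite divr_gt0 // subr_gt0.
have Nh : v0 + N%:R * h = v1 by rewrite /h mulrC divfK ?lt0r_neq0 //; ring.
pose b (l : nat) : R := v0 + l%:R * h.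
have bS l : b l.+1 = b l + h by rewrite /b -natr1; ring.
have b0 l : v0 <= b l by rewrite lerDl mulr_ge0 // ltW.
have bN (l : 'I_N) : b l.+1 <= v1.
  by rewrite -Nh /b lerD2l ler_pM2r // ler_nat.
have Th : T * h < w by rewrite /h mulrA ltr_pdivrMr.
suff L : lower_density (tube u0 u1 v0 v1)
    (\sum_(l < N) (c * atan T * (w - T * h) * ((b l)^-1 - (b l.+1)^-1))).
  apply: lower_density_sub L => //.
  rewrite -mulr_sumr -(big_mkord xpredT (fun l => (b l)^-1 - (b l.+1)^-1)).
  have -> : \sum_(0 <= l < N) ((b l)^-1 - (b l.+1)^-1) = del.
    under eq_bigr do rewrite -opprB.
    by rewrite sumrN telescope_sumr // opprB /b mul0r addr0 Nh delD.
  have h1 : c * (pi / 2) * w * del - c * atan T * w * del <= eps / 2.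
    rewrite -eE (_ : _ - _ = c * w * del * (pi / 2 - atan T)); last by ring.
    have : c * w * del * (pi / 2 - atan T) <= c * w * del * e.
      by apply: ler_wpM2l; [rewrite !mulr_ge0 // ltW|lra].
    lra.
  have h2 : c * atan T * (T * h) * del <= eps / 2.
    apply: (@le_trans _ _ (B / N%:R)).
      rewrite (_ : B / N%:R = c * (pi / 2) * (T * h) * del); last by rewrite BD /h; ring.
      apply: ler_wpM2r; first exact: ltW.
      by apply: ler_wpM2r; [rewrite mulr_ge0 // ltW|rewrite ler_pM2l // ltW].
    by rewrite ler_pdivrMr //; lra.
  rewrite cE; lra.
apply: (@lower_density_sum R _ (fun l : 'I_N => tube u0 u1 (b l) (b l.+1))) => //.
- move=> l q [q1 /andP[q2 q3]]; split => //; apply/andP; split.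
    by apply: le_lt_trans q2.
  exact: le_trans (bN l).
- move=> l m q [_ /andP[l1 l2]] [_ /andP[m1 m2]].
  have lt1 (i j : 'I_N) : b i < b j.+1 -> (i <= j)%N.
    by rewrite /b ltrD2l ltr_pM2r // ltr_nat ltnS.
  by apply: val_inj; apply/eqP; rewrite eqn_leq !lt1 //; lra.
- move=> l; have hE : b l.+1 - b l = h by rewrite bS; ring.
  have := @lower_density_thin R u0 u1 (b l) (b l.+1) T.
  rewrite hE -cD -wD; apply => //.
  + exact: lt_le_trans (b0 l).
  + by rewrite bS ltrDl.
  + move=> q [q1 /andP[q2 q3]]; apply: inF; split => //; apply/andP; split.
      by apply: le_lt_trans q2.
    exact: le_trans (bN l).
Qed.

(** Each point hits at most one [F i], and then its value under [g], computed at the image by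
    invariance, is at least [w i]; points without a hit contribute a nonnegative amount. *)
Lemma weighted_lower_density (R : realType) (I : finType)
    (F : I -> set ((R * R) * R)) (k w : I -> R) (g : R * R -> R) :
  (forall z, upper_half z -> 0 <= g z) ->
  (forall (h : SL2Z) z, upper_half z -> g (mob h z) = g z) ->
  (forall i q, F i q -> fund_int q.1) ->
  (forall i j q, F i q -> F j q -> i = j) ->
  (forall i, 0 <= w i) -> (forall i q, F i q -> w i <= g q.1) ->
  (forall i, lower_density (F i) (k i)) ->
  forall eps, 0 < eps -> exists Y0 K : R, [/\ 0 < Y0, 0 < K &
    forall (x y : R) (n : nat), (0 < n)%N -> 0 < y -> y < Y0 ->
      K * 2 ^+ size (primes n) <= (totient n)%:R * y ->
      (totient n)%:R * (\sum_i w i * k i - eps) <=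
      \sum_(j < n | coprime j n) g (x + j%:R / n%:R, y)].
Proof.
move=> g0 ginv Ff Fdisj w0 wg LF.
suff H (r : seq I) : forall eps, 0 < eps -> exists Y0 K : R, [/\ 0 < Y0, 0 < K &
    forall (x y : R) (n : nat), (0 < n)%N -> 0 < y -> y < Y0 ->
      K * 2 ^+ size (primes n) <= (totient n)%:R * y ->
      (totient n)%:R * (\sum_(i <- r) w i * k i - eps) <=
      \sum_(i <- r) w i * (nhits (F i) n x y)%:R].
  move=> eps /(H (index_enum I))[Y0 [K [Y00 K0 HH]]]; exists Y0, K; split => //.
  move=> x y n n0 y0 yY Ky; apply: (le_trans (HH x y n n0 y0 yY Ky)).
  have nE i : (nhits (F i) n x y)%:R =
      \sum_(j < n | coprime j n) (`[< hits (F i) (x + j%:R / n%:R, y) >] : nat)%:R :> R.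
    rewrite /nhits -sum1_card -natr_sum; congr (_%:R).
    rewrite [LHS]big_mkcond [RHS]big_mkcond; apply: eq_bigr => j _; rewrite inE.
    by case: (coprime j n) => //=; case: asboolP.
  under eq_bigr do rewrite nE mulr_sumr.
  rewrite exchange_big; apply: ler_sum => j _.
  have zH : upper_half (x + j%:R / n%:R, y) by [].
  have [[i hi]|no] := pselect (exists i, hits (F i) (x + j%:R / n%:R, y)); last first.
    rewrite big1 ?g0 // => i _; case: asboolP => hi; last by rewrite mulr0.
    by case: no; exists i.
  rewrite (bigD1 i) //= big1 ?addr0.
    case: asboolP => // -[h h0 Fh]; rewrite mulr1 -(ginv h) //.
    exact: wg Fh.
  move=> l li; case: asboolP => hl; last by rewrite mulr0.
  case: hi hl => h h0 Fh [h' h0' Fh'].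
  have [mE tE] := @hits_uniq R h h' (x + j%:R / n%:R, y) y0 h0 h0' (Ff _ _ Fh) (Ff _ _ Fh').
  rewrite -mE -tE in Fh'.
  by move: li; rewrite (Fdisj _ _ _ Fh Fh') eqxx.
elim: r => [|i r IH] eps eps0.
  exists 1, 1; split => // x y n _ _ _ _; rewrite !big_nil mulr_ge0_le0 //; lra.
have e2 : 0 < eps / 2 by rewrite divr_gt0.
have w1 : 0 < w i + 1 by rewrite ltr_pwDr.
(* The added 1 allows the weight to be zero. *)
have e3 : 0 < eps / 2 / (w i + 1) by rewrite divr_gt0.
have [Y0 [K [Y00 K0 HD]]] := IH _ e2; have [Y1 [L [Y10 L0 HE]]] := LF i _ e3.
exists (Num.min Y0 Y1), (Num.max K L); split.
- by rewrite lt_min Y00.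
- by rewrite lt_max K0.
move=> x y n n0 y0; rewrite lt_min => /andP[yY0 yY1] Ky.
have p2 : 0 <= 2 ^+ size (primes n) :> R by rewrite exprn_ge0.
have h1 : K * 2 ^+ size (primes n) <= (totient n)%:R * y.
  by apply: le_trans Ky; rewrite ler_wpM2r // le_max lexx.
have h2 : L * 2 ^+ size (primes n) <= (totient n)%:R * y.
  by apply: le_trans Ky; rewrite ler_wpM2r // le_max lexx orbT.
have E1 := HD x y n n0 y0 yY0 h1.
have E2 := ler_wpM2l (w0 i) (HE x y n n0 y0 yY1 h2).
rewrite !big_cons.
have wE : w i * (eps / 2 / (w i + 1)) <= eps / 2.
  rewrite mulrA ler_pdivrMr //.
  by rewrite [leLHS]mulrC ler_wpM2l ?(ltW e2) // lerDl.
have := ler_wpM2l (ler0n R (totient n)) wE.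
move: E1 E2; set a := (nhits _ _ _ _)%:R; set S := \sum_(_ <- _) _ * _; set S' := \sum_(_ <- _) _.
by rewrite !mulrBr !mulrDr ![w i * (_ * _)]mulrCA; lra.
Qed.

(** * Grid boxes and measurability in the plane *)

(** Half-open on the same sides as [tube]: the boxes of one mesh tile the plane, and each of them is
    a tube. *)
Definition grid_box (R : realType) (N : nat) (i j : int) : set (R * R) :=
  [set z | i%:~R / N%:R <= z.1 < (i + 1)%:~R / N%:R /\ (j - 1)%:~R / N%:R < z.2 <= j%:~R / N%:R].

Lemma grid_box_mem (R : realType) (N : nat) (z : R * R) : (0 < N)%N ->
  grid_box N (Num.floor (z.1 * N%:R)) (Num.ceil (z.2 * N%:R)) z.
Proof.
move=> N0; have NR : 0 < N%:R :> R by rewrite ltr0n.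
rewrite /grid_box /= !ler_pdivrMr // !ltr_pdivlMr // ltr_pdivrMr // ler_pdivlMr //.
by split; [exact: floor_itv|exact: ceil_itv].
Qed.

Lemma grid_box_dist (R : realType) (N : nat) (i j : int) (z w : R * R) : (0 < N)%N ->
  grid_box N i j z -> grid_box N i j w -> `|z.1 - w.1| <= N%:R^-1 /\ `|z.2 - w.2| <= N%:R^-1.
Proof.
move=> N0 [/andP[a1 a2] /andP[a3 a4]] [/andP[b1 b2] /andP[b3 b4]].
move: a2 b2 a3 b3; rewrite intrD intrB !mulrDl mulNr !mul1r => a2 b2 a3 b3.
by split; rewrite ler_norml; apply/andP; split; lra.
Qed.

Lemma nbhs_grid_box (R : realType) (U : set (R * R)) (z : R * R) : nbhs z U ->
  exists N0 : nat, forall N i j, (N0 <= N)%N -> (0 < N)%N -> grid_box N i j z ->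
    grid_box N i j `<=` U.
Proof.
move=> /nbhs_ballP[e /= e0 eU].
exists (Num.truncn e^-1).+1 => N i j N0N N0 bz w bw.
apply: eU; have [d1 d2] := grid_box_dist N0 bz bw.
have Ne : N%:R^-1 < e.
  rewrite -[e]invrK ltf_pV2 ?posrE ?invr_gt0 ?ltr0n //.
  by apply: (@lt_le_trans _ _ (Num.truncn e^-1).+1%:R); [exact: truncnS_gt|rewrite ler_nat].
by split => /=; rewrite /ball /= (le_lt_trans _ Ne).
Qed.

Lemma measurable_rect (R : realType) (a b c d : R) :
  measurable [set z : R * R | a <= z.1 < b /\ c < z.2 <= d].
Proof.
rewrite (_ : mkset _ = `[a, b[%classic `*` `]c, d]%classic).
  by apply: measurableX; exact: measurable_itv.
by apply/seteqP; split => -[x y] /=; rewrite !in_itv.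
Qed.

(** Measurability refers to the product sigma-algebra, so an open set is written as a countable
    union of rectangles. *)
Lemma open_measurable2 (R : realType) (U : set (R * R)) : open U -> measurable U.
Proof.
move=> oU.
have -> : U = \bigcup_(k : nat * int * int)
   (if `[< grid_box k.1.1.+1 k.1.2 k.2 `<=` U >] then @grid_box R k.1.1.+1 k.1.2 k.2 else set0).
  apply/seteqP; split => [z Uz|z [k _]]; last by case: asboolP => // + kz; apply.
  have [N0 HN] := nbhs_grid_box (open_nbhs_nbhs (conj oU Uz)).
  have gz := @grid_box_mem R N0.+1 z (ltn0Sn _).
  exists (N0, Num.floor (z.1 * N0.+1%:R), Num.ceil (z.2 * N0.+1%:R)) => //=.
  by case: asboolP => // -[]; exact: HN gz.
apply: countable_bigcupT_measurable => // k; case: ifP => _ //.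
exact: measurable_rect.
Qed.

Lemma upper_half_open (R : realType) : open (@upper_half R).
Proof.
rewrite (_ : @upper_half R = (fun z : R * R => z.2) @^-1` [set x | 0 < x]) //.
by apply: open_comp; [move=> z _; exact: cvg_snd|exact: open_gt].
Qed.

Lemma upper_half_measurable_fun (R : realType) (g : R * R -> R) :
  (forall z, upper_half z -> {for z, continuous g}) ->
  measurable_fun (@upper_half R) g.
Proof.
move=> gc mH; apply: (measurability _ (RGenOInfty.measurableE R)) => //.
move=> _ [_ [a ->] <-]; apply: open_measurable2.
rewrite openE => z [zH gz].
have oa : open `]a, +oo[%classic := @interval_open _ _ _ _ _.
have [zU ga] : nbhs z (@upper_half R) /\ nbhs z (g @^-1` `]a, +oo[).
  split; first by apply: open_nbhs_nbhs; split => //; exact: upper_half_open.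
  by apply: gc => //; apply: open_nbhs_nbhs; split => //; exact: interval_open.
exact: filterI.
Qed.

Lemma fund_int_open (R : realType) : open (@fund_int R).
Proof.
have c1 : continuous (fun z : R * R => z.1) by move=> z; exact: cvg_fst.
have c2 : continuous (fun z : R * R => z.2) by move=> z; exact: cvg_snd.
have c3 : continuous (fun z : R * R => z.1 ^+ 2 + z.2 ^+ 2).
  by move=> z; apply: cvgD; apply: cvgM; [exact: c1|exact: c1|exact: c2|exact: c2].
rewrite (_ : @fund_int R = (fun z : R * R => z.1) @^-1` `]- (1/2), 1/2[ `&`
  (fun z : R * R => z.1 ^+ 2 + z.2 ^+ 2) @^-1` `]1, +oo[ `&`
  (fun z : R * R => z.2) @^-1` `]0, +oo[).
  by apply: openI; [apply: openI|]; apply: open_comp; (try by move=> z _; auto); exact: interval_open.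
apply/seteqP; split => -[x y]; rewrite /fund_int /= !in_itv /= !andbT.
  by move=> [-> [-> ->]].
by move=> [[-> ->] ->].
Qed.

Lemma measurable_fund_int (R : realType) : measurable (@fund_int R).
Proof. by apply: open_measurable2; exact: fund_int_open. Qed.

Lemma measurable_fund_dom (R : realType) : measurable (@fund_dom R).
Proof.
have c1 : continuous (fun z : R * R => z.1) by move=> z; exact: cvg_fst.
have c2 : continuous (fun z : R * R => z.2) by move=> z; exact: cvg_snd.
have c3 : continuous (fun z : R * R => z.1 ^+ 2 + z.2 ^+ 2).
  by move=> z; apply: cvgD; apply: cvgM; [exact: c1|exact: c1|exact: c2|exact: c2].
rewrite (_ : @fund_dom R = ~` ((fun z : R * R => z.1) @^-1` `]-oo, - (1/2)[) `&`
  ~` ((fun z : R * R => z.1) @^-1` `]1/2, +oo[) `&`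
  ~` ((fun z : R * R => z.1 ^+ 2 + z.2 ^+ 2) @^-1` `]-oo, 1[) `&`
  (fun z : R * R => z.2) @^-1` `]0, +oo[).
  by do ![apply: measurableI]; rewrite ?setCK; (try apply: measurableC);
    apply: open_measurable2; apply: open_comp; (try by move=> z _; auto); exact: interval_open.
apply/seteqP; split => -[x y]; rewrite /fund_dom /= !in_itv /= !andbT.
  move=> [/andP[a b] [c ->]]; split => //; split; [split|]; apply/negP; rewrite -leNgt //.
move=> [[[/negP a /negP b] /negP c] ->]; rewrite -!leNgt in a b c.
by split => //; apply/andP.
Qed.

Lemma fund_dom_upper (R : realType) : @fund_dom R `<=` @upper_half R.
Proof. by move=> z [_ []]. Qed.

Lemma fund_int_dom (R : realType) : @fund_int R `<=` @fund_dom R.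
Proof. by move=> z [/andP[a b] [c d]]; split; [rewrite !ltW|rewrite ltW]. Qed.

(** By vertical sections: for x other than 1/2 and -1/2 only the point of the unit circle above x
    remains. *)
Lemma fund_boundary_null (R : realType) :
  ((@lebesgue_measure R) \x (@lebesgue_measure R))%E (@fund_dom R `\` @fund_int R) = 0%E.
Proof.
have mA : measurable (@fund_dom R `\` @fund_int R).
  by apply: measurableD; [exact: measurable_fund_dom|exact: measurable_fund_int].
rewrite /= /product_measure1.
pose N : set R := [set (1/2 : R)] `|` [set - (1/2)].
have mN : measurable N by apply: measurableU; exact: measurable_set1.
have N0 : lebesgue_measure N = 0%E.
  by apply: countable_lebesgue_measure0; apply: finite_set_countable; rewrite finite_setU.
have mphi := measurable_fun_xsection (@lebesgue_measure R) mA.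
have H := @ge0_negligible_integral _ _ R (@lebesgue_measure R) setT N _ mN measurableT mphi _ N0.
rewrite H => [|x _]; last exact: measure_ge0.
apply: integral0_eq => x [_ Nx] /=.
apply/eqP; rewrite -measure_le0.
rewrite -(lebesgue_measure_set1 (Num.sqrt (1 - x ^+ 2))).
apply: le_measure; rewrite ?inE; [exact: measurable_xsection|exact: measurable_set1|].
move=> y; rewrite /xsection /= inE => -[[/andP[a b] [c d]] nint].
have xl : - (1/2) < x < 1/2.
  rewrite !lt_neqAle a b !andbT; apply/andP; split; apply/eqP => E; apply: Nx.
    by right.
  by left.
have E : y ^+ 2 = 1 - x ^+ 2.
  apply/eqP; rewrite eq_le; apply/andP; split; last by move: c => /=; lra.
  rewrite leNgt; apply/negP => h; apply: nint; split => //; split => //=; lra.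
by rewrite -E sqrtr_sqr gtr0_norm.
Qed.

(** * The hyperbolic area of the fundamental domain *)

Lemma sin_pi_6 (R : realType) : sin (pi / 6) = 1 / 2 :> R.
Proof.
have p0 := @pi_gt0 R.
have s0 : 0 < sin (pi / 6) :> R by apply: sin_gt0_pihalf; lra.
have E1 : cos (pi / 6 *+ 2) = sin (pi / 6) :> R.
  have -> : pi / 6 *+ 2 = pi / 2 - pi / 6 :> R.
    by move: (pi : R) => p; rewrite mulr2n; field.
  by rewrite cosB cos_pihalf sin_pihalf mul0r mul1r add0r.
have := cos_mulr2n (pi / 6 : R); rewrite E1 cos2sin2 mulr2n.
by move: (sin (pi / 6) : R) s0 => s s0 h; nra.
Qed.

Lemma asin_half (R : realType) : asin (1 / 2) = pi / 6 :> R.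
Proof.
have p0 := @pi_gt0 R.
by rewrite -sin_pi_6 sinK // in_itv /=; lra.
Qed.

Lemma asinN (R : realType) (x : R) : -1 <= x <= 1 -> asin (- x) = - asin x.
Proof.
move=> x1; have xi : x \in `[(-1), 1] by rewrite in_itv.
have h1 := asin_geNpi2 x1; have h2 := asin_lepi2 x1.
rewrite -{1}(asinK xi) -sinN sinK // in_itv /=; lra.
Qed.

Lemma integral_inv_sqr (R : realType) (a : R) : 0 < a ->
  (\int[@lebesgue_measure R]_(y in `[a, +oo[) ((y ^+ 2)^-1)%:E = (a^-1)%:E)%E.
Proof.
move=> a0.
have dV (x : R) : 0 < x -> is_derive x 1 (fun y : R => - y^-1) ((x ^+ 2)^-1).
  move=> x0; have xn : x != 0 by rewrite lt0r_neq0.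
  have D1 := @is_deriveV R id x 1 1 xn (@is_derive_id _ _ _ _).
  apply: (is_derive_eq (is_deriveN D1)).
  by rewrite /GRing.scale /= mulr1 opprK.
have cV (x : R) : 0 < x -> {for x, continuous (fun y : R => - y^-1)}.
  by move=> x0; apply/differentiable_continuous/derivable1_diffP; case: (dV x x0).
have cq (x : R) : 0 < x -> {for x, continuous (fun y : R => (y ^+ 2)^-1)}.
  move=> x0; apply: cvgV; first by rewrite expf_neq0 // lt0r_neq0.
  exact: exprn_continuous.
have := @ge0_continuous_FTC2y R (fun y => (y ^+ 2)^-1) (fun y => - y^-1) a 0.
rewrite -EFinB opprK add0r; apply.
- by move=> x _; rewrite invr_ge0 sqr_ge0.
- apply: continuous_in_subspaceT => x; rewrite inE /= in_itv /= andbT => ax.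
  by apply: cq; exact: lt_le_trans ax.
- rewrite -oppr0; apply: cvgN; apply/gtr0_cvgV0 => //.
  exact: nbhs_pinfty_gt.
- by move=> x ax; case: (dV x (lt_trans a0 ax)).
- by apply: cvg_at_right_filter; exact: cV.
- move=> x; rewrite in_itv /= andbT => ax.
  by rewrite derive1E; case: (dV x (lt_trans a0 ax)).
Qed.

Lemma integral_inv_sqrt (R : realType) :
  (\int[@lebesgue_measure R]_(x in `[(- (1/2))%R, (1/2)%R]) ((Num.sqrt (1 - x ^+ 2))^-1)%:E = (pi / 3)%:E)%E.
Proof.
have dA (x : R) : -1 < x < 1 -> is_derive x 1 (@asin R) ((Num.sqrt (1 - x ^+ 2))^-1).
  exact: is_derive1_asin.
have cA (x : R) : -1 < x < 1 -> {for x, continuous (@asin R)} by exact: continuous_asin.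
have cS (x : R) : -1 < x < 1 -> {for x, continuous (fun x : R => (Num.sqrt (1 - x ^+ 2))^-1)}.
  move=> /andP[x0 x1]; apply: cvgV; first by rewrite sqrtr_eq0 -ltNge; nra.
  apply: continuous_comp; last exact: sqrt_continuous.
  by apply: cvgB; [exact: cvg_cst|exact: exprn_continuous].
rewrite (@continuous_FTC2 R _ (@asin R)).
- rewrite asinN ?asin_half; last by apply/andP; split; lra.
  by rewrite -EFinB; congr (_%:E); move: (pi : R) => p; field.
- lra.
- apply: continuous_in_subspaceT => x; rewrite inE /= in_itv /= => xi.
  by apply: cS; lra.
- split.
  + move=> x; rewrite in_itv /= => xi; have xi' : -1 < x < 1 by lra.
    by case: (dA x xi').
  + by apply: cvg_at_right_filter; apply: cA; lra.
  + by apply: cvg_at_left_filter; apply: cA; lra.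
- move=> x; rewrite in_itv /= => xi; have xi' : -1 < x < 1 by lra.
  by rewrite derive1E; case: (dA x xi').
Qed.

Lemma inv_sqr_snd_measurable (R : realType) :
  measurable_fun (@fund_dom R) (fun z : R * R => (z.2 ^+ 2)^-1).
Proof.
apply: (measurable_funS (E := @upper_half R)).
- by apply: open_measurable2; exact: upper_half_open.
- exact: fund_dom_upper.
- apply: upper_half_measurable_fun => z zH.
  apply: cvgV; first by rewrite expf_neq0 // lt0r_neq0.
  by apply: cvgM; exact: cvg_snd.
Qed.

(** The inner integral over y >= sqrt(1 - x^2) is 1/sqrt(1 - x^2), and the outer one is 2
    asin(1/2). *)
Lemma fund_dom_area (R : realType) :
  (\int[(@lebesgue_measure R) \x (@lebesgue_measure R)]_(z in @fund_dom R) ((z.2 ^+ 2)^-1)%:E = (pi / 3)%:E)%E.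
Proof.
pose f : R * R -> \bar R := (fun z => ((z.2 ^+ 2)^-1)%:E) \_ (@fund_dom R).
have mf : measurable_fun [set: R * R] f.
  apply/(measurable_restrictT _ _).1; first exact: measurable_fund_dom.
  by apply/measurable_EFinP; exact: inv_sqr_snd_measurable.
have f0 z : (0 <= f z)%E.
  by apply: erestrict_ge0 => w _; rewrite lee_fin invr_ge0 sqr_ge0.
transitivity (\int[(@lebesgue_measure R) \x (@lebesgue_measure R)]_z f z)%E.
  exact: integral_mkcond.
transitivity (\int[@lebesgue_measure R]_x (fubini_F (@lebesgue_measure R) f x))%E.
  exact: fubini_tonelli1.
rewrite -integral_inv_sqrt [RHS]integral_mkcond.
apply: eq_integral => x _; rewrite /fubini_F [RHS]patchE.
case: ifPn => xi.
  have xl : - (1/2) <= x <= 1/2 by move: xi; rewrite inE /= in_itv.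
  have a0 : 0 < 1 - x ^+ 2 by nra.
  have s0 : 0 < Num.sqrt (1 - x ^+ 2) by rewrite sqrtr_gt0.
  rewrite -(integral_inv_sqr s0) [RHS]integral_mkcond.
  apply: eq_integral => y _; rewrite /f !patchE.
  have -> : ((x, y) \in @fund_dom R) = (y \in `[Num.sqrt (1 - x ^+ 2), +oo[%classic).
    apply/idP/idP; rewrite !inE /= in_itv /= andbT.
      move=> [_ [/= c y0]]; rewrite -[y in leRHS](ger0_norm (ltW y0)) -sqrtr_sqr.
      by apply: ler_wsqrtr; move: c => /= c; rewrite lerBlDl.
    move=> sy; split => //=; split; last exact: lt_le_trans sy.
    have : Num.sqrt (1 - x ^+ 2) ^+ 2 <= y ^+ 2 by rewrite ler_pXn2r ?nnegrE // ltW // (lt_le_trans s0).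
    by rewrite sqr_sqrtr ?(ltW a0) // lerBlDl.
  by [].
apply: integral0_eq => y _; rewrite /f patchE ifF //; apply/negbTE; apply: contra xi.
by rewrite !inE /= in_itv => -[].
Qed.

(** * Lower Riemann sums on the fundamental domain *)

(** Boxes of side 1/N filling -1 <= x < 1, 0 < y <= N: the refinement of the mesh exhausts the cusp
    at the same time. *)
Definition cell_box (R : realType) (N : nat) (ij : 'I_(N + N) * 'I_(N * N)) : set (R * R) :=
  grid_box N (Posz ij.1 - Posz N) (Posz ij.2 + 1).

(* Boxes not contained in the open fundamental domain get weight 0, which is
   harmless for a lower bound. *)
Definition cell_inf (R : realType) (g : R * R -> R) (N : nat) (ij : 'I_(N + N) * 'I_(N * N)) : R :=
  if `[< cell_box ij `<=` @fund_int R >] then inf (g @` @cell_box R N ij) else 0.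

(** The height of the top edge, where 1/y^2 is smallest on the box. *)
Definition cell_top (R : realType) (N : nat) (ij : 'I_(N + N) * 'I_(N * N)) : R :=
  (ij.2 + 1)%:R / N%:R.

Lemma cell_box_neq0 (R : realType) (N : nat) (ij : 'I_(N + N) * 'I_(N * N)) : (0 < N)%N ->
  @cell_box R N ij !=set0.
Proof.
move=> N0; have NR : 0 < N%:R :> R by rewrite ltr0n.
exists ((Posz ij.1 - Posz N)%:~R / N%:R, (Posz ij.2 + 1)%:~R / N%:R).
by split; rewrite /= lexx ?andbT /= ltr_pM2r ?invr_gt0 // ltr_int; lia.
Qed.

Lemma cell_box_measure (R : realType) (N : nat) (ij : 'I_(N + N) * 'I_(N * N)) : (0 < N)%N ->
  ((@lebesgue_measure R) \x (@lebesgue_measure R))%E (cell_box ij) = ((N%:R ^+ 2)^-1)%:E.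
Proof.
move=> N0; have NR : 0 < N%:R :> R by rewrite ltr0n.
rewrite /cell_box /grid_box; set i := Posz ij.1 - _; set j := Posz ij.2 + 1.
rewrite (_ : mkset _ = `[(i%:~R / N%:R : R), (i + 1)%:~R / N%:R[%classic `*`
   `]((j - 1)%:~R / N%:R : R), j%:~R / N%:R]%classic); last first.
  by apply/seteqP; split => -[x y] /=; rewrite !in_itv.
have m1 : lebesgue_measure (`[(i%:~R / N%:R : R), (i + 1)%:~R / N%:R[%classic : set R) = (N%:R^-1)%:E.
  rewrite lebesgue_measure_itv /= lte_fin ltr_pM2r ?invr_gt0 // ltr_int.
  have -> : i < i + 1 by lia.
  by rewrite -EFinB -mulrBl -intrB addrAC subrr add0r mul1r.
have m2 : lebesgue_measure (`]((j - 1)%:~R / N%:R : R), j%:~R / N%:R]%classic : set R) = (N%:R^-1)%:E.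
  rewrite lebesgue_measure_itv /= lte_fin ltr_pM2r ?invr_gt0 // ltr_int.
  have -> : j - 1 < j by lia.
  by rewrite -EFinB -mulrBl -intrB opprB addrCA subrr addr0 mul1r.
move: (measurable_itv `[(i%:~R / N%:R : R), (i + 1)%:~R / N%:R[).
move: (measurable_itv `](j - 1)%:~R / N%:R : R, j%:~R / N%:R]).
move: m1 m2; set A := [set` _]; set B := [set` _] => m1 m2 mB mA.
transitivity (lebesgue_measure A * lebesgue_measure B)%E; first exact: product_measure1E.
by rewrite m1 m2 -EFinM -invfM expr2.
Qed.

Lemma fund_dom_bound (R : realType) (z : R * R) : fund_int z -> 1 / 2 < z.2.
Proof. by move=> [/andP[a b] [c d]]; nra. Qed.

Section LowerSum.
Variables (R : realType) (g : R * R -> R).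
Hypothesis g0 : forall z, upper_half z -> 0 <= g z.
Hypothesis gc : forall z, upper_half z -> {for z, continuous g}.

Let h (z : R * R) : R := g z / z.2 ^+ 2.

Lemma cell_inf_ge0 (N : nat) (ij : 'I_(N + N) * 'I_(N * N)) : (0 < N)%N -> 0 <= cell_inf g ij.
Proof.
move=> N0; rewrite /cell_inf; case: asboolP => // sub.
have [z zB] := @cell_box_neq0 R N ij N0.
apply: lb_le_inf; first by exists (g z), z.
by move=> _ [w /sub[_ [_ w0]] <-]; exact: g0.
Qed.

Lemma cell_inf_le (N : nat) (ij : 'I_(N + N) * 'I_(N * N)) (z : R * R) :
  cell_box ij `<=` @fund_int R -> cell_box ij z -> cell_inf g ij <= g z.
Proof.
move=> sub zB; rewrite /cell_inf; case: asboolP => // _.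
apply: ge_inf; last by exists z.
by exists 0 => _ [w /sub[_ [_ w0]] <-]; exact: g0.
Qed.

Lemma h_cont z : upper_half z -> {for z, continuous h}.
Proof.
move=> zH; apply: cvgM; first exact: gc.
apply: cvgV; first by rewrite expf_neq0 // lt0r_neq0.
by apply: cvgM; exact: cvg_snd.
Qed.

Lemma h_ge0 z : upper_half z -> 0 <= h z.
Proof. by move=> zH; rewrite divr_ge0 ?g0 // sqr_ge0. Qed.

Let s (N : nat) (z : R * R) : R :=
  \sum_ij (cell_inf g ij / cell_top R ij ^+ 2 * \1_(@cell_box R N ij) z).

Lemma lower_step_near (z : R * R) (eps : R) : fund_int z -> 0 < eps ->
  exists N0 : nat, forall N, (N0 <= N)%N -> (0 < N)%N -> h z - eps <= s N z.
Proof.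
move=> zF eps0; have zH : upper_half z by case: zF => _ [].
have z2 : 1 / 2 < z.2 := fund_dom_bound zF.
have [d d0 dz] : exists2 d : R, 0 < d &
    h z - eps <= (g z - d) / (z.2 + d) ^+ 2.
  have ht : (fun d : R => (g z - d) / (z.2 + d) ^+ 2) @ (0 : R) --> h z.
    have -> : h z = (g z - 0) / (z.2 + 0) ^+ 2 by rewrite subr0 addr0.
    apply: cvgM; first by apply: cvgB; [exact: cvg_cst|exact: cvg_id].
    apply: cvgV; first by rewrite addr0 expf_neq0 // lt0r_neq0.
    by apply: cvgM; apply: cvgD; (try exact: cvg_cst); exact: cvg_id.
  have : \forall d \near (0 : R), h z - eps <= (g z - d) / (z.2 + d) ^+ 2.
    by apply: (cvgr_ge (h z) ht); lra.
  move=> /nbhs_ballP[e /= e0 eH]; exists (e / 2); first by rewrite divr_gt0.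
  apply: eH; rewrite /ball /= sub0r normrN gtr0_norm ?divr_gt0 //; lra.
have nF : nbhs z (@fund_int R `&` [set w | g z - d <= g w]).
  apply: filterI.
    by apply: open_nbhs_nbhs; split => //; exact: fund_int_open.
  by apply: (cvgr_ge (g z) (gc zH)); lra.
have [N2 HN2] := nbhs_grid_box nF.
(* The mesh must be finer than [d], so that the top edge is within [d] of [z], and the grid must
   reach above [z]. *)
exists (N2 + (Num.truncn (z.2 + d^-1 + 1)).+1)%N => N NN N0.
have NR : 0 < N%:R :> R by rewrite ltr0n.
have NB : z.2 + d^-1 + 1 < N%:R.
  apply: (@lt_le_trans _ _ (Num.truncn (z.2 + d^-1 + 1)).+1%:R); first exact: truncnS_gt.
  by rewrite ler_nat (leq_trans _ NN) // leq_addl.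
have di : 0 < d^-1 by rewrite invr_gt0.
have N1R : 1 <= N%:R :> R by lra.
have zG := @grid_box_mem R N z N0.
set i := Num.floor _ in zG; set j := Num.ceil _ in zG.
have i1 : - Posz N <= i.
  rewrite /i floor_ge_int mulrNz -[(Posz N)%:~R]/(N%:R); case: zF => /andP[]; nra.
have i2 : i < Posz N.
  rewrite /i floor_lt_int -[(Posz N)%:~R]/(N%:R); case: zF => /andP[]; nra.
have j1 : 0 < j by rewrite ceil_gt0 mulr_gt0.
have j2 : j <= Posz (N * N)%N.
  rewrite /j ceil_le_int -[(Posz _)%:~R]/((N * N)%:R) natrM ler_pM2r //; lra.
have iP : (absz (i + Posz N)%R < N + N)%N by lia.
have jP : (absz (j - 1)%R < N * N)%N by lia.
pose ij : 'I_(N + N) * 'I_(N * N) := (Ordinal iP, Ordinal jP).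
have E : @cell_box R N ij = grid_box N i j.
  by rewrite /cell_box /=; congr (grid_box N _ _); clear -i1 j1; lia.
have sub : @cell_box R N ij `<=` @fund_int R `&` [set w | g z - d <= g w].
  by rewrite E; apply: HN2 => //; exact: leq_trans (leq_addr _ _) NN.
have ci : g z - d <= cell_inf g ij.
  rewrite /cell_inf; case: asboolP => [_|[]]; last by move=> w /sub[].
  apply: lb_le_inf; first by exists (g z), z => //; rewrite E.
  by move=> _ [w /sub[_ ?] <-].
have ct : z.2 <= cell_top R ij <= z.2 + d.
  have -> : cell_top R ij = j%:~R / N%:R.
    rewrite /cell_top /= -[(_ + 1)%:R]/((Posz (absz (j - 1)%R + 1)%N)%:~R); congr (_%:~R / _);
      by clear -j1; lia.
  case: zG => _ /andP[]; rewrite intrB mulrBl => z3 ->.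
  have : 1%:~R / N%:R <= d by rewrite div1r -[d]invrK lef_pV2 ?posrE ?invr_gt0 //; lra.
  by rewrite /=; lra.
have top0 : 0 < cell_top R ij by case/andP: ct; lra.
rewrite /s (bigD1 ij) //= indicE mem_set; last by rewrite E.
rewrite mulr1; apply: ler_wpDr.
  apply: sumr_ge0 => kl _; apply: mulr_ge0; last by rewrite indicE.
  by apply: divr_ge0; [exact: cell_inf_ge0|exact: sqr_ge0].
apply: (le_trans dz).
have ci0 := cell_inf_ge0 ij N0.
have [gd|gd] := leP (g z - d) 0.
  apply: (@le_trans _ _ 0); last by rewrite divr_ge0 // sqr_ge0.
  by rewrite mulr_le0_ge0 // invr_ge0 sqr_ge0.
apply: ler_pM => //; [exact: ltW|by rewrite invr_ge0 sqr_ge0|].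
rewrite lef_pV2 ?posrE ?exprn_gt0 //; last by lra.
by case/andP: ct => _ ct; rewrite ler_pXn2r ?nnegrE //; lra.
Qed.

Lemma lower_step_ge0 N z : (0 < N)%N -> 0 <= s N z.
Proof.
move=> N0; apply: sumr_ge0 => kl _; apply: mulr_ge0; last by rewrite indicE.
by apply: divr_ge0; [exact: cell_inf_ge0|exact: sqr_ge0].
Qed.

Let mu2 := ((@lebesgue_measure R) \x (@lebesgue_measure R))%E.

Lemma measurable_cell_box (N : nat) (ij : 'I_(N + N) * 'I_(N * N)) : measurable (@cell_box R N ij).
Proof. exact: measurable_rect. Qed.

Lemma measurable_lower_step N (D : set (R * R)) : measurable_fun D (s N).
Proof.
apply: measurable_sum => ij; apply: measurable_funM => //.
by apply: measurable_indic; exact: measurable_cell_box.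
Qed.

Lemma integral_lower_step N : (0 < N)%N ->
  (\int[mu2]_z (s N z)%:E = (\sum_(ij : 'I_(N + N) * 'I_(N * N)) cell_inf g ij / cell_top R ij ^+ 2 * (N%:R ^+ 2)^-1)%:E)%E.
Proof.
move=> N0; have c0 (ij : 'I_(N + N) * 'I_(N * N)) : 0 <= cell_inf g ij / cell_top R ij ^+ 2.
  by apply: divr_ge0; [exact: cell_inf_ge0|exact: sqr_ge0].
transitivity (\int[mu2]_z (\sum_(ij : 'I_(N + N) * 'I_(N * N)) (cell_inf g ij / cell_top R ij ^+ 2 * \1_(@cell_box R N ij) z)%:E)%R)%E.
  by apply: eq_integral => z _; rewrite sumEFin.
rewrite ge0_integral_sum //; first last.
- by move=> ij z _; rewrite lee_fin mulr_ge0 // indicE.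
- move=> ij; apply/measurable_EFinP; apply: measurable_funM => //.
  by apply: measurable_indic; exact: measurable_cell_box.
rewrite -sumEFin; apply: eq_bigr => ij _.
under eq_integral do rewrite EFinM.
rewrite ge0_integralZl //; first last.
- by rewrite lee_fin.
- by apply/measurable_EFinP; apply: measurable_indic; exact: measurable_cell_box.
rewrite integral_indic //; last exact: measurable_cell_box.
have H : mu2 (cell_box ij) = ((N%:R ^+ 2)^-1)%:E by exact: cell_box_measure.
by rewrite setIT [RHS]EFinM -H.
Qed.

Lemma h_measurable : measurable_fun (@upper_half R) h.
Proof. by apply: upper_half_measurable_fun => z; exact: h_cont. Qed.

Lemma h_measurable_dom : measurable_fun (@fund_dom R) h.
Proof.
apply: measurable_funS h_measurable; [|exact: fund_dom_upper].
by apply: open_measurable2; exact: upper_half_open.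
Qed.

(** [lower_step_near] only bounds the step functions from below. Their minimum with [h] converges to
    [h] and is dominated by it, so dominated convergence applies on the unbounded domain. *)
Lemma fund_lower_sum (r eps : R) :
  (\int[mu2]_(z in @fund_dom R) (h z)%:E = r%:E)%E -> 0 < eps ->
  exists2 N : nat, (0 < N)%N &
    r - eps <= \sum_(ij : 'I_(N + N) * 'I_(N * N)) cell_inf g ij / cell_top R ij ^+ 2 * (N%:R ^+ 2)^-1.
Proof.
move=> hr eps0; have mF := @measurable_fund_int R; have mD := @measurable_fund_dom R.
have mhD : measurable_fun (@fund_dom R) (EFin \o h).
  by apply/measurable_EFinP; exact: h_measurable_dom.
have mh : measurable_fun (@fund_int R) (EFin \o h).
  by apply: measurable_funS mhD => //; exact: fund_int_dom.
have hI : (\int[mu2]_(z in @fund_int R) (h z)%:E = r%:E)%E.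
  rewrite -hr (@ge0_negligible_integral _ _ _ mu2 (@fund_dom R) (@fund_dom R `\` @fund_int R)) //.
  - congr (integral _ _ _); rewrite setDD; apply/esym/setIidPr; exact: fund_int_dom.
  - exact: measurableD.
  - by move=> z /fund_dom_upper zH; rewrite lee_fin h_ge0.
  - exact: fund_boundary_null.
have ih : mu2.-integrable (@fund_int R) (EFin \o h).
  apply/integrableP; split => //.
  apply: (@le_lt_trans _ _ r%:E); last exact: ltry.
  rewrite -hI le_eqVlt; apply/orP; left; apply/eqP; apply: eq_integral.
  move=> z; rewrite inE => zF; rewrite /= ger0_norm // h_ge0 //.
  by apply: fund_dom_upper; exact: fund_int_dom.
pose t (n : nat) (z : R * R) : \bar R := mine (s n.+1 z)%:E (h z)%:E.
have mt n : measurable_fun (@fund_int R) (t n).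
  by apply: measurable_mine => //; apply/measurable_EFinP; exact: measurable_lower_step.
have tE n z : t n z = (Num.min (s n.+1 z) (h z))%:E by rewrite /t EFin_min.
have Dn : forall z, @fund_int R z -> t^~ z n @[n --> \oo] --> (EFin \o h) z.
  move=> z zF; under eq_fun do rewrite tE; apply: cvg_EFin; first by near=> n.
  apply/cvgrPdist_le => e e0; have [N0 HN] := lower_step_near zF e0.
  near=> n; have : (N0 <= n.+1)%N by apply: ltnW; near: n; exact: nbhs_infty_ge.
  move=> /HN/(_ (ltn0Sn _)) hs; rewrite /= ler_norml; apply/andP; split.
    have : Num.min (s n.+1 z) (h z) <= h z by rewrite ge_min lexx orbT.
    by lra.
  have : h z - e <= Num.min (s n.+1 z) (h z) by rewrite le_min hs /=; lra.
  by lra.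
have tb n z : @fund_int R z -> (`|t n z| <= (EFin \o h) z)%E.
  move=> zF; have zH := fund_dom_upper (fund_int_dom zF).
  rewrite tE /= lee_fin ger0_norm; first by rewrite ge_min lexx orbT.
  by rewrite le_min h_ge0 // lower_step_ge0.
have C := @dominated_cvg _ _ _ mu2 _ mF t _ (EFin \o h) mt Dn (fun _ _ => erefl) ih tb.
rewrite hI in C.
have : \forall n \near \oo, ((r - eps)%:E < \int[mu2]_(z in @fund_int R) t n z)%E.
  apply: (C [set y | ((r - eps)%:E < y)%E]).
  by apply: (@nbhs_open_ereal_gt _ r (fun x => x - eps)); lra.
move=> [n _ /(_ n (leqnn n)) Hn]; exists n.+1 => //.
rewrite -lee_fin -integral_lower_step //.
apply: (le_trans (ltW Hn)).
apply: (@le_trans _ _ (\int[mu2]_(z in @fund_int R) (s n.+1 z)%:E)%E).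
  apply: ge0_le_integral => //.
  - move=> z zF; have zH := fund_dom_upper (fund_int_dom zF).
    by rewrite tE lee_fin le_min h_ge0 // lower_step_ge0.
  - exact: mt.
  - by apply/measurable_EFinP; exact: measurable_lower_step.
  - by move=> z _; rewrite tE lee_fin ge_min lexx.
apply: ge0_subset_integral => //.
- by apply/measurable_EFinP; exact: measurable_lower_step.
- by move=> z _; rewrite lee_fin lower_step_ge0.
Unshelve. all: by end_near.
Qed.

End LowerSum.

Lemma grid_box_inj (R : realType) (N : nat) (i j k l : int) (z : R * R) : (0 < N)%N ->
  grid_box N i j z -> grid_box N k l z -> i = k /\ j = l.
Proof.
move=> N0; have NR : 0 < N%:R :> R by rewrite ltr0n.
rewrite /grid_box /= !ler_pdivrMr // !ltr_pdivlMr // !ltr_pdivrMr // !ler_pdivlMr //.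
move=> [/andP[a1 a2] /andP[a3 a4]] [/andP[b1 b2] /andP[b3 b4]].
have := le_lt_trans a1 b2; have := le_lt_trans b1 a2.
have := lt_le_trans a3 b4; have := lt_le_trans b3 a4.
by rewrite !ltr_int; lia.
Qed.

Lemma cell_box_inj (R : realType) (N : nat) (ij kl : 'I_(N + N) * 'I_(N * N)) (z : R * R) :
  (0 < N)%N -> cell_box ij z -> cell_box kl z -> ij = kl.
Proof.
move=> N0 /(grid_box_inj N0) H /H[]; case: ij {H} => i j; case: kl => k l /= E1 E2.
by congr pair; apply: val_inj => /=; lia.
Qed.

Lemma lower_density_cell_box (R : realType) (N : nat) (ij : 'I_(N + N) * 'I_(N * N)) :
  (0 < N)%N -> cell_box ij `<=` @fund_int R ->
  lower_density [set q | cell_box ij q.1] (3 / pi * ((N%:R ^+ 2)^-1 / cell_top R ij ^+ 2)).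
Proof.
move=> N0 sub; have NR : 0 < N%:R :> R by rewrite ltr0n.
pose u0 : R := (Posz ij.1 - Posz N)%:~R / N%:R; pose v1 := cell_top R ij.
pose v0 : R := ij.2%:R / N%:R.
have E : (Posz ij.2 + 1)%:~R = (ij.2 + 1)%:R :> R by [].
have v01 : v1 = v0 + N%:R^-1 by rewrite /v1 /cell_top /v0 natrD mulrDl mul1r.
have Ni : 0 < N%:R^-1 :> R by rewrite invr_gt0.
have boxE : [set q : (R * R) * R | cell_box ij q.1] = tube u0 (u0 + N%:R^-1) v0 v1.
  have E1 : (Posz ij.1 - Posz N + 1)%:~R / N%:R = u0 + N%:R^-1.
    by rewrite [(_ + 1)%:~R]intrD mulrDl mul1r.
  by apply/seteqP; split => q; rewrite /cell_box /grid_box /tube /= E1 E addrK.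
have v0_ge0 : 0 <= v0 by rewrite divr_ge0 // ltW.
(* A box of the bottom row contains points of height at most 1/2, so it is not inside the
   fundamental domain. *)
have v0_gt0 : 0 < v0.
  rewrite lt_neqAle v0_ge0 andbT; apply/eqP => v00.
  have zb : tube u0 (u0 + N%:R^-1) v0 v1 ((u0, Num.min v1 (1 / 2)), 0).
    split => /=; first by rewrite lexx ltrDl.
    by rewrite ge_min lexx andbT lt_min v01 -v00 add0r Ni /=; lra.
  move: zb; rewrite -boxE => /sub/fund_dom_bound /=.
  by rewrite lt_min ltxx andbF.
rewrite boxE; apply: (@lower_density_sub _ _ _ _ _ (fun _ => id) _ (lower_density_tube _ v0_gt0 _ _)); first last.
- by move=> q; rewrite -boxE => /sub.
- by rewrite v01 ltrDl.
- by rewrite ltrDl.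
have p0 := @pi_gt0 R.
have v1_gt0 : 0 < v1 by rewrite v01 addr_gt0.
rewrite -[leRHS]mulrA ler_pM2l; last by rewrite divr_gt0.
have -> : v0^-1 - v1^-1 = N%:R^-1 / (v0 * v1).
  have -> : N%:R^-1 = v1 - v0 by rewrite v01; ring.
  by field; rewrite !lt0r_neq0.
have -> : (u0 + N%:R^-1 - u0) * (N%:R^-1 / (v0 * v1)) = (N%:R ^+ 2)^-1 * (v0 * v1)^-1.
  by rewrite addrAC subrr add0r mulrA -invfM -expr2.
rewrite -/v1 ler_pM2l ?invr_gt0 ?exprn_gt0 //.
have v01' : v0 <= v1 by rewrite v01 lerDl ltW.
have h1 : 0 < v0 * v1 by rewrite mulr_gt0.
have h2 : v0 * v1 <= v1 ^+ 2 by rewrite expr2 ler_pM2r.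
by rewrite lef_pV2 ?posrE // (lt_le_trans h1).
Qed.

Lemma primitive_lower_bound (R : realType) (g : R * R -> R) (r eps : R) :
  (forall z, upper_half z -> 0 <= g z) ->
  (forall z, upper_half z -> {for z, continuous g}) ->
  (forall (h : SL2Z) z, upper_half z -> g (mob h z) = g z) ->
  (\int[(@lebesgue_measure R) \x (@lebesgue_measure R)]_(z in @fund_dom R)
     (g z / z.2 ^+ 2)%:E = r%:E)%E ->
  0 < eps -> exists Y0 K : R, [/\ 0 < Y0, 0 < K &
    forall (x y : R) (n : nat), (0 < n)%N -> 0 < y -> y < Y0 ->
      K * 2 ^+ size (primes n) <= (totient n)%:R * y ->
      (totient n)%:R * (3 / pi * r - eps) <=
      \sum_(j < n | coprime j n) g (x + j%:R / n%:R, y)].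
Proof.
move=> g0 gc ginv gr eps0; have p0 := @pi_gt0 R.
have c0 : 0 < 3 / pi :> R by rewrite divr_gt0.
have e2 : 0 < eps / 2 by rewrite divr_gt0.
have e3 : 0 < eps / 2 / (3 / pi) by rewrite divr_gt0.
have [N N0 HN] := fund_lower_sum g0 gc gr e3.
pose good (ij : 'I_(N + N) * 'I_(N * N)) := `[< cell_box ij `<=` @fund_int R >].
pose F ij : set ((R * R) * R) := if good ij then [set q | cell_box ij q.1] else set0.
pose k ij : R := if good ij then 3 / pi * ((N%:R ^+ 2)^-1 / cell_top R ij ^+ 2) else 0.
have h1 ij q : F ij q -> fund_int q.1.
  by rewrite /F /good; case: asboolP => // sub /sub.
have h2 ij kl q : F ij q -> F kl q -> ij = kl.
  rewrite /F /good; case: asboolP => // _ qi; case: asboolP => // _.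
  exact: cell_box_inj qi.
have h3 ij : 0 <= @cell_inf R g N ij by exact: cell_inf_ge0.
have h4 ij q : F ij q -> cell_inf g ij <= g q.1.
  by rewrite /F /good; case: asboolP => // sub; exact: cell_inf_le.
have h5 ij : lower_density (F ij) (k ij).
  rewrite /F /k /good; case: asboolP => [sub|_]; last exact: lower_density_le0.
  exact: lower_density_cell_box.
have [Y0 [K [Y00 K0 H]]] := weighted_lower_density g0 ginv h1 h2 h3 h4 h5 e2.
exists Y0, K; split => // x y n n0 y0 yY Ky.
apply: le_trans (H x y n n0 y0 yY Ky); rewrite ler_wpM2l //.
have -> : \sum_i cell_inf g i * k i =
   3 / pi * \sum_(ij : 'I_(N + N) * 'I_(N * N)) cell_inf g ij / cell_top R ij ^+ 2 * (N%:R ^+ 2)^-1.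
  rewrite mulr_sumr; apply: eq_bigr => ij _; rewrite /k /good /cell_inf.
  case: asboolP => _; last by rewrite !mul0r !mulr0.
  by ring.
have := ler_wpM2l (ltW c0) HN; rewrite mulrBr [3 / pi * (eps / 2 / _)]mulrC divfK ?lt0r_neq0 //.
lra.
Qed.

(** * Inversion of rational points and splitting of fractions *)

Lemma inv_periodic (R : realType) (f : R * R -> R) (k : int) (x y : R) :
  (forall (g : SL2Z) z, upper_half z -> f (mob g z) = f z) -> 0 < y ->
  f (x + k%:~R, y) = f (x, y).
Proof.
move=> finv y0; have det : 1 * 1 - k * 0 == 1 :> int by rewrite mulr0 subr0 mulr1.
rewrite -(finv (mkSL2Z det) (x, y)) //; congr f; rewrite /mob /=.
have E0 : (0 : int)%:~R = 0 :> R by [].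
have E1 : (1 : int)%:~R = 1 :> R by [].
by rewrite E0 E1 !mul0r !add0r expr1n expr0n addr0 !divr1 mulr0 mul0r addr0 !mulr1 mul1r.
Qed.

Lemma inv_rational (R : realType) (f : R * R -> R) (N : nat) (m m' : int) (y : R) :
  (forall (g : SL2Z) z, upper_half z -> f (mob g z) = f z) ->
  (0 < N)%N -> (Posz N %| m * m' + 1)%Z -> 0 < y ->
  f (m%:~R / N%:R, y) = f (m'%:~R / N%:R, (N%:R ^+ 2 * y)^-1).
Proof.
move=> finv N0 /dvdzP[k kE] y0; have NR : 0 < N%:R :> R by rewrite ltr0n.
(* The bottom row [(N, -m)] sends m/N to the cusp at infinity, so cz + d = i N y. *)
have det : m' * (- m) - (- k) * Posz N == 1.
  by rewrite mulrN mulNr opprK -kE; apply/eqP; ring.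
rewrite -(finv (mkSL2Z det) (m%:~R / N%:R, y)) //; congr f; rewrite /mob /=.
rewrite -[(Posz N)%:~R]/(N%:R) !intrN.
have -> : N%:R * (m%:~R / N%:R) = m%:~R :> R by field; rewrite lt0r_neq0.
rewrite subrr expr0n add0r mulr0 add0r.
by congr pair; field; rewrite !lt0r_neq0.
Qed.

Lemma ex_neg_inverse (a n : nat) : (0 < n)%N -> coprime a n ->
  exists2 u : nat, (u < n)%N & (n %| a * u + 1)%N.
Proof.
move=> n0 co; have [a0|a0] := posnP a.
  by move: co; rewrite a0 /coprime gcd0n => /eqP ->; exists 0%N.
have [[u v] /= uv] := coprimeP n a0 co.
exists ((n.-1 * u) %% n)%N; first by rewrite ltn_mod.
rewrite /dvdn -modnDml modnMmr modnDml -/(dvdn _ _).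
have au : (u * a = v * n + 1)%N by lia.
rewrite mulnCA [(a * u)%N]mulnC au.
have -> : (n.-1 * (v * n + 1) + 1 = (n.-1 * v + 1) * n)%N by case: n n0 {co uv au} => // n _ /=; ring.
exact: dvdn_mull.
Qed.

(** The numerators p n + j q and r n + j' q must have product -1 modulo q n. By the Chinese
    remainder theorem this means p r n^2 = -1 modulo q, solved by one [r] for all [j], and q^2 j j'
    = -1 modulo n, which permutes the residues. *)
Lemma primitive_inversion (R : realType) (f : R * R -> R) (p : int) (q n : nat) (y : R) :
  (forall (g : SL2Z) z, upper_half z -> f (mob g z) = f z) ->
  (0 < q)%N -> (0 < n)%N -> coprime `|p|%N q -> coprime n q -> 0 < y ->
  exists x' : R, \sum_(j < n | coprime j n) f (p%:~R / q%:R + j%:R / n%:R, y) =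
    \sum_(j < n | coprime j n) f (x' + j%:R / n%:R, ((q * n)%:R ^+ 2 * y)^-1).
Proof.
move=> finv q0 n0 copq conq y0.
have qR : q%:R != 0 :> R by rewrite pnatr_eq0 -lt0n.
have nR : n%:R != 0 :> R by rewrite pnatr_eq0 -lt0n.
have [r rP] : exists r : int, (Posz q %| p * r * Posz (n ^ 2) + 1)%Z.
  have co : coprime (`|p| * n ^ 2) q by rewrite coprimeMl copq coprimeXl.
  have [u _ uP] := ex_neg_inverse q0 co.
  exists (sgz p * Posz u).
  rewrite (_ : _ + 1 = Posz (`|p| * n ^ 2 * u + 1)%N) //.
  have -> : p * (sgz p * Posz u) = Posz `|p|%N * Posz u by rewrite mulrA -[p * sgz p]/(_) abszE normrEsg; ring.
  by rewrite PoszD !PoszM; ring.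
exists (r%:~R / q%:R).
pose P (j j' : 'I_n) := (n %| q ^ 2 * j * j' + 1)%N.
have exP (j : 'I_n) : coprime j n -> exists j', P j j'.
  move=> co; have co' : coprime (q ^ 2 * j) n.
    by rewrite coprimeMl co andbT coprimeXl // coprime_sym.
  by have [u un uP] := ex_neg_inverse n0 co'; exists (Ordinal un).
have Psym j j' : P j j' = P j' j by rewrite /P -!mulnA [(j * j')%N]mulnC.
have Pco j j' : P j j' -> coprime j n.
  rewrite /P => d; rewrite /coprime; apply/eqP.
  have g1 : (gcdn j n %| q ^ 2 * j * j')%N by rewrite dvdn_mulr // dvdn_mull // dvdn_gcdl.
  have := dvdn_trans (dvdn_gcdr j n) d; rewrite dvdn_addr // dvdn1; exact/eqP.
have Puniq j k l : P j k -> P j l -> k = l.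
  move=> jk jl; have co := Pco _ _ jk.
  have co' : coprime n (q ^ 2 * j).
    by rewrite coprimeMr coprimeXr // coprime_sym.
  apply: val_inj => /=.
  have : (q ^ 2 * j * k = q ^ 2 * j * l %[mod n])%N.
    apply/eqP; rewrite -(eqn_modDr 1); move: jk jl.
    by rewrite /P /dvdn => /eqP -> /eqP ->.
  wlog kl : k l jk jl / (k <= l)%N.
    by move=> H E; case/orP: (leq_total k l) => h; [exact: H|apply/esym; exact: H].
  move=> /eqP; rewrite eq_sym eqn_mod_dvd ?leq_mul // -mulnBr Gauss_dvdr //.
  have ll := ltn_ord l; have [|lk] := posnP (l - k)%N; first by lia.
  by move=> /(dvdn_leq lk); lia.
pose s (j : 'I_n) : 'I_n := if [pick j' | P j j'] is Some j' then j' else j.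
have sP (j : 'I_n) : coprime j n -> P j (s j).
  move=> /exP[j' Pj]; rewrite /s; case: pickP => // H.
  by have := H j'; rewrite Pj.
have sco (j : 'I_n) : coprime j n -> coprime (s j) n.
  by move=> /sP; rewrite Psym => /Pco.
have ss (j : 'I_n) : coprime j n -> s (s j) = j.
  move=> co; have h1 := sP _ co; have h2 := sP _ (sco _ co).
  by apply: Puniq h2 _; rewrite Psym.
(* The relation [P] is symmetric, so [s] is an involution on the residues coprime to [n]. *)
rewrite [RHS](reindex_onto s s) //=.
apply: eq_big => [j|j co].
  apply/idP/andP => [co|[co /eqP <-]]; first by rewrite sco // ss.
  exact: sco.
have h := sP _ co.
have -> : p%:~R / q%:R + j%:R / n%:R = (p * Posz n + Posz j * Posz q)%:~R / (q * n)%:R :> R.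
  by rewrite intrD !intrM natrM -![(Posz _)%:~R]/(_%:R); field; rewrite ?qR ?nR.
have -> : r%:~R / q%:R + (s j)%:R / n%:R = (r * Posz n + Posz (s j) * Posz q)%:~R / (q * n)%:R :> R.
  by rewrite intrD !intrM natrM -![(Posz _)%:~R]/(_%:R); field; rewrite ?qR ?nR.
apply: inv_rational => //; first by rewrite muln_gt0 q0.
rewrite PoszM Gauss_dvdz; last by rewrite coprimezE coprime_sym.
apply/andP; split.
  rewrite (_ : _ + 1 = (p * r * Posz (n ^ 2) + 1) + Posz q * (p * Posz n * Posz (s j) + r * Posz n * Posz j + Posz j * Posz (s j) * Posz q)).
    by apply: rpredD => //; apply: dvdz_mulr; exact: dvdzz.
  have -> : Posz (n ^ 2)%N = Posz n * Posz n by rewrite -PoszM mulnn.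
  ring.
rewrite (_ : _ + 1 = Posz (q ^ 2 * j * s j + 1)%N + Posz n * (p * r * Posz n + p * Posz (s j) * Posz q + r * Posz j * Posz q)).
  by apply: rpredD => //; apply: dvdz_mulr; exact: dvdzz.
have -> : Posz (q ^ 2 * j * s j + 1)%N = Posz q * Posz q * Posz j * Posz (s j) + 1.
  by rewrite PoszD !PoszM.
ring.
Qed.

Lemma sum_gcdn_eq (R : realType) (e d : nat) (F : R -> R) : (0 < e)%N -> (0 < d)%N ->
  \sum_(j < e * d | gcdn j (e * d) == e) F (j%:R / (e * d)%:R) =
  \sum_(i < d | coprime i d) F (i%:R / d%:R).
Proof.
move=> e0 d0.
rewrite (eq_bigl (fun j : 'I_(e * d) => (e %| j)%N && (gcdn j (e * d) == e))); last first.
  move=> j; apply/eqP/andP => [E|[_ /eqP]] //.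
  by rewrite -{1}E dvdn_gcdl E eqxx.
rewrite big_mkcondr.
rewrite -(big_mkord (fun j => e %| j)%N (fun j => if gcdn j (e * d) == e then F (j%:R / (e * d)%:R) else 0)).
rewrite big_dvdn_nat // big_mkord [RHS]big_mkcond; apply: eq_bigr => i _.
rewrite -muln_gcdr -{2}[e]muln1 eqn_pmul2l // -/(coprime _ _); case: ifP => // _.
congr F; rewrite !natrM; field.
by rewrite !pnatr_eq0 -!lt0n e0 d0.
Qed.

Lemma sum_by_denominator (R : realType) (n : nat) (F : R -> R) : (0 < n)%N ->
  \sum_(j < n) F (j%:R / n%:R) =
  \sum_(d < n.+1 | (d %| n)%N) \sum_(i < d | coprime i d) F (i%:R / d%:R).
Proof.
move=> n0.
have gn (j : 'I_n) : (n %/ gcdn j n < n.+1)%N by rewrite ltnS leq_div.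
rewrite (partition_big (fun j => Ordinal (gn j)) (fun d : 'I_n.+1 => (d %| n)%N)) /=; last first.
  by move=> j _; rewrite dvdn_div // dvdn_gcdr.
apply: eq_bigr => -[d dn] /= dvd; have d0 := dvdn_gt0 n0 dvd.
have e0 : (0 < n %/ d)%N by rewrite divn_gt0 // -ltnS.
rewrite -(sum_gcdn_eq F e0 d0) divnK //; apply: eq_bigl => j; rewrite -val_eqE /=.
have gj : (0 < gcdn j n)%N by rewrite gcdn_gt0 n0 orbT.
have gdn : (gcdn j n %| n)%N by exact: dvdn_gcdr.
by apply/eqP/eqP => [<-|->]; rewrite divnA // mulKn.
Qed.

(** With g = gcd(n, q) the hypothesis forces gcd(n^2, q) = g, hence q2 = q/g is coprime to n. A
    Bezout relation u g + v q2 = 1 then splits p/q into p u/q2 + p v/g. *)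
Lemma split_fraction (p : int) (q n : nat) : (0 < q)%N -> coprime `|p|%N q ->
  (gcdn (n ^ 2) q %| n)%N -> (0 < n)%N ->
  exists (p2 k : int) (q2 : nat), [/\ (0 < q2)%N, coprime `|p2|%N q2, coprime n q2, (q2 <= q)%N &
    forall R : realType, p%:~R / q%:R = p2%:~R / q2%:R + k%:~R / n%:R :> R].
Proof.
move=> q0 copq gd n0.
pose g := gcdn n q; have g0 : (0 < g)%N by rewrite gcdn_gt0 n0.
have gE : gcdn (n ^ 2) q = g.
  apply/eqP; rewrite eqn_dvd; apply/andP; split.
    by rewrite dvdn_gcd gd dvdn_gcdr.
  by rewrite dvdn_gcd dvdn_gcdr (dvdn_trans (dvdn_gcdl _ _)) // expnS dvdn_mulr.
pose q2 := (q %/ g)%N.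
have qE : (q = q2 * g)%N by rewrite divnK // dvdn_gcdr.
have q20 : (0 < q2)%N by move: q0; rewrite qE muln_gt0 => /andP[].
have [e nE] : exists e, (n = e * g)%N by apply/dvdnP; exact: dvdn_gcdl.
have con : coprime n q2.
  have : (gcdn (n * e) q2 * g = g)%N.
    rewrite muln_gcdl -qE -mulnA -nE -gE; congr gcdn.
  move=> /eqP; rewrite -{2}[g]mul1n eqn_pmul2r // => /eqP E.
  have : (gcdn n q2 %| 1)%N by rewrite -E dvdn_gcd dvdn_gcdr andbT (dvdn_trans (dvdn_gcdl _ _)) // dvdn_mulr.
  by rewrite dvdn1.
have cog : coprimez (Posz g) (Posz q2).
  rewrite /coprimez /=; apply: coprime_dvdl con; exact: dvdn_gcdl.
have /coprimezP[[u v] /= uv] := cog.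
exists (p * u), (p * v * Posz e), q2; split => //.
- have : coprimez (p * u) (Posz q2).
    rewrite coprimezMl; apply/andP; split.
      by rewrite /coprimez; apply: coprime_dvdr copq; rewrite /= [X in (_ %| X)%N]qE dvdn_mulr.
    by apply/coprimezP; exists (Posz g, v) => /=; rewrite -uv; ring.
  by [].
- by rewrite /q2 leq_div.
move=> R.
have q2R : q2%:R != 0 :> R by rewrite pnatr_eq0 -lt0n.
have gR : g%:R != 0 :> R by rewrite pnatr_eq0 -lt0n.
have eR : e%:R != 0 :> R by rewrite pnatr_eq0 -lt0n; move: n0; rewrite nE muln_gt0 => /andP[].
have uvR : u%:~R * g%:R + v%:~R * q2%:R = 1 :> R.
  by rewrite -[g%:R]/((Posz g)%:~R) -[q2%:R]/((Posz q2)%:~R) -!intrM -intrD uv.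
rewrite {1}qE nE !natrM !intrM -[(Posz e)%:~R]/(e%:R).
transitivity (p%:~R / (q2%:R * g%:R) * (u%:~R * g%:R + v%:~R * q2%:R) : R).
  by rewrite uvR mulr1.
field.
by rewrite q2R gR eR.
Qed.

(** * Bounds for the number of divisors and of prime divisors *)

Lemma prime_power_ind (P : nat -> Prop) : P 1%N ->
  (forall p a m, prime p -> (0 < m)%N -> ~~ (p %| m)%N -> P m -> P (p ^ a.+1 * m)%N) ->
  forall n, (0 < n)%N -> P n.
Proof.
move=> P1 Pind; elim/ltn_ind => n IH n0.
have [n1|n1] := leqP n 1; first by have -> : n = 1%N by lia.
have p_pr := pdiv_prime n1; set p := pdiv n in p_pr.
have a0 : (0 < logn p n)%N by rewrite logn_gt0 mem_primes p_pr n0 pdiv_dvd.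
have [m pm nE] := pfactor_coprime p_pr n0.
have m0 : (0 < m)%N by move: n0; rewrite nE muln_gt0 => /andP[].
rewrite nE mulnC -(prednK a0); apply: Pind => //; first by rewrite -prime_coprime.
apply: IH => //; rewrite [X in (_ < X)%N]nE ltn_Pmulr //.
by rewrite -(exp1n (logn p n)) ltn_exp2r // prime_gt1.
Qed.

(* The divisor bound and the bound on the number of prime divisors are proved
   prime by prime; the finitely many primes below [B] only cost a constant. *)
Definition small_primes (B n : nat) : nat := \sum_(r < B) (prime r && (r %| n))%N.

Lemma small_primes_le (B n : nat) : (small_primes B n <= B)%N.
Proof.
rewrite -{2}[B]card_ord -sum1_card; apply: leq_sum => r _; exact: leq_b1.
Qed.

Lemma prime_dvd_ppow (r p a m : nat) : prime r -> prime p ->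
  (r %| p ^ a.+1 * m)%N = (r == p) || (r %| m)%N.
Proof. by move=> r_pr p_pr; rewrite Euclid_dvdM // Euclid_dvdX // dvdn_prime2 // andbT. Qed.

Lemma small_primes_ppow (B p a m : nat) : prime p -> ~~ (p %| m)%N ->
  small_primes B (p ^ a.+1 * m) = ((p < B) + small_primes B m)%N.
Proof.
move=> p_pr pm; have -> : ((p < B) = \sum_(r < B) (r == p :> nat) :> nat)%N.
  case: ltnP => pB; last by rewrite big1 // => r _; have := ltn_ord r; case: eqP => //; lia.
  rewrite (bigD1 (Ordinal pB)) //= eqxx big1 // => r; rewrite -val_eqE /=.
  by move=> /negbTE ->.
rewrite -big_split; apply: eq_bigr => r _ /=.
have [r_pr|nr] := boolP (prime r).
  rewrite prime_dvd_ppow //; case: eqP => [->|_] //=.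
  by rewrite (negbTE pm).
by case: eqP => // rp; rewrite rp p_pr in nr.
Qed.

Lemma size_primes_ppow (p a m : nat) : prime p -> (0 < m)%N -> ~~ (p %| m)%N ->
  size (primes (p ^ a.+1 * m)) = (size (primes m)).+1.
Proof.
move=> p_pr m0 pm; rewrite -[RHS]/(size (p :: primes m)); apply: perm_size; apply: uniq_perm.
- exact: primes_uniq.
- by rewrite /= primes_uniq andbT mem_primes (negbTE pm) !andbF.
move=> r; rewrite inE !mem_primes muln_gt0 expn_gt0 prime_gt0 // m0 /=.
have [r_pr|nr] := boolP (prime r); first by rewrite prime_dvd_ppow.
by case: eqP => // rp; rewrite rp p_pr in nr.
Qed.

(** As [B] is free, any c^omega(n) is bounded by a small power of n; the choice B = 256 = 4^4 gives
    4^omega(n) << n^(1/4). *)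
Lemma omega_bound (B n : nat) : (0 < B)%N -> (0 < n)%N ->
  (B ^ size (primes n) <= B ^ B * n)%N.
Proof.
move=> B0 n0; apply: (@leq_trans (B ^ small_primes B n * n)); last first.
  by rewrite leq_mul2r leq_pexp2l ?small_primes_le ?orbT.
move: n n0; apply: prime_power_ind => [|p a m p_pr m0 pm IH].
  by rewrite muln1 expn_gt0 B0.
rewrite size_primes_ppow // small_primes_ppow // expnS expnD mulnACA.
apply: leq_mul => //; case: ltnP => pB; first by rewrite expn1 leq_pmulr // expn_gt0 prime_gt0.
by rewrite expn0 mul1n (leq_trans pB) // expnS leq_pmulr // expn_gt0 prime_gt0.
Qed.

(** Each prime contributes a factor 2 (1 - 1/p) >= 1. *)
Lemma totient_ge (R : realType) (n : nat) : (0 < n)%N ->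
  n%:R <= (totient n)%:R * 2 ^+ size (primes n) :> R.
Proof.
move=> n0; rewrite totient_prod // -mulrA ler_peMr //.
have H (s : seq nat) : all prime s -> 1 <= \prod_(p <- s) (1 - p%:R^-1) * 2 ^+ size s :> R.
  elim: s => [_|p s IH /= /andP[p_pr /IH h]]; first by rewrite big_nil mul1r.
  rewrite big_cons exprS mulrACA.
  have p2 : 2 <= p%:R :> R by rewrite ler_nat prime_gt1.
  have : p%:R^-1 <= 2^-1 :> R by rewrite lef_pV2 ?posrE //; lra.
  by move: h; set P := _ * 2 ^+ _; set q := p%:R^-1; nra.
by apply: H; apply/allP => p; rewrite mem_primes => /andP[].
Qed.

(** From a + 1 <= k (a %/ k + 1) <= k 2^(a %/ k). *)
Lemma succ_exp_bound (k a : nat) : (0 < k)%N -> (a.+1 ^ k <= k ^ k * 2 ^ a)%N.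
Proof.
move=> k0; apply: (@leq_trans ((k * 2 ^ (a %/ k)) ^ k)).
  rewrite leq_exp2r //; apply: (@leq_trans (k * (a %/ k).+1)).
    by rewrite {1}(divn_eq a k) mulnS addnC mulnC -addSn leq_add2r ltn_mod.
  by rewrite leq_mul2l ltn_expl // orbT.
by rewrite expnMn leq_mul2l -expnM leq_exp2l // leq_trunc_div orbT.
Qed.

(** A prime p >= 2^k needs no constant, as p^a >= (2^a)^k >= (a + 1)^k. *)
Lemma local_divisor_bound (k a p : nat) : (0 < k)%N -> prime p ->
  (a.+1 ^ k <= (k ^ k) ^ (p < 2 ^ k)%N * p ^ a)%N.
Proof.
move=> k0 p_pr; have p2 := prime_gt1 p_pr; case: ltnP => pk.
  rewrite expn1; apply: leq_trans (succ_exp_bound a k0) _.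
  rewrite leq_mul2l; apply/orP; right.
  by case: a => // a; rewrite leq_exp2r.
rewrite expn0 mul1n; apply: (@leq_trans ((2 ^ a) ^ k)).
  by rewrite leq_exp2r // ltn_expl.
rewrite -expnM mulnC expnM; case: a => // a; by rewrite leq_exp2r.
Qed.

Lemma size_divisors_ppow (p a m : nat) : prime p -> (0 < m)%N -> ~~ (p %| m)%N ->
  (size (divisors (p ^ a.+1 * m)) <= a.+2 * size (divisors m))%N.
Proof.
move=> p_pr m0 pm; have p0 := prime_gt0 p_pr.
pose l := [seq (p ^ i * e)%N | i <- iota 0 a.+2, e <- divisors m].
have -> : (a.+2 * size (divisors m))%N = size l by rewrite size_allpairs size_iota.
apply: uniq_leq_size; first exact: divisors_uniq.
have n0 : (0 < p ^ a.+1 * m)%N by rewrite muln_gt0 expn_gt0 p0.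
move=> d; rewrite -dvdn_divisors // => dn.
have d0 := dvdn_gt0 n0 dn.
have [e pe dE] := pfactor_coprime p_pr d0.
have em : (e %| m)%N.
  have : (e %| p ^ a.+1 * m)%N by apply: dvdn_trans dn; rewrite dE dvdn_mulr.
  by rewrite Gauss_dvdr // coprimeXr // coprime_sym.
have la : (logn p d <= a.+1)%N.
  have := dvdn_leq_log p n0 dn.
  rewrite lognM ?expn_gt0 ?p0 // pfactorK //.
  have -> : logn p m = 0%N by apply/eqP; rewrite -leqn0 leqNgt logn_gt0 mem_primes (negbTE pm) !andbF.
  by rewrite addn0.
apply/allpairsP; exists (logn p d, e); split.
- by rewrite mem_iota.
- by rewrite -dvdn_divisors.
- by rewrite mulnC.
Qed.

Lemma size_divisors_exp (k n : nat) : (0 < k)%N -> (0 < n)%N ->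
  (size (divisors n) ^ k <= (k ^ k) ^ (2 ^ k) * n)%N.
Proof.
move=> k0 n0; apply: (@leq_trans ((k ^ k) ^ small_primes (2 ^ k) n * n)); last first.
  by rewrite leq_mul2r leq_pexp2l ?small_primes_le ?orbT // expn_gt0 k0.
move: n n0; apply: prime_power_ind => [|p a m p_pr m0 pm IH].
  by rewrite muln1 /= exp1n !expn_gt0 k0.
rewrite small_primes_ppow // expnD mulnACA.
apply: (@leq_trans (a.+2 ^ k * size (divisors m) ^ k)).
  by rewrite -expnMn leq_exp2r // size_divisors_ppow.
by apply: leq_mul => //; exact: local_divisor_bound.
Qed.

Lemma totient_leq (d : nat) : (totient d <= d)%N.
Proof.
rewrite totient_count_coprime big_mkord -[leqRHS]card_ord -sum1_card.
by apply: leq_sum => i _; exact: leq_b1.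
Qed.

(** * Growth of the heights and lower bounds for the averages *)

Section Growth.
Variables (R : realType) (alpha c1 c2 : R) (y : nat -> R).
Hypothesis y0 : forall n : nat, (0 < n)%N -> 0 < y n.
Hypotheses (c10 : 0 < c1) (c20 : 0 < c2).
Hypothesis yc : forall n : nat, (0 < n)%N ->
  c1 * (n%:R `^ (- alpha)) <= y n /\ y n <= c2 * (n%:R `^ (- alpha)).

(** Here n y_n << n^(-1/2), while 4^omega(d) << n^(1/4). The base 4 combines the sieve error
    2^omega(d) with the loss in phi(d) >= d / 2^omega(d). *)
Lemma height_upper (K : R) : 3 / 2 <= alpha -> 0 < K ->
  exists N : nat, forall n d : nat, (N <= n)%N -> (0 < d)%N -> (d <= n)%N ->
    K * 4 ^+ size (primes d) * (n%:R * y n) <= 1.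
Proof.
move=> al K0.
have [C CE] : {C : R | C = 256%:R ^+ 256} by exists (256%:R ^+ 256).
exists (Num.truncn ((K * c2) ^+ 4 * C)).+1 => n d Nn d0 dn.
have n0 : (0 < n)%N := leq_trans d0 dn.
have nR : 0 < n%:R :> R by rewrite ltr0n.
have n1 : 1 <= n%:R :> R by rewrite ler1n.
have nC : (K * c2) ^+ 4 * C <= n%:R.
  apply: ltW; apply: lt_le_trans (truncnS_gt _) _; by rewrite ler_nat.
pose s : R := n%:R `^ (1 / 2).
have s0 : 0 < s by rewrite powR_gt0.
have s2 : s ^+ 2 = n%:R.
  by rewrite -powR_mulrn ?(ltW s0) // -powRrM mul1r mulVf // powRr1 // ltW.
have ys : n%:R * y n * s <= c2.
  have [_ yn] := yc n0.
  have h1 : n%:R * s <= n%:R `^ alpha.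
    rewrite -{1}[n%:R](powRr1 (ltW nR)) -powRD ?lt0r_neq0 ?implybT //.
    by apply: ler_powR => //; lra.
  have h2 : n%:R `^ alpha * n%:R `^ (- alpha) = 1 :> R.
    by rewrite -powRD ?subrr ?powRr0 // lt0r_neq0 ?implybT.
  have p0 : 0 <= n%:R `^ (- alpha) :> R by exact: powR_ge0.
  have h3 : n%:R * s * n%:R `^ (- alpha) <= 1 by rewrite -[X in _ <= X]h2 ler_wpM2r.
  have h4 : 0 <= n%:R * s by rewrite mulr_ge0 // ltW.
  by have := ler_wpM2l h4 yn; have := ler_wpM2l (ltW c20) h3; lra.
set w : R := 4 ^+ size (primes d).
have w0 : 0 <= w by rewrite exprn_ge0.
have w4 : w ^+ 4 <= C * n%:R.
  have := @omega_bound 256 d isT d0; rewrite -(ler_nat R) natrM !natrX -CE => h.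
  have C0 : 0 <= C by rewrite CE; apply: exprn_ge0; exact: ler0n.
  rewrite /w -exprM mulnC exprM (_ : 4 ^+ 4 = 256%:R); last by rewrite -natrX.
  by apply: (le_trans h); rewrite ler_wpM2l // ler_nat.
have Kw : K * c2 * w <= s.
  rewrite -(ler_pXn2r (n := 4)) ?nnegrE ?(ltW s0) //; last by rewrite !mulr_ge0 // ltW.
  rewrite exprMn (_ : s ^+ 4 = n%:R * n%:R); last by rewrite -s2 -exprD.
  have k4 : 0 <= (K * c2) ^+ 4 by rewrite exprn_ge0 // mulr_ge0 // ltW.
  apply: (le_trans (ler_wpM2l k4 w4)); rewrite mulrA ler_wpM2r // ltW //.
rewrite -(ler_pM2r s0) mul1r -/w.
by have := ler_wpM2l (mulr_ge0 (ltW K0) w0) ys; lra.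
Qed.

(** The right side grows like n^(2 - alpha), faster than any power of the divisor function. The
    square serves [full_case], where small denominators are compared through d^2. *)
Lemma height_lower (c : R) : alpha < 2 -> 0 < c ->
  exists N : nat, forall n : nat, (N <= n)%N -> (0 < n)%N ->
    (size (divisors n))%:R ^+ 2 <= c * (n%:R ^+ 2 * y n).
Proof.
move=> al c0; pose b := 2 - alpha; have b0 : 0 < b by rewrite subr_gt0.
(* After raising to the power [m], the right side is at least a constant times n^2, against [C n] on
   the left. *)
pose m := (Num.truncn (2 / b)).+1.
have mb : 2 <= m%:R * b.
  have : 2 / b < m%:R by exact: truncnS_gt.
  by rewrite ltr_pdivrMr // => /ltW.
have m2 : (0 < m * 2)%N by rewrite muln_gt0.
pose C : nat := (((m * 2) ^ (m * 2)) ^ (2 ^ (m * 2)))%N.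
have cc : 0 < (c * c1) ^+ m by rewrite exprn_gt0 // mulr_gt0.
exists (Num.truncn (C%:R / (c * c1) ^+ m)).+1 => n Nn n0.
have nR : 0 < n%:R :> R by rewrite ltr0n.
have n1 : 1 <= n%:R :> R by rewrite ler1n.
have nC : C%:R / (c * c1) ^+ m <= n%:R.
  apply: ltW; apply: lt_le_trans (truncnS_gt _) _; by rewrite ler_nat.
have [yn _] := yc n0.
have n2y : c1 * n%:R `^ b <= n%:R ^+ 2 * y n.
  have -> : n%:R `^ b = n%:R ^+ 2 * n%:R `^ (- alpha) :> R.
    by rewrite /b powRD ?lt0r_neq0 ?implybT // powR_mulrn // ltW.
  by rewrite mulrCA ler_wpM2l // sqr_ge0.
apply: (@le_trans _ _ (c * (c1 * n%:R `^ b))); last by rewrite ler_pM2l.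
have pb : 0 <= n%:R `^ b :> R by exact: powR_ge0.
rewrite -(ler_pXn2r (n := m)) ?nnegrE ?sqr_ge0 //; last by rewrite !mulr_ge0 // ltW.
rewrite -exprM mulnC mulrA exprMn.
have h1 : n%:R ^+ 2 <= (n%:R `^ b) ^+ m :> R.
  have -> : (n%:R `^ b) ^+ m = n%:R `^ (b * m%:R) by rewrite powRrM powR_mulrn.
  have -> : n%:R ^+ 2 = n%:R `^ 2%:R :> R by rewrite powR_mulrn // ltW.
  by apply: ler_powR => //; rewrite mulrC.
apply: (@le_trans _ _ (C%:R * n%:R)).
  by rewrite -natrX -natrM ler_nat size_divisors_exp.
apply: (@le_trans _ _ ((c * c1) ^+ m * n%:R ^+ 2)); last by rewrite ler_pM2l.
move: nC; rewrite ler_pdivrMr // => nC.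
by rewrite expr2 mulrA ler_pM2r // mulrC.
Qed.

Variables (p : int) (q : nat) (g : R * R -> R) (r : R).
Hypotheses (q0 : (0 < q)%N) (copq : coprime `|p|%N q).
Hypotheses (al1 : 3 / 2 <= alpha) (al2 : alpha < 2).
Hypothesis g0 : forall z, upper_half z -> 0 <= g z.
Hypothesis gc : forall z, upper_half z -> {for z, continuous g}.
Hypothesis ginv : forall (h : SL2Z) z, upper_half z -> g (mob h z) = g z.
Hypothesis gr : (\int[(@lebesgue_measure R) \x (@lebesgue_measure R)]_(z in @fund_dom R)
     (g z / z.2 ^+ 2)%:E = r%:E)%E.

(* The inversion raises the height [y n] to [1 / ((q2 d)^2 y n)], which is bounded
   by a small constant exactly under the last hypothesis. *)
Lemma denominator_lower_bound (eps : R) : 0 < eps ->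
  exists (Y0 : R) (N : nat), 0 < Y0 /\ forall (n d q2 : nat) (p2 : int),
    (N <= n)%N -> (0 < d)%N -> (d <= n)%N -> (0 < q2)%N -> (q2 <= q)%N ->
    coprime `|p2|%N q2 -> coprime d q2 -> 1 < Y0 * (d%:R ^+ 2 * y n) ->
    (totient d)%:R * (3 / pi * r - eps) <=
      \sum_(i < d | coprime i d) g (p2%:~R / q2%:R + i%:R / d%:R, y n).
Proof.
move=> eps0; have [Y0 [K [Y00 K0 H]]] := primitive_lower_bound g0 gc ginv gr eps0.
have qR : 0 < q%:R ^+ 2 :> R by rewrite exprn_gt0 // ltr0n.
have [N HN] := height_upper al1 (mulr_gt0 K0 qR).
exists Y0, N; split => // n d q2 p2 Nn d0 dn q20 q2q cop2 codq2 dY.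
have n0 : (0 < n)%N := leq_trans d0 dn.
have yn := y0 n0.
have dR : 0 < d%:R :> R by rewrite ltr0n.
have q2R : 0 < q2%:R :> R by rewrite ltr0n.
have q21 : 1 <= q2%:R :> R by rewrite ler1n.
have [x' ->] := primitive_inversion ginv q20 d0 cop2 codq2 yn.
have D0 : 0 < (q2 * d)%:R ^+ 2 * y n by rewrite mulr_gt0 // exprn_gt0 // natrM mulr_gt0.
apply: H => //; first by rewrite invr_gt0.
  rewrite -[Y0]invrK ltf_pV2 ?posrE ?invr_gt0 //.
  rewrite -(ltr_pM2l Y00) mulfV ?lt0r_neq0 //; apply: (lt_le_trans dY).
  rewrite ler_pM2l // ler_pM2r // natrM exprMn ler_peMl ?sqr_ge0 //.
  by rewrite exprn_ege1.
have w0 : 0 < 2 ^+ size (primes d) :> R by rewrite exprn_gt0.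
have F := HN n d Nn d0 dn.
have T := totient_ge R d0.
(* Clearing the inverted height and multiplying by 2^omega(d) leaves phi(d) 2^omega(d) on the right,
   which is at least d. *)
rewrite -(ler_pM2r w0) -(ler_pM2r D0).
set phi := (totient d)%:R in T *; set w := 2 ^+ size (primes d) in w0 T *.
have -> : phi * ((q2 * d)%:R ^+ 2 * y n)^-1 * w * ((q2 * d)%:R ^+ 2 * y n) = phi * w.
  by rewrite mulrAC mulfVK // lt0r_neq0.
apply: le_trans T.
have w2 : w * w = 4 ^+ size (primes d).
  by rewrite /w -exprMn; congr (_ ^+ _); ring.
have -> : K * w * w * ((q2 * d)%:R ^+ 2 * y n) =
   d%:R * (K * q2%:R ^+ 2 * 4 ^+ size (primes d) * (d%:R * y n)).
  by rewrite -w2 natrM; ring.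
rewrite ler_piMr ?(ltW dR) //; apply: le_trans F.
have w4 : 0 <= 4 ^+ size (primes d) :> R by rewrite exprn_ge0.
have dnR : d%:R <= n%:R :> R by rewrite ler_nat.
have qq : q2%:R ^+ 2 <= q%:R ^+ 2 :> R.
  by rewrite ler_pXn2r ?nnegrE ?ler0n // ler_nat.
apply: ler_pM.
- by rewrite mulr_ge0 // mulr_ge0 ?sqr_ge0 // ltW.
- by rewrite mulr_ge0 // ltW.
- by rewrite ler_wpM2r // ler_pM2l.
- by rewrite ler_pM2r.
Qed.

Lemma primitive_case (eps : R) : 0 < eps ->
  exists N : nat, forall n : nat, (N <= n)%N -> N_q_pr q n ->
    (totient n)%:R * (3 / pi * r - eps) <=
      \sum_(j < n | coprime j n) g (p%:~R / q%:R + j%:R / n%:R, y n).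
Proof.
move=> eps0; have [Y0 [N [Y00 H]]] := denominator_lower_bound eps0.
(* Half of [Y0] gives the strict inequality, as [n] has at least one divisor. *)
have [N' HN'] := height_lower al2 (divr_gt0 Y00 (ltr0n R 2)).
exists (maxn N N') => n; rewrite geq_max => /andP[Nn N'n] /andP[n0 con].
apply: H => //.
have yn := y0 n0; have := HN' n N'n n0.
have : 1 <= (size (divisors n))%:R ^+ 2 :> R.
  by rewrite exprn_ege1 // ler1n; case: (divisors n) (divisors_id n0) => // .
have : 0 < n%:R ^+ 2 * y n by rewrite mulr_gt0 // exprn_gt0 // ltr0n.
by move: (n%:R ^+ 2 * y n) => t; lra.
Qed.

Lemma shift_sum (h : nat -> R) (n k : nat) : (forall j, h (j + n)%N = h j) ->
  \sum_(j < n) h (k + j)%N = \sum_(j < n) h j.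
Proof.
move=> hp; elim: k => [//|k <-].
have E : \sum_(j < n.+1) h (k + j)%N = \sum_(j < n.+1) h (k + j)%N by [].
rewrite {1}big_ord_recl big_ord_recr /= hp addn0 addrC in E.
have {}E := addrI (h k) E.
by rewrite -E; apply: eq_bigr => j _; rewrite /bump /= addnA addn1.
Qed.

(* The fractions [j/n] with reduced denominator [d] too small for the previous
   lemma are negligible: there are at most [tau(n)] such [d], each of size at most
   [e n / tau(n)] by the divisor bound. *)
Lemma full_case (eps : R) : 0 < eps ->
  exists N : nat, forall n : nat, (N <= n)%N -> N_q q n ->
    n%:R * (3 / pi * r - eps) <=
      \sum_(j < n) g (p%:~R / q%:R + j%:R / n%:R, y n).
Proof.
move=> eps0; pose kap := 3 / pi * r.
have r0 : 0 <= r.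
  rewrite -lee_fin -gr; apply: integral_ge0 => z /fund_dom_upper zH.
  by rewrite lee_fin divr_ge0 ?sqr_ge0 // g0.
have kap0 : 0 <= kap by rewrite mulr_ge0 // divr_ge0 // pi_ge0.
have k1 : 0 < kap + 1 by rewrite ltr_pwDr.
(* Small denominators lose [e * kap] of the total and large ones [e], both per unit of [n]. *)
have [e e0 eE] : exists2 e : R, 0 < e & e * (kap + 1) = eps.
  by exists (eps / (kap + 1)); rewrite ?divr_gt0 // divfK // lt0r_neq0.
have [Y0 [N [Y00 H]]] := denominator_lower_bound e0.
have c0 : 0 < e ^+ 2 * Y0 by rewrite mulr_gt0 // exprn_gt0.
have [N' HN'] := height_lower al2 c0.
exists (maxn N N') => n; rewrite geq_max => /andP[Nn N'n] /andP[n0 gd].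
have [p2 [k [q2 [q20 cop2 con q2q xE]]]] := split_fraction q0 copq gd n0.
have yn := y0 n0; have nR : 0 < n%:R :> R by rewrite ltr0n.
(* Replacing p/q by p2/q2 shifts [j] cyclically by k modulo n, which leaves the full sum
   unchanged. *)
have -> : \sum_(j < n) g (p%:~R / q%:R + j%:R / n%:R, y n) =
    \sum_(j < n) g (p2%:~R / q2%:R + j%:R / n%:R, y n).
  pose h (j : nat) := g (p2%:~R / q2%:R + j%:R / n%:R, y n).
  have hp j : h (j + n)%N = h j.
    rewrite /h -[RHS](inv_periodic 1 _ ginv yn); congr g; congr pair.
    by rewrite natrD; field; rewrite lt0r_neq0 //= ?pnatr_eq0 -?lt0n.
  rewrite -[RHS](@shift_sum h n `|(k %% n)%Z|%N hp); apply: eq_bigr => j _.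
  rewrite /h -[RHS](inv_periodic (k %/ n)%Z _ ginv yn) xE; congr g; congr pair.
  rewrite natrD natr_absz ger0_norm; last by rewrite modz_ge0 // eqz_nat -lt0n.
  rewrite {1}(divz_eq k n) intrD intrM -[(Posz n)%:~R]/(n%:R).
  by field; rewrite lt0r_neq0 //= ?pnatr_eq0 -?lt0n.
rewrite (sum_by_denominator (fun t => g (p2%:~R / q2%:R + t, y n)) n0).
pose big (d : nat) := 1 < Y0 * (d%:R ^+ 2 * y n).
have phiS : \sum_(d < n.+1 | (d %| n)%N) (totient d)%:R = n%:R :> R.
  by rewrite -natr_sum cyclic.sum_totient_dvd.
have small : \sum_(d < n.+1 | (d %| n)%N && ~~ big d) (totient d)%:R <= e * n%:R.
  have t0 : 0 < (size (divisors n))%:R :> R.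
    by rewrite ltr0n; case: (divisors n) (divisors_id n0).
  have tE : #|[pred d : 'I_n.+1 | (d %| n)%N]| = size (divisors n).
    rewrite -sum1_card -(big_mkord (fun d => d %| n)%N (fun=> 1%N)) -big_filter sum1_size.
    apply: perm_size; apply: uniq_perm; rewrite ?divisors_uniq ?filter_uniq ?iota_uniq //.
    move=> d; rewrite mem_filter mem_index_iota -dvdn_divisors //=.
    by case: (boolP (d %| n)%N) => // dn; rewrite ltnS dvdn_leq.
  apply: (@le_trans _ _ (\sum_(d < n.+1 | (d %| n)%N) (e * n%:R / (size (divisors n))%:R))).
    rewrite big_mkcondr; apply: ler_sum => d dn; rewrite /big -leNgt.
    have b0 : 0 <= e * n%:R / (size (divisors n))%:R.
      by rewrite divr_ge0 ?mulr_ge0 // ltW.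
    case: ifP => // small; rewrite ler_pdivlMr //.
    apply: (@le_trans _ _ (d%:R * (size (divisors n))%:R)).
      by rewrite ler_wpM2r // ler_nat totient_leq.
    rewrite -(ler_pXn2r (n := 2)) ?nnegrE ?mulr_ge0 ?(ltW e0) //.
    have := HN' n N'n n0; rewrite !exprMn => h.
    have d2 : 0 <= d%:R ^+ 2 :> R by rewrite sqr_ge0.
    have := ler_wpM2l d2 h.
    have en : 0 <= e ^+ 2 * n%:R ^+ 2 by rewrite mulr_ge0 // sqr_ge0.
    have := ler_wpM2l en small; lra.
  by rewrite sumr_const -[X in _ *+ X]/#|[pred d : 'I_n.+1 | (d %| n)%N]| tE -[leLHS]mulr_natr divfK // lt0r_neq0.
rewrite (bigID (fun d : 'I_n.+1 => big d)) /=.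
apply: (@le_trans _ _ (\sum_(d < n.+1 | (d %| n)%N && big d) (totient d)%:R * (kap - e))).
  rewrite -mulr_suml.
  have := phiS; rewrite (bigID (fun d : 'I_n.+1 => big d)) /=.
  set S1 := \sum_(_ < _ | _ && big _) _; set S2 := \sum_(_ < _ | _ && ~~ _) _ in small *.
  move=> S12; have S20 : 0 <= S2 by apply: sumr_ge0.
  rewrite -/kap -eE; have := ler_wpM2l kap0 small; nra.
apply: ler_wpDr.
  by apply: sumr_ge0 => d _; apply: sumr_ge0 => i _; exact: g0.
apply: ler_sum => d /andP[dn bd].
apply: H => //.
- exact: dvdn_gt0 dn.
- exact: dvdn_leq.
- exact: coprime_dvdl con.
Qed.

End Growth.

(** * From lower bounds to convergence *)

Lemma test_fun_bounded (R : realType) (f : R * R -> R) : test_fun f ->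
  exists2 M : R, 0 < M & forall z, upper_half z -> `|f z| <= M.
Proof.
move=> [fc finv [K [cK KH Kf]]].
have cfK : compact (f @` K).
  apply: continuous_compact => //; apply: continuous_in_subspaceT => z.
  by rewrite inE => /KH; exact: fc.
have [M [_ HM]] := compact_bounded cfK.
have HM1 := HM (`|M| + 1) (ltr_pwDr ltr01 (ler_norm M)).
exists (`|M| + 1); first by rewrite ltr_pwDr.
move=> z zH; have [->|fz] := eqVneq (f z) 0; first by rewrite normr0 addr_ge0.
have [h Kh] := Kf z zH fz.
by rewrite -(finv h z zH); apply: HM1; exists (mob h z).
Qed.

Section Affine.
Variables (R : realType) (f : R * R -> R).
Hypothesis tf : test_fun f.

Let mu2 := ((@lebesgue_measure R) \x (@lebesgue_measure R))%E.

Lemma test_fun_integrable : mu2.-integrable (@fund_dom R) (EFin \o (fun z => f z / z.2 ^+ 2)).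
Proof.
have [M M0 fM] := test_fun_bounded tf; case: (tf) => fc _ _.
have mD := @measurable_fund_dom R.
have mq : measurable_fun (@fund_dom R) (EFin \o (fun z : R * R => M * (z.2 ^+ 2)^-1)).
  by apply/measurable_EFinP; apply: measurable_funM => //; exact: inv_sqr_snd_measurable.
have iq : mu2.-integrable (@fund_dom R) (EFin \o (fun z : R * R => M * (z.2 ^+ 2)^-1)).
  apply/integrableP; split => //.
  apply: (@le_lt_trans _ _ (M * (pi / 3))%:E); last exact: ltry.
  rewrite EFinM -fund_dom_area -ge0_integralZl //; first last.
  - by rewrite lee_fin ltW.
  - by move=> z _; rewrite lee_fin invr_ge0 sqr_ge0.
  - by apply/measurable_EFinP; exact: inv_sqr_snd_measurable.
  rewrite le_eqVlt; apply/orP; left; apply/eqP; apply: eq_integral => z _.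
  by rewrite /= ger0_norm ?EFinM // mulr_ge0 ?invr_ge0 ?sqr_ge0 // ltW.
have mf : measurable_fun (@fund_dom R) (EFin \o (fun z => f z / z.2 ^+ 2)).
  by apply/measurable_EFinP; exact: h_measurable_dom.
apply: (le_integrable _ _ _ iq); [exact: mD|exact: mf|].
move=> z /fund_dom_upper zH; rewrite /= lee_fin normrM [leRHS]ger0_norm; last first.
  by rewrite mulr_ge0 ?invr_ge0 ?sqr_ge0 // ltW.
rewrite [X in _ * X]ger0_norm ?invr_ge0 ?sqr_ge0 // ler_wpM2r ?invr_ge0 ?sqr_ge0 //.
exact: fM.
Qed.

Lemma affine_integral (a s : R) :
  (\int[mu2]_(z in @fund_dom R) ((a + s * f z) / z.2 ^+ 2)%:E =
   (pi / 3 * (a + s * mu_M f))%:E)%E.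
Proof.
have mD := @measurable_fund_dom R; have p0 := @pi_gt0 R.
have iF := test_fun_integrable.
have mD' : measurable (@fund_dom R : set (measurableTypeR R * measurableTypeR R)%type).
  exact: mD.
have iA : mu2.-integrable (@fund_dom R) (EFin \o (fun z : R * R => z.2 ^- 2)).
  apply/integrableP; split; first by apply/measurable_EFinP; exact: inv_sqr_snd_measurable.
  apply: (@le_lt_trans _ _ (pi / 3)%:E); last exact: ltry.
  rewrite -fund_dom_area le_eqVlt; apply/orP; left; apply/eqP.
  by apply: eq_integral => z _; rewrite /= ger0_norm // invr_ge0 sqr_ge0.
have FE : (\int[mu2]_(z in @fund_dom R) (f z / z.2 ^+ 2)%:E = (pi / 3 * mu_M f)%:E)%E.
  rewrite -[LHS]fineK; last exact: integrable_fin_num iF.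
  congr EFin; rewrite /mu_M /Rintegral mulrA.
  move: (fine _) => I.
  by move: (pi : R) p0 => w w0; field; rewrite lt0r_neq0.
have EA : (\int[mu2]_(z in @fund_dom R) (a%:E * (EFin \o (fun z : R * R => z.2 ^- 2)) z) =
    (pi / 3 * a)%:E)%E.
  rewrite (integralZl mD' iA).
  by rewrite fund_dom_area -EFinM mulrC.
have EF : (\int[mu2]_(z in @fund_dom R) (s%:E * (EFin \o (fun z : R * R => (f z / z.2 ^+ 2)%R)) z) =
    (pi / 3 * (s * mu_M f))%:E)%E.
  rewrite (integralZl mD' iF).
  by rewrite FE -EFinM mulrCA.
have iA' := integrableZl mD' a iA; have iF' := integrableZl mD' s iF.
rewrite mulrDr EFinD -EA -EF -(integralD mD' iA' iF').
by apply: eq_integral => z _; rewrite /= -!EFinM -EFinD; congr EFin; ring.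
Qed.

Lemma average_dist (n : nat) (P : pred 'I_n) (m a c e : R) (u : 'I_n -> R) : 0 < m ->
  \sum_(j < n | P j) 1 = m ->
  m * (a + c - e) <= \sum_(j < n | P j) (a + u j) ->
  m * (a - c - e) <= \sum_(j < n | P j) (a - u j) ->
  `|m^-1 * \sum_(j < n | P j) u j - c| <= e.
Proof.
move=> m0 mE; have aE : \sum_(j < n | P j) a = m * a.
  by rewrite -mE mulr_suml; apply: eq_bigr => j _; rewrite mul1r.
rewrite sumrB big_split /= !aE; move: (\sum_(j < n | P j) u j) => S hp hm.
rewrite -(ler_pM2l m0) -[X in X * `|_|](gtr0_norm m0) -normrM mulrBr mulrA mulfV ?gt_eqF // mul1r.
rewrite ler_norml; nra.
Qed.

Lemma affine_continuous (a s : R) (z : R * R) : upper_half z ->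
  {for z, continuous (fun w => a + s * f w)}.
Proof.
case: tf => fc _ _ zH; apply: cvgD; first exact: cvg_cst.
by apply: cvgM; [exact: cvg_cst|exact: fc].
Qed.

Lemma affine_invariant (a s : R) (h : SL2Z) (z : R * R) : upper_half z ->
  a + s * f (mob h z) = a + s * f z.
Proof. by case: tf => _ finv _ zH; rewrite finv. Qed.

End Affine.

(* Applying the lower bound to [M + f] and to [M - f], with [M] a bound for
   [|f|], gives both inequalities, since the total mass is one. *)
Lemma conv_along_average (R : realType) (P : pred nat) (Q : nat -> pred nat)
    (m : nat -> R) (z : nat -> nat -> R * R) :
  (forall n, P n -> 0 < m n) ->
  (forall n, \sum_(j < n | Q n j) 1 = m n) ->
  (forall (g : R * R -> R) (r eps : R),
     (forall w, upper_half w -> 0 <= g w) ->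
     (forall w, upper_half w -> {for w, continuous g}) ->
     (forall (h : SL2Z) w, upper_half w -> g (mob h w) = g w) ->
     (\int[(@lebesgue_measure R) \x (@lebesgue_measure R)]_(w in @fund_dom R)
        (g w / w.2 ^+ 2)%:E = r%:E)%E ->
     0 < eps -> exists N : nat, forall n, (N <= n)%N -> P n ->
     m n * (3 / pi * r - eps) <= \sum_(j < n | Q n j) g (z n j)) ->
  forall f, test_fun f ->
  conv_along P (fun n => (m n)^-1 * \sum_(j < n | Q n j) f (z n j)) (mu_M f).
Proof.
move=> m0 mE lower f tf e e0; have [M M0 fM] := test_fun_bounded tf.
have affine (s : R) : s = 1 \/ s = -1 -> exists N : nat, forall n, (N <= n)%N -> P n ->
    m n * (M + s * mu_M f - e / 2) <= \sum_(j < n | Q n j) (M + s * f (z n j)).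
  move=> sE; have g0 w : upper_half w -> 0 <= M + s * f w.
    by move/fM; rewrite ler_norml => /andP[? ?]; case: sE => ->; lra.
  have [N HN] := lower _ _ _ g0 (@affine_continuous R f tf M s)
    (@affine_invariant R f tf M s) (affine_integral tf M s)
    (divr_gt0 e0 (ltr0Sn _ 1)).
  exists N => n nN nP; have := HN n nN nP.
  suff -> : 3 / pi * (pi / 3 * (M + s * mu_M f)) = M + s * mu_M f by [].
  by move: (pi : R) (@pi_gt0 R) => w w0; field; rewrite lt0r_neq0.
have [N1 H1] := affine 1 (or_introl erefl).
have [N2 H2] := affine (-1) (or_intror erefl).
exists (maxn N1 N2) => n; rewrite geq_max => /andP[nN1 nN2] nP.
apply: (@le_lt_trans _ _ (e / 2)); last by rewrite ltr_pdivrMr //; lra.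
apply: (average_dist (a := M)) => //; first exact: m0.
- by have := H1 n nN1 nP; rewrite mul1r; under eq_bigr do rewrite mul1r.
- by have := H2 n nN2 nP; rewrite mulN1r; under eq_bigr do rewrite mulN1r.
Qed.

Lemma sum_coprime_totient (R : realType) (n : nat) :
  \sum_(j < n | coprime j n) (1 : R) = (totient n)%:R.
Proof.
rewrite totient_count_coprime big_mkord natr_sum [LHS]big_mkcond /=.
by apply: eq_bigr => j _; rewrite coprime_sym; case: ifP.
Qed.

Theorem theorem1p2 (R : realType) (p : int) (q : nat) (y : nat -> R) (alpha : R) :
  (0 < q)%N -> coprime `|p|%N q ->
  (forall n : nat, (0 < n)%N -> 0 < y n) ->
  (exists c1 c2 : R, [/\ 0 < c1, 0 < c2 &
     forall n : nat, (0 < n)%N ->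
       c1 * (n%:R `^ (- alpha)) <= y n /\ y n <= c2 * (n%:R `^ (- alpha))]) ->
  2 / (1 + 2 * theta R) <= alpha -> alpha < 2 ->
  let x : R := p%:~R / q%:R in
  (forall f : R * R -> R, test_fun f ->
     conv_along (N_q q) (fun n => delta_nxy n x (y n) f) (mu_M f)) /\
  (forall f : R * R -> R, test_fun f ->
     conv_along (N_q_pr q) (fun n => delta_pr_nxy n x (y n) f) (mu_M f)).
Proof.
move=> q0 copq y0 [c1 [c2 [c10 c20 yc]]] al1 al2 x.
(* For theta = 7/64 the lower end of the range is 64/39. *)
have al : 3 / 2 <= alpha by apply: le_trans al1; rewrite /theta ler_pdivlMr; lra.
split.
- apply: (conv_along_average (Q := fun _ => xpredT) (m := fun n => n%:R)
    (z := fun n j => (x + j%:R / n%:R, y n))).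
  + by move=> n /andP[n0 _]; rewrite ltr0n.
  + by move=> n; rewrite big_const_ord iter_addr_0.
  + by move=> g r eps g0 gc ginv gr; exact: (full_case y0 c10 c20 yc q0 copq al al2 g0 gc ginv gr).
- apply: (conv_along_average (Q := fun n => coprime^~ n) (m := fun n => (totient n)%:R)
    (z := fun n j => (x + j%:R / n%:R, y n))).
  + by move=> n /andP[n0 _]; rewrite ltr0n totient_gt0.
  + exact: sum_coprime_totient.
  + by move=> g r eps g0 gc ginv gr; exact: (primitive_case y0 c10 c20 yc q0 copq al al2 g0 gc ginv gr).
Qed.
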